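(* The two specific elements $A,B\in\mathcal G(3333)_{4,+}$ described in the context (with dual generators $\check A,\check B$) satisfy the box jellyfish relations $$\begin{pmatrix} f\cdot j(\check A)\\ f\cdot j(\check B)\end{pmatrix}=R\begin{pmatrix} f(A\circ A)\\ f(A\circ B)\\ f(B\circ A)\\ f(B\circ B)\end{pmatrix},\qquad \begin{pmatrix} f\cdot j(A)\\ f\cdot j(B)\end{pmatrix}=\check R\begin{pmatrix} f(\check A\circ \check A)\\ f(\check A\circ \check B)\\ f(\check B\circ \check A)\\ f(\check B\circ \check B)\end{pmatrix},$$ where $$R=\begin{pmatrix} \frac{1}{2}(\sqrt5-2) & \frac14(-1-\sqrt5) & \frac14(-1-\sqrt5) & \frac1{12}(1-\sqrt5)\\[3pt] \frac14(3-3\sqrt5) & \frac12(2-\sqrt5) & \frac12(2-\sqrt5) & \frac14(1+\sqrt5)\end{pmatrix}$$ and $$\check R=\begin{pmatrix} \lambda_{64,0,-216,0,121}^{(-0.8422)} & \lambda_{64,0,-24,0,1}^{(-0.2185)} & \lambda_{64,0,-24,0,1}^{(-0.2185)} & \lambda_{5184,0,-3024,0,121}^{(0.7349)}\\[3pt] \lambda_{64,0,-1296,0,81}^{(-0.2504)} & \lambda_{64,0,-216,0,121}^{(0.8422)} & \lambda_{64,0,-216,0,121}^{(0.8422)} & \lambda_{64,0,-24,0,1}^{(0.2185)}\end{pmatrix};$$ here $\lambda^{(z)}_{a_m,\dots,a_0}$ denotes the root of $\sum_i a_ix^i$ closest to $z$.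
   Context: **Diagrams.** Let $f^{(k)}$ be the Jones–Wenzl idempotent on $k$ strands. For $S,T$ both in $P_{n,+}$ or both in $P_{n,-}$: $S\circ T$ is the diagram with $S$ on the left and $T$ on the right, distinguished regions $\star$ of both at the top, joined to each other by $n-1$ parallel strings, with the remaining $n+1$ strings of each running down to the bottom boundary; the external distinguished region is the outer region at the top and left. $j(S)$ is the diagram in which all $2n$ strings of $S$ run down to the bottom (the $\star$ of $S$ being immediately to the left of its strings) and one additional string forms an arc from the bottom boundary, over the top of $S$, back to the bottom boundary; the external distinguished region is outside this arc. $f(S\circ T)$ and $f\cdot j(S)$ denote the diagrams obtained by attaching $f^{(2n+2)}$ to the $2n+2$ strings at the bottom of $S\circ T$ and $j(S)$. **Graph planar algebra.** For a finite bipartite graph $\Gamma$ with root $*$ and Perron–Frobenius eigenvector $\dim$ (eigenvalue $\delta$), the (spherical) graph planar algebra $\mathcal G(\Gamma)$ has $\mathcal G(\Gamma)_{n,+}$ (resp. $\mathcal G(\Gamma)_{n,-}$) equal to the complex functions on closed walks (loops) $\gamma=(\gamma(0),\dots,\gamma(2n-1))$ of length $2n$ with $\gamma(0)$ at even (resp. odd) distance from $*$. An $n$-box is a rectangle with $n$ strings on top and $n$ on the bottom and distinguished region $\star$ on the left; its regions are numbered clockwise from $\star$ ($0$ = left, $1,\dots,n-1$ = top, $n$ = right, $n+1,\dots,2n-1$ = bottom), and $\gamma(i)$ labels region $i$. Tangles act by Jones' state sum, each local maximum or minimum of a string contributing $\sqrt{\dim(v)/\dim(w)}$, with $v$ the vertex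 on the convex side and $w$ the vertex on the other side. The adjoint is $x^*(\gamma)=\overline{x(\gamma^{\rm rev})}$, where $\gamma^{\rm rev}$ is $\gamma$ traversed backwards from the same base point. An element is uncappable (a lowest weight vector) if joining any two adjacent boundary points by a cap gives $0$. The Fourier transform is $\mathcal F(x)(\gamma)=\sqrt{\frac{\dim\gamma(1)\dim\gamma(n+1)}{\dim\gamma(0)\dim\gamma(n)}}\;x(\gamma(1),\dots,\gamma(2n-1),\gamma(0))$, and $\rho=\mathcal F^2$. If $\rho(S)=\omega_SS$ and $\sigma_S^2=\omega_S$ is a chosen square root, then $\check S=\sigma_S^{-1}\mathcal F(S)$. **The generators.** $\Gamma=3333$ is the tree with a central vertex $c$ and four arms $0,1,2,3$ with $3$ edges each; the root $*$ is the end of arm $0$; $\delta^2=3+\sqrt5$. Let $u_j$ be the neighbour of $c$ on arm $j$. Here $n=4$; for a word $a=a_1a_2a_3a_4$ let $\ell(a)=(u_{a_1},c,u_{a_2},c,u_{a_3},c,u_{a_4},c)$. $A$ and $B$ are the unique uncappable elements of $\mathcal G(\Gamma)_{4,+}$ with $\rho(A)=A$, $\rho(B)=B$ ($\sigma_A=\sigma_B=1$), vanishing on $\ell(1111),\ell(2222),\ell(3333)$, and with $A(\ell(a))=\kappa\mathbf A(a)$, $B(\ell(a))=\kappa\mathbf B(a)$ for the words in the table, where $\kappa>0$ is the constant for which $\mathrm{Tr}(A^2)=\frac12(11+5\sqrt5)$ (and then $\mathrm{Tr}(B^2)=6+3\sqrt5$, $\mathrm{Tr}(AB)=0$). They are self-adjoint.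 Table (word: $\mathbf A$; $\mathbf B$): 1112: $\frac{2-\sqrt5}{4}$; $\frac{7\sqrt5-15}{8}$. 1113: $\frac{3\sqrt5-7}{8}$; $\frac{\sqrt5-3}{8}$. 1122: $\frac{\sqrt5-3}{4}$; $\frac{2-\sqrt5}{2}$. 1123: $\frac{3-\sqrt5}{8}$; $\frac14$. 1132: $\frac{3-\sqrt5}{8}$; $\frac14$. 1133: $\frac{3-\sqrt5}{4}$; $\frac{2-\sqrt5}{2}$. 1212: $\frac{\sqrt5-1}{4}$; $\frac{5-3\sqrt5}{4}$. 1213: $\frac{-1-\sqrt5}{8}$; $\frac{2-\sqrt5}{4}$. 1222: $\frac{2-\sqrt5}{4}$; $\frac{7\sqrt5-15}{8}$. 1223: $\frac{\sqrt5-1}{8}$; $\frac{5-3\sqrt5}{8}$. 1232: $\frac{\sqrt5-1}{8}$; $\frac{1+\sqrt5}{8}$. 1233: $-\frac14$; $\frac{3\sqrt5-7}{8}$. 1313: $\frac{3-\sqrt5}{4}$; $\frac12$. 1322: $\frac{\sqrt5-1}{8}$; $\frac{5-3\sqrt5}{8}$. 1323: $\frac14$; $\frac{\sqrt5-5}{8}$. 1332: $-\frac14$; $\frac{3\sqrt5-7}{8}$. 1333: $\frac{3\sqrt5-7}{8}$; $\frac{\sqrt5-3}{8}$. 2223: $\frac{3-\sqrt5}{8}$; $\frac{9-4\sqrt5}{4}$. 2233: $0$; $\sqrt5-2$. 2323: $-\frac12$; $\frac{3\sqrt5-7}{4}$. 2333: $\frac{3-\sqrt5}{8}$; $\frac{9-4\sqrt5}{4}$.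 *)

(* Defs.v *)
From HB Require Import structures.
From mathcomp Require Import all_boot all_order all_algebra.
From mathcomp Require Import all_classical reals.
From mathcomp Require Import complex.
Set Implicit Arguments.
Unset Strict Implicit.
Unset Printing Implicit Defensive.
Import Order.TTheory GRing.Theory Num.Theory.
Local Open Scope ring_scope.
Local Open Scope complex_scope.

(* The tree 3333: [None] is the central vertex c, and [Some (j, k)] is the
   vertex of arm j at distance k + 1 from c. *)
Definition vertex : finType := option ('I_4 * 'I_3).

Definition center : vertex := None.
Definition arm_vertex (j : 'I_4) (k : 'I_3) : vertex := Some (j, k).
Definition root_vertex : vertex := arm_vertex 0 ord_max.

Definition child (v w : vertex) : bool :=
  match v, w with
  | None, Some (_, k) => k == 0
  | Some (j, k), Some (j', k') => (j == j') && (nat_of_ord k' == k.+1)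
  | _, None => false
  end.

Definition adj : rel vertex := [rel v w | child v w || child w v].

Definition dist_root (v : vertex) : nat :=
  match v with
  | None => 3
  | Some (j, k) => if j == 0 then (2 - k)%N else (4 + k)%N
  end.

Definition even_vertex (v : vertex) : bool := ~~ odd (dist_root v).

(* Closed walks (g(0), ..., g(2n-1)) of length 2n; the boolean b is true for
   the shading + (g(0) even) and false for -.  Only n > 0 is meaningful. *)
Definition is_loop (n : nat) (b : bool) (g : seq vertex) : bool :=
  [&& size g == n.*2, cycle adj g & even_vertex (head root_vertex g) == b].

Definition loop (n : nat) (b : bool) : Type :=
  {g : n.*2.-tuple vertex | is_loop n b g}.

HB.instance Definition _ n b := SubFinite.on (loop n b).

Definition loop_seq (n : nat) (b : bool) (g : loop n b) : seq vertex := tval (val g).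
Coercion loop_seq : loop >-> seq.

(* Region labels are indexed cyclically. *)
Definition label (g : seq vertex) (i : nat) : vertex :=
  nth root_vertex g (i %% size g).

Section GraphPlanarAlgebra.
Context (R : realType).

Definition delta : R := Num.sqrt (3 + Num.sqrt 5).

Definition perron_frobenius (dim : vertex -> R) : Prop :=
  (forall v, 0 < dim v) /\
  (forall v, \sum_(w | adj v w) dim w = delta * dim v).

(* Quantum integers at q + q^-1 = delta. *)
Fixpoint qnum (k : nat) : R :=
  match k with
  | 0%N => 0
  | k1.+1 => match k1 with
             | 0%N => 1
             | k2.+1 => delta * qnum k1 - qnum k2
             end
  end.

Definition gpa (n : nat) (b : bool) : Type := {ffun loop n b -> R[i]}.

(* The value of x on a sequence of vertices, extended by 0 to the sequences
   that are not loops of the right length and shading. *)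
Definition value (n : nat) (b : bool) (x : gpa n b) (g : seq vertex) : R[i] :=
  oapp x 0 (obind insub (insub g : option (n.*2.-tuple vertex))).

(* A diagram in a horizontal strip, drawn in Morse position, is the list of its
   events from top to bottom.  The argument of type [nat] is the number of
   strings to the left of the event; [Box n b i x] is an n-box labelled by x,
   with n strings on top, n strings at the bottom and star on the left. *)
Inductive event : Type :=
  | Max of nat
  | Min of nat
  | Box n b of nat & gpa n b.

Definition strings_below (e : event) (m : nat) : nat :=
  match e with Max _ => m.+2 | Min _ => m.-2 | Box _ _ _ _ => m end.

(* Replaces the i-th entry w of p by w, v, w. *)
Definition bulge (i : nat) (v : vertex) (p : seq vertex) : seq vertex :=
  take i.+1 p ++ v :: drop i p.

Section StateSum.
Context (dim : vertex -> R).

(* v is on the convex side. *)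
Definition turn (v w : vertex) : R[i] := (Num.sqrt (dim v / dim w))%:C.

(* The weight of an event when the regions met just above it (resp. just below
   it) are labelled, from left to right, by p (resp. by q).  It is 0 when p
   and q label some region inconsistently.  The regions around a box are read
   clockwise from the star. *)
Definition weight (e : event) (p q : seq vertex) : R[i] :=
  match e with
  | Max i => let v := nth root_vertex q i.+1 in
      if q == bulge i v p then turn v (nth root_vertex q i) else 0
  | Min i => let v := nth root_vertex p i.+1 in
      if p == bulge i v q then turn v (nth root_vertex p i) else 0
  | Box n b i x =>
      if (take i.+1 p == take i.+1 q) && (drop (i + n) p == drop (i + n) q)
      then value x (take n.+1 (drop i p) ++ rev (take n.-1 (drop i.+1 q)))
      else 0
  end.

(* Jones' state sum of the diagram D when the regions at its top (resp. bottom)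
   edge are labelled, from left to right, by the walk p (resp. q): the sum over
   all the labellings of the regions at the intermediate levels. *)
Fixpoint state_sum (D : seq event) (p q : seq vertex) : R[i] :=
  if D is e :: D' then
    \sum_(r : (strings_below e (size p).-1).+1.-tuple vertex | sorted adj r)
      weight e p r * state_sum D' r q
  else (p == q)%:R.

(* The element given by a diagram with n strings on top and n at the bottom. *)
Definition of_diagram (n : nat) (b : bool) (D : seq event) : gpa n b :=
  [ffun g : loop n b =>
     state_sum D (take n.+1 g) (head root_vertex g :: rev (drop n g))].

(* The function of the labels of the boundary regions given by a diagram whose
   2n boundary points are all at the bottom, with the external distinguished
   region at the top and left; the labels are read clockwise. *)
Definition of_bottom_diagram (n : nat) (b : bool) (D : seq event) : gpa n b :=
  [ffun g : loop n b =>
     let v := head root_vertex g in state_sum D [:: v] (rev (rcons g v))].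

(* [jones_wenzl b k] is f^(k+1), by Wenzl's recursion
   f^(k+1) = f^(k) - [k]/[k+1] f^(k) e_k f^(k). *)
Fixpoint jones_wenzl (b : bool) (k : nat) : gpa k.+1 b :=
  match k with
  | 0%N => of_diagram 1 b [::]
  | k'.+1 =>
      let f := Box 0 (jones_wenzl b k') in
      [ffun g => of_diagram k'.+2 b [:: f] g
         - (qnum k'.+1 / qnum k'.+2)%:C
           * of_diagram k'.+2 b [:: f; Min k'; Max k'; f] g]
  end.

(* The box S with its n top strings bent over to its right, so that its 2n
   strings all run down; the star is immediately to their left. *)
Definition bent_down (n : nat) (b : bool) (i : nat) (S : gpa n b) : seq event :=
  [seq Max (i + k) | k <- iota 0 n] ++ [:: Box i S].

Definition circ (n : nat) (b : bool) (S T : gpa n b) : seq event :=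
  bent_down 0 S ++ bent_down n.*2 T
  ++ [seq Min (n.*2.-1 - k) | k <- iota 0 n.-1].

Definition jelly (n : nat) (b : bool) (S : gpa n b) : seq event :=
  Max 0 :: bent_down 1 S.

Definition f_circ (n : nat) (b : bool) (S T : gpa n b) : gpa n.+1 b :=
  of_bottom_diagram n.+1 b (circ S T ++ [:: Box 0 (jones_wenzl b n.*2.+1)]).

Definition f_jelly (n : nat) (b : bool) (S : gpa n b) : gpa n.+1 (~~ b) :=
  of_bottom_diagram n.+1 (~~ b)
    (jelly S ++ [:: Box 0 (jones_wenzl (~~ b) n.*2.+1)]).

Definition fourier (n : nat) (b : bool) (x : gpa n b) : gpa n (~~ b) :=
  [ffun g : loop n (~~ b) =>
     (Num.sqrt (dim (label g 1) * dim (label g n.+1)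
                / (dim (label g 0) * dim (label g n))))%:C
     * value x (rot 1 g)].

Definition rho (n : nat) (x : gpa n true) : gpa n true := fourier (fourier x).

Definition dual_gen (sigma : R[i]) (n : nat) (b : bool) (x : gpa n b) :
    gpa n (~~ b) :=
  [ffun g => sigma^-1 * fourier x g].

Definition vanishes (m : nat) (D : seq event) : Prop :=
  forall p q : seq vertex, size p = m.+1 -> sorted adj p -> state_sum D p q = 0.

(* The cap joins two neighbours among the top strings, among the bottom
   strings, or the rightmost (resp. leftmost) top and bottom strings. *)
Definition uncappable (n : nat) (b : bool) (x : gpa n b) : Prop :=
  [/\ forall i, (i < n.-1)%N -> vanishes n.-2 [:: Max i; Box 0 x],
      forall i, (i < n.-1)%N -> vanishes n [:: Box 0 x; Min i],
      vanishes n.-1 [:: Max n.-1; Box 0 x; Min n.-1]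
    & vanishes n.-1 [:: Max 0; Box 1 x; Min 0]].

Definition gpa_mul (n : nat) (b : bool) (x y : gpa n b) : gpa n b :=
  of_diagram n b [:: Box 0 x; Box 0 y].

Definition closure_diagram (n : nat) (b : bool) (x : gpa n b) : seq event :=
  [seq Max k | k <- iota 0 n] ++ Box 0 x :: [seq Min k | k <- rev (iota 0 n)].

(* The closure of x is a function on the vertices of parity b; the trace of the
   spherical planar algebra averages it with weights dim(v)^2, so that the
   empty diagram has value 1 and a closed loop has value delta. *)
Definition gpa_trace (n : nat) (b : bool) (x : gpa n b) : R[i] :=
  (\sum_(v | even_vertex v == b)
     (dim v ^+ 2)%:C * state_sum (closure_diagram x) [:: v] [:: v])
  / (\sum_(v | even_vertex v == b) dim v ^+ 2)%:C.

End StateSum.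

Definition ell (a : seq 'I_4) : seq vertex :=
  flatten [seq [:: arm_vertex j 0; center] | j <- a].

Local Notation s5 := (@Num.sqrt R 5).

Definition table : seq (seq 'I_4 * (R * R)) :=
  [:: ([:: 1; 1; 1; 2], ((2 - s5) / 4,     (7 * s5 - 15) / 8));
      ([:: 1; 1; 1; 3], ((3 * s5 - 7) / 8, (s5 - 3) / 8));
      ([:: 1; 1; 2; 2], ((s5 - 3) / 4,     (2 - s5) / 2));
      ([:: 1; 1; 2; 3], ((3 - s5) / 8,     1 / 4));
      ([:: 1; 1; 3; 2], ((3 - s5) / 8,     1 / 4));
      ([:: 1; 1; 3; 3], ((3 - s5) / 4,     (2 - s5) / 2));
      ([:: 1; 2; 1; 2], ((s5 - 1) / 4,     (5 - 3 * s5) / 4));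
      ([:: 1; 2; 1; 3], ((- 1 - s5) / 8,   (2 - s5) / 4));
      ([:: 1; 2; 2; 2], ((2 - s5) / 4,     (7 * s5 - 15) / 8));
      ([:: 1; 2; 2; 3], ((s5 - 1) / 8,     (5 - 3 * s5) / 8));
      ([:: 1; 2; 3; 2], ((s5 - 1) / 8,     (1 + s5) / 8));
      ([:: 1; 2; 3; 3], (- (1 / 4),        (3 * s5 - 7) / 8));
      ([:: 1; 3; 1; 3], ((3 - s5) / 4,     1 / 2));
      ([:: 1; 3; 2; 2], ((s5 - 1) / 8,     (5 - 3 * s5) / 8));
      ([:: 1; 3; 2; 3], (1 / 4,            (s5 - 5) / 8));
      ([:: 1; 3; 3; 2], (- (1 / 4),        (3 * s5 - 7) / 8));
      ([:: 1; 3; 3; 3], ((3 * s5 - 7) / 8, (s5 - 3) / 8));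
      ([:: 2; 2; 2; 3], ((3 - s5) / 8,     (9 - 4 * s5) / 4));
      ([:: 2; 2; 3; 3], (0,                s5 - 2));
      ([:: 2; 3; 2; 3], (- (1 / 2),        (3 * s5 - 7) / 4));
      ([:: 2; 3; 3; 3], ((3 - s5) / 8,     (9 - 4 * s5) / 4))].

Definition tableA : seq (seq 'I_4 * R) := [seq (t.1, t.2.1) | t <- table].
Definition tableB : seq (seq 'I_4 * R) := [seq (t.1, t.2.2) | t <- table].

Definition is_generator (dim : vertex -> R) (kappa : R)
    (t : seq (seq 'I_4 * R)) (x : gpa 4 true) : Prop :=
  [/\ uncappable dim x,
      rho dim x = x,
      [/\ value x (ell [:: 1; 1; 1; 1]) = 0,
          value x (ell [:: 2; 2; 2; 2]) = 0
        & value x (ell [:: 3; 3; 3; 3]) = 0]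
    & forall w, w \in t -> value x (ell w.1) = (kappa * w.2)%:C].

Definition closest_root (cs : seq R[i]) (z x : R[i]) : Prop :=
  root (Poly (rev cs)) x /\
  forall y, root (Poly (rev cs)) y -> `|x - z| <= `|y - z|.

(* The root closest to z of the polynomial whose coefficients, from the leading
   one down to the constant one, are cs. *)
Definition lambda (cs : seq R[i]) (z : R[i]) : R[i] :=
  xget 0 (fun x => closest_root cs z x).

Definition mx24 (K : pzRingType) (rows : seq (seq K)) : 'M[K]_(2, 4) :=
  \matrix_(i < 2, j < 4) nth 0 (nth [::] rows i) j.

Definition Rmat : 'M[R[i]]_(2, 4) :=
  map_mx (real_complex R) (mx24
    [:: [:: (s5 - 2) / 2; (- 1 - s5) / 4; (- 1 - s5) / 4; (1 - s5) / 12];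
        [:: (3 - 3 * s5) / 4; (2 - s5) / 2; (2 - s5) / 2; (1 + s5) / 4]]).

Definition Rmat_check : 'M[R[i]]_(2, 4) :=
  mx24
    [:: [:: lambda [:: 64; 0; - 216; 0; 121] (- (8422 / 10000));
            lambda [:: 64; 0; - 24; 0; 1] (- (2185 / 10000));
            lambda [:: 64; 0; - 24; 0; 1] (- (2185 / 10000));
            lambda [:: 5184; 0; - 3024; 0; 121] (7349 / 10000)];
        [:: lambda [:: 64; 0; - 1296; 0; 81] (- (2504 / 10000));
            lambda [:: 64; 0; - 216; 0; 121] (8422 / 10000);
            lambda [:: 64; 0; - 216; 0; 121] (8422 / 10000);
            lambda [:: 64; 0; - 24; 0; 1] (2185 / 10000)]].

(* X = M Y, for a column X of 2 elements and a column Y of 4 elements. *)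
Definition column_relation (n : nat) (b : bool) (M : 'M[R[i]]_(2, 4))
    (X Y : seq (gpa n b)) : Prop :=
  forall (i : 'I_2) (g : loop n b),
    nth [ffun=> 0] X i g = \sum_(j < 4) M i j * nth [ffun=> 0] Y j g.

End GraphPlanarAlgebra.

(* Main.v *)
From Stdlib Require Import ZArith.
Require Import Defs.
From mathcomp Require Import all_boot all_order all_algebra.
From mathcomp Require Import all_classical reals.
From mathcomp Require Import complex.
From mathcomp Require Import ring lra ssrZ zify.
Set Implicit Arguments.
Unset Strict Implicit.
Unset Printing Implicit Defensive.
Import Order.TTheory GRing.Theory Num.Theory.
Local Open Scope ring_scope.
Local Open Scope complex_scope.

(** Both sides of each relation are functions of a closed walk g of length 10
    in the tree, obtained by applying f^(10) to a sum of products of values of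
    A, B and their Fourier transforms.  The proof reduces these sums to finitely
    many identities in Z[sqrt 5].

    Read from the bottom to the top, every event of a diagram acts on the
    functions of walks, and a state sum is a composition of such operators
    ([state_sum_run]).  Since dim is an eigenvector, cups and caps satisfy the
    Temperley-Lieb relations, and Wenzl's recursion gives the usual facts: the
    operators [jw_op] are idempotent and killed by cups ([jw_factsP],
    [cup_jw_op_eq0]).  So the diagrams become sums over walks ([f_circ_sum],
    [f_jelly_sum]) in which f^(10) enters only through one function Phi of
    walks, the column of f^(10) at g, and of Phi only [jw_column_cup] is used.

    After multiplication by square roots of dimensions, uncappability of A and B
    and [jw_column_cup] take the same form: the sum over the neighbours w of x
    of the values at (.., x, w, x, ..) is 0.  Where x has two neighbours this
    exchanges them at the price of a sign.  Hence every walk can be pushed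
    towards the center of the tree, and its value is, up to a product of signs
    [eps], the value at a walk that alternates between the center and its
    neighbours, which is a word in the four arms ([gauge_normal_form],
    [normal_even], [normal_odd]).  The words satisfy one linear relation for
    each position (the sum over the four letters is 0), and for Phi the words
    with four equal letters in a row vanish as well ([spine_sums],
    [spine_zero]).  In products of S, T and Phi all the signs cancel except
    that of one vertex.

    For a fixed base vertex of g, the difference of the two sides is then a
    common factor times a combination of values of Phi at words, with
    coefficients in Z[sqrt 5] ([f_circ_value], [f_jelly_value]).  For each of
    the 13 base vertices and each of the 2 rows, evaluation shows that this
    combination lies in the span of the relations between words
    ([all_certified], [cancels_lsum]).

    One side of the relations is linear in the generators and the other one is
    quadratic, so the normalization matters: the same sums over walks compute
    Tr(A^2) and give kappa = 1 ([kappa_eq1]).  Finally the entries of the second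
    matrix are delta times elements of Q(sqrt 5): each of the four quartics has
    the roots r, -r, t, -t with r and t of this form, and a numerical bound
    selects one of them ([lambda_delta]). *)

(** * State sums as operators on functions of walks *)

Lemma adj_sym : symmetric adj.
Proof. by move=> v w; rewrite /adj /= orbC. Qed.

Section Events.
Context (R : realType) (dim : vertex -> R).
Hypothesis dim_gt0 : forall v, 0 < dim v.
Implicit Types (l r p q : seq vertex) (psi phi : seq vertex -> R[i]).

Definition apply_event (e : event R) psi p : R[i] :=
  \sum_(r : (strings_below e (size p).-1).+1.-tuple vertex | sorted adj r)
    weight dim e p r * psi r.

(** The linear functional [state_sum D p q], q varying, tested against psi: this form lets
    diagrams be evaluated event by event without mentioning the bottom labels. *)
Definition run (D : seq (event R)) psi : seq vertex -> R[i] :=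
  foldr apply_event psi D.

Lemma state_sum_run (D : seq (event R)) p q :
  state_sum dim D p q = run D (fun r => (r == q)%:R) p.
Proof.
by elim: D p => [|e D IH] p //=; apply: eq_bigr => r _; rewrite IH.
Qed.

Lemma run_cat (D D' : seq (event R)) psi p :
  run (D ++ D') psi p = run D (run D' psi) p.
Proof. by rewrite /run foldr_cat. Qed.

(** An event changes only a window of m regions, so in its sum over all labellings only those
    that agree with the frame (l, r) outside the window survive. *)
Lemma sum_tuple_frame k l m r (G : seq vertex -> R[i]) :
  k = (size l + (m + size r))%N ->
  (forall q, size q = k ->
     ~~ ((take (size l) q == l) && (drop (size l + m) q == r)) -> G q = 0) ->
  \sum_(q : k.-tuple vertex) G q = \sum_(t : m.-tuple vertex) G (l ++ t ++ r).
Proof.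
move=> -> G0.
pose P (q : (size l + (m + size r)).-tuple vertex) :=
  (take (size l) q == l) && (drop (size l + m) q == r).
rewrite (bigID P) /= [X in _ + X]big1 ?addr0; last first.
  by move=> q; apply: G0; rewrite size_tuple.
pose h (t : m.-tuple vertex) := cat_tuple (in_tuple l) (cat_tuple t (in_tuple r)).
pose h' (q : (size l + (m + size r)).-tuple vertex) :=
  insubd (nseq_tuple m root_vertex) (take m (drop (size l) q)).
have h'E (q : (size l + (m + size r)).-tuple vertex) : val (h' q) = take m (drop (size l) q).
  rewrite val_insubd size_takel ?eqxx // size_drop size_tuple addKn leq_addr //.
rewrite (reindex_onto h h') => [|q /andP[/eqP ql /eqP qr]]; last first.
  apply: val_inj => /=; rewrite h'E -[in RHS](cat_take_drop (size l) q) ql.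
  congr (_ ++ _); rewrite -[in RHS](cat_take_drop m (drop _ q)).
  by congr (_ ++ _); rewrite drop_drop; apply: (etrans (esym qr)); congr drop; apply: addnC.
apply: eq_big => [t|t _] //=.
rewrite /P /= take_size_cat // eqxx drop_cat ltnNge leq_addr /= addKn.
rewrite drop_size_cat ?size_tuple // eqxx /=.
apply/eqP/val_inj; rewrite h'E /= drop_size_cat //.
by rewrite take_size_cat ?size_tuple.
Qed.

Lemma sum_tuple0 (G : seq vertex -> R[i]) :
  \sum_(t : 0.-tuple vertex) G t = G [::].
Proof.
rewrite (bigD1 [tuple]) //= big1 ?addr0 // => t /eqP; case.
by rewrite [t]tuple0.
Qed.

Lemma sum_tupleS n (G : seq vertex -> R[i]) :
  \sum_(t : n.+1.-tuple vertex) G t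
    = \sum_(x : vertex) \sum_(t : n.-tuple vertex) G (x :: t).
Proof.
rewrite (pair_bigA _ (fun x (t : n.-tuple vertex) => G (x :: t))) /=.
rewrite (reindex (fun u : vertex * n.-tuple vertex => cons_tuple u.1 u.2)) //=.
exists (fun t : n.+1.-tuple vertex => (thead t, behead_tuple t)).
  by move=> [x t] _ /=; congr pair; apply: val_inj.
by move=> t _; rewrite [t in RHS]tuple_eta /=; apply: val_inj.
Qed.

Lemma sum_tuple1 (G : seq vertex -> R[i]) :
  \sum_(t : 1.-tuple vertex) G t = \sum_x G [:: x].
Proof. by rewrite sum_tupleS; apply: eq_bigr => x _; rewrite (sum_tuple0 (fun t => G (x :: t))). Qed.

Lemma sorted_adj_bulge l x w r : sorted adj (l ++ x :: r) ->
  sorted adj (l ++ [:: x, w, x & r]) = adj x w.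
Proof.
rewrite !sorted_cat_cons /= => /andP[-> ->].
by rewrite (adj_sym w) andbT andbb.
Qed.

Lemma sorted_adj_flat l x w r : sorted adj (l ++ [:: x, w, x & r]) ->
  sorted adj (l ++ x :: r).
Proof. by rewrite !sorted_cat_cons /= => /and4P[-> _ _ ->]. Qed.

Lemma apply_max i l x r psi : size l = i -> sorted adj (l ++ x :: r) ->
  apply_event (Max R i) psi (l ++ x :: r)
    = \sum_(w | adj x w) turn dim w x * psi (l ++ [:: x, w, x & r]).
Proof.
move=> <- sp; rewrite /apply_event big_mkcond /=.
set p := l ++ x :: r.
have bulgeE w : bulge (size l) w p = l ++ [:: x, w, x & r].
  rewrite /bulge drop_size_cat // take_cat ltnNge leqnSn /= subSn // subnn /=.
  by rewrite take0 -catA.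
pose G (q : seq vertex) := if sorted adj q
   then weight dim (Max R (size l)) p q * psi q else 0.
rewrite (@sum_tuple_frame _ (rcons l x) 1 (x :: r) G); first last.
- move=> q _ qE; rewrite /G /weight; case: ifP => // _.
  rewrite bulgeE; case: eqP => [qq|]; last by rewrite mul0r.
  move: qE; rewrite {}qq -cat_rcons -[_ :: _]cat1s take_size_cat // eqxx.
  by rewrite catA drop_size_cat ?eqxx // size_cat.
- by rewrite size_rcons /p size_cat /=; lia.
rewrite (sum_tuple1 (fun t => G (rcons l x ++ t ++ (x :: r)))).
rewrite [RHS]big_mkcond; apply: eq_bigr => w _.
rewrite cat_rcons cat1s /G sorted_adj_bulge //; case: ifP => // _; congr (_ * _).
rewrite /weight bulgeE.
rewrite !nth_cat ltnn ltnNge leqnSn /= subnn subSn // subnn /= eqxx //.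
Qed.

Lemma apply_min i l x y z r psi : size l = i -> sorted adj (l ++ [:: x, y, z & r]) ->
  apply_event (Min R i) psi (l ++ [:: x, y, z & r])
    = if x == z then turn dim y x * psi (l ++ x :: r) else 0.
Proof.
move=> <- sp; rewrite /apply_event big_mkcond /=.
set p := l ++ [:: x, y, z & r].
have bulgeE l' w u s : size l' = size l ->
    bulge (size l) w (l' ++ u :: s) = l' ++ [:: u, w, u & s].
  move=> <-; rewrite /bulge drop_size_cat // take_cat ltnNge leqnSn /=.
  by rewrite subSn // subnn /= take0 -catA.
have nthE : nth root_vertex p (size l).+1 = y.
  by rewrite nth_cat ltnNge leqnSn /= subSn // subnn.
have nth0E : nth root_vertex p (size l) = x.
  by rewrite nth_cat ltnn subnn.
pose G (q : seq vertex) := if sorted adj q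
   then weight dim (Min R (size l)) p q * psi q else 0.
rewrite (@sum_tuple_frame _ (rcons l x) 0 r G); first last.
- move=> q sq qE; rewrite /G /weight; case: ifP => // _.
  rewrite nthE; case: eqP => [qq|]; last by rewrite mul0r.
  have sl : (size l < size q)%N.
    by rewrite sq size_cat /=; lia.
  have st : size (take (size l) q) = size l by rewrite size_takel // ltnW.
  move: qE qq; rewrite size_rcons addn0 (take_nth root_vertex) //.
  have qsplit : q = take (size l) q ++ nth root_vertex q (size l) :: drop (size l).+1 q.
    by rewrite -drop_nth // cat_take_drop.
  rewrite [X in bulge _ _ X]qsplit bulgeE //.
  rewrite /p => qE /eqP; rewrite eqseq_cat ?st //.
  rewrite !eqseq_cons => /and5P[/eqP ql /eqP qx _ _ /eqP qr].
  by move: qE; rewrite -ql -qx -qr !eqxx.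
- by rewrite size_rcons /p size_cat /=; lia.
rewrite (sum_tuple0 (fun t => G (rcons l x ++ t ++ r))) /= cat_rcons /G.
rewrite /weight nthE nth0E bulgeE // /p eqseq_cat // eqxx /= !eqseq_cons !eqxx /=.
rewrite andbT eq_sym; case: eqP => [zx|]; last by rewrite mul0r if_same.
by move: sp; rewrite /p zx => /sorted_adj_flat ->.
Qed.

(** A box keeps the regions at its two sides, and its bottom labels t run over the walks
    between them; the labels are read clockwise, hence the reversal of t. *)
Lemma apply_box n b i (S : gpa R n.+1 b) l x m y r psi :
  size l = i -> size m = n -> sorted adj (l ++ x :: m ++ y :: r) ->
  apply_event (Box i S) psi (l ++ x :: m ++ y :: r)
    = \sum_(t : n.-tuple vertex | sorted adj (x :: rcons t y))
        value S (x :: m ++ y :: rev t) * psi (l ++ x :: t ++ y :: r).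
Proof.
move=> <- sm sp; rewrite /apply_event big_mkcond [RHS]big_mkcond /=.
set p := l ++ x :: m ++ y :: r.
have takeE (s : seq vertex) : take (size l).+1 (l ++ x :: s) = rcons l x.
  by rewrite -cat_rcons take_size_cat // size_rcons.
have dropE (s : seq vertex) : size s = n ->
    drop (size l + n.+1) (l ++ x :: s ++ y :: r) = y :: r.
  move=> ss; rewrite drop_cat ltnNge leq_addr /= addKn -cat_cons.
  by rewrite drop_size_cat //= ss.
pose G (q : seq vertex) := if sorted adj q
   then weight dim (Box (size l) S) p q * psi q else 0.
rewrite (@sum_tuple_frame _ (rcons l x) n (y :: r) G); first last.
- move=> q sq; rewrite /G /weight; case: ifP => // _.
  rewrite /p takeE dropE // size_rcons addSnnS.
  by rewrite ![in X in X -> _](eq_sym _ (_ :: _)) ![in X in X -> _](eq_sym _ (rcons _ _)) => /negPf->; rewrite mul0r.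
- by rewrite size_rcons /p size_cat /= size_cat /= sm; lia.
apply: eq_bigr => t _; rewrite cat_rcons /G.
have -> : sorted adj (l ++ x :: t ++ y :: r) = sorted adj (x :: rcons t y).
  move: sp; rewrite /p !sorted_cat_cons !cat_path /= rcons_path.
  by case/and4P=> -> _ _ ->; rewrite andbT.
rewrite /=; case: ifP => // _; congr (_ * _); rewrite /weight.
rewrite /p !takeE !dropE ?size_tuple // !eqxx /= drop_size_cat //.
rewrite /= -[in take n.+1 _]cat_rcons take_size_cat ?size_rcons ?sm //.
rewrite -cat_rcons drop_size_cat ?size_rcons // take_size_cat ?size_tuple //.
by rewrite cat_rcons.
Qed.

End Events.

(** * Temperley-Lieb relations *)

Section JonesWenzl.
Context (R : realType) (dim : vertex -> R).
Hypothesis dim_gt0 : forall v, 0 < dim v.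
Hypothesis dim_eigen : forall v, \sum_(w | adj v w) dim w = delta R * dim v.
Implicit Types (l r p q : seq vertex) (psi phi : seq vertex -> R[i]).

Local Notation cup i := (apply_event dim (Max R i)).
Local Notation cap i := (apply_event dim (Min R i)).

(** Square roots of dimensions: the weight of a turn is a ratio of two of them, which is why
    rescaling by [sdim] removes all turns. *)
Definition sdim (v : vertex) : R[i] := (Num.sqrt (dim v))%:C.

Lemma sdim_neq0 v : sdim v != 0.
Proof. by rewrite /sdim fmorph_eq0 sqrtr_eq0 -ltNge. Qed.

Lemma sdim_sqr v : sdim v * sdim v = (dim v)%:C.
Proof. by rewrite /sdim -rmorphM -expr2 sqr_sqrtr // ltW. Qed.

Lemma turnE v w : turn dim v w = sdim v / sdim w.
Proof. by rewrite /turn /sdim sqrtrM ?ltW // sqrtrV ?ltW // rmorphM fmorphV. Qed.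

Lemma turn_inv v w : turn dim v w * turn dim w v = 1.
Proof. by rewrite !turnE; field; rewrite !sdim_neq0. Qed.

(** The only place where the eigenvector equation enters the planar calculus: it says that a
    closed loop is delta. *)
Lemma turn_sqr_sum x :
  \sum_(w | adj x w) turn dim w x * turn dim w x = (delta R)%:C.
Proof.
transitivity ((\sum_(w | adj x w) dim w / dim x)%:C : R[i]); last first.
  by rewrite -mulr_suml dim_eigen mulfK // gt_eqF.
rewrite rmorph_sum; apply: eq_bigr => w _.
by rewrite !turnE rmorphM fmorphV /= -!sdim_sqr; field; rewrite sdim_neq0.
Qed.

Lemma eq_apply_event e psi phi p :
  (forall q, sorted adj q -> size q = (strings_below e (size p).-1).+1 ->
     psi q = phi q) ->
  apply_event dim e psi p = apply_event dim e phi p.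
Proof. by move=> E; apply: eq_bigr => q sq; rewrite E // size_tuple. Qed.

Lemma apply_event_sum e (I : finType) (P : pred I) (c : I -> R[i])
    (f : I -> seq vertex -> R[i]) p :
  apply_event dim e (fun q => \sum_(j | P j) c j * f j q) p
    = \sum_(j | P j) c j * apply_event dim e (f j) p.
Proof.
rewrite /apply_event; under eq_bigr do rewrite mulr_sumr.
rewrite exchange_big; apply: eq_bigr => j _; rewrite mulr_sumr.
by apply: eq_bigr => q _; rewrite mulrCA.
Qed.

(** A closed loop.  The two lemmas after this one straighten the two zigzags. *)
Lemma cup_cap l x r psi : sorted adj (l ++ x :: r) ->
  cup (size l) (cap (size l) psi) (l ++ x :: r)
    = (delta R)%:C * psi (l ++ x :: r).
Proof.
move=> sp; rewrite apply_max // -(turn_sqr_sum x) mulr_suml.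
apply: eq_bigr => w xw; rewrite apply_min ?eqxx ?mulrA //.
by rewrite sorted_adj_bulge.
Qed.

Lemma cup_cap_right l x y r psi : sorted adj (l ++ [:: x, y & r]) ->
  cup (size l) (cap (size l).+1 psi) (l ++ [:: x, y & r])
    = psi (l ++ [:: x, y & r]).
Proof.
move=> sp; rewrite apply_max //.
have xy : adj x y by move: sp; rewrite sorted_cat_cons /= => /and3P[].
have E w : adj x w -> turn dim w x * cap (size l).+1 psi (l ++ [:: x, w, x, y & r])
    = if w == y then psi (l ++ [:: x, y & r]) else 0.
  move=> xw; rewrite -cat_rcons apply_min ?size_rcons //; last first.
    by rewrite cat_rcons sorted_adj_bulge.
  rewrite cat_rcons; case: eqP => [->|_]; last by rewrite mulr0.
  by rewrite mulrA turn_inv mul1r.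
rewrite (eq_bigr _ E) -big_mkcondr (big_pred1 y) // => w /=.
by case: eqP => [->|]; rewrite ?xy ?andbF.
Qed.

Lemma cup_cap_left l x y r psi : sorted adj (l ++ [:: x, y & r]) ->
  cup (size l).+1 (cap (size l) psi) (l ++ [:: x, y & r])
    = psi (l ++ [:: x, y & r]).
Proof.
move=> sp; have sp' : sorted adj (rcons l x ++ y :: r) by rewrite cat_rcons.
rewrite -cat_rcons apply_max ?size_rcons //.
have yx : adj y x by move: sp; rewrite adj_sym sorted_cat_cons /= => /and3P[].
have E w : adj y w -> turn dim w y * cap (size l) psi (rcons l x ++ [:: y, w, y & r])
    = if w == x then psi (rcons l x ++ y :: r) else 0.
  move=> yw; rewrite cat_rcons apply_min //; last first.
    by rewrite -cat_rcons sorted_adj_bulge.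
  rewrite eq_sym cat_rcons; case: eqP => [->|_]; last by rewrite mulr0.
  by rewrite mulrA turn_inv mul1r.
rewrite (eq_bigr _ E) -big_mkcondr (big_pred1 x) // => w /=.
by case: eqP => [->|]; rewrite ?yx ?andbF.
Qed.

Lemma cap_cup l x y z r psi : sorted adj (l ++ [:: x, y, z & r]) ->
  cap (size l) (cup (size l) psi) (l ++ [:: x, y, z & r])
    = if x == z then turn dim y x
        * \sum_(w | adj x w) turn dim w x * psi (l ++ [:: x, w, x & r]) else 0.
Proof.
move=> sp; rewrite apply_min //; case: eqP => // xz.
by rewrite apply_max //; move: sp; rewrite xz => /sorted_adj_flat.
Qed.

Definition jw_coef k : R[i] := (qnum R k.+1 / qnum R k.+2)%:C.

(** Wenzl's recursion for f^(k+1), acting on the first k + 1 strings of longer walks as well;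
    the state sums of [jones_wenzl] are compared with it in [apply_jones_wenzl]. *)
Fixpoint jw_op k psi : seq vertex -> R[i] :=
  if k is j.+1 then fun p =>
    jw_op j psi p - jw_coef j * jw_op j (cap j (cup j (jw_op j psi))) p
  else psi.

Lemma jw_op_sum k (I : finType) (P : pred I) (c : I -> R[i])
    (f : I -> seq vertex -> R[i]) p :
  jw_op k (fun q => \sum_(j | P j) c j * f j q) p
    = \sum_(j | P j) c j * jw_op k (f j) p.
Proof.
elim: k f p => [|k IH] f p //=; rewrite IH.
under eq_bigr do rewrite mulrBr; rewrite sumrB; congr (_ - _).
have E : cap k (cup k (jw_op k (fun q => \sum_(j | P j) c j * f j q)))
       = fun q => \sum_(j | P j) c j * cap k (cup k (jw_op k (f j))) q.
  apply: funext => q; rewrite -apply_event_sum; apply: eq_apply_event => q1 _ _.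
  by rewrite -apply_event_sum; apply: eq_apply_event => q2 _ _; rewrite IH.
by rewrite E IH mulr_sumr; apply: eq_bigr => j _; rewrite mulrCA.
Qed.

Lemma jw_opB k psi (c : R[i]) phi p :
  jw_op k (fun q => psi q - c * phi q) p = jw_op k psi p - c * jw_op k phi p.
Proof.
have := @jw_op_sum k bool predT (fun b => if b then 1 else - c)
          (fun b => if b then psi else phi) p.
rewrite big_bool /= mul1r mulNr => <-; congr (jw_op _ _ _).
by apply: funext => q; rewrite big_bool /= mul1r mulNr.
Qed.

Lemma split_at3 k p : (k.+2 < size p)%N ->
  exists l x y z r, size l = k /\ p = l ++ [:: x, y, z & r].
Proof.
move=> kp; exists (take k p), (nth root_vertex p k), (nth root_vertex p k.+1),
  (nth root_vertex p k.+2), (drop k.+3 p); split.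
  by rewrite size_takel //; lia.
by rewrite -!drop_nth ?cat_take_drop //; lia.
Qed.

Lemma split_at2 k p : (k.+1 < size p)%N ->
  exists l x y r, size l = k /\ p = l ++ [:: x, y & r].
Proof.
move=> kp; exists (take k p), (nth root_vertex p k), (nth root_vertex p k.+1),
  (drop k.+2 p); split; first by rewrite size_takel //; lia.
by rewrite -!drop_nth ?cat_take_drop //; lia.
Qed.

Lemma split_at1 k p : (k < size p)%N ->
  exists l x r, size l = k /\ p = l ++ x :: r.
Proof.
move=> kp; exists (take k p), (nth root_vertex p k), (drop k.+1 p).
by rewrite size_takel ?(ltnW kp) // -!drop_nth ?cat_take_drop //; lia.
Qed.

(** The walks that f^(k+1), placed at the left end of p, can relate to p: it changes neither
    the leftmost region nor the regions from index k + 1 on. *)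
Definition same_frame k p q : Prop :=
  [/\ sorted adj q, size q = size p, head root_vertex q = head root_vertex p
    & drop k.+1 q = drop k.+1 p].

Lemma same_frameW k p q : same_frame k p q -> same_frame k.+1 p q.
Proof. by case=> ? ? ? d; split=> //; rewrite -[k.+2]add1n -!drop_drop d. Qed.

Lemma same_frame_trans k p q q' :
  same_frame k p q -> same_frame k q q' -> same_frame k p q'.
Proof.
by case=> sq zq hq dq [sq' zq' hq' dq']; split=> //;
  rewrite ?zq' ?zq ?hq' ?hq ?dq' ?dq.
Qed.

Lemma same_frame_bulge l x y w r : sorted adj (l ++ [:: x, y, x & r]) -> adj x w ->
  same_frame (size l).+1 (l ++ [:: x, y, x & r]) (l ++ [:: x, w, x & r]).
Proof.
move=> sp xw; split.
- by rewrite sorted_adj_bulge // (sorted_adj_flat sp).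
- by rewrite !size_cat.
- by case: (l).
- by rewrite -[(size l).+2]add2n -!drop_drop !drop_size_cat.
Qed.

Lemma eq_cap_cup k psi phi p : (k.+2 < size p)%N -> sorted adj p ->
  (forall q, same_frame k.+1 p q -> psi q = phi q) ->
  cap k (cup k psi) p = cap k (cup k phi) p.
Proof.
move=> /split_at3 [l [x [y [z [r [<- ->]]]]]] sp E.
rewrite !cap_cup //; case: eqP => // xz; congr (_ * _).
apply: eq_bigr => w xw; congr (_ * _); apply: E; rewrite -{}xz in sp *.
exact: same_frame_bulge.
Qed.

(** [jw_op] is an operator on all functions of lists, but its value at p depends only on
    the walks in the frame of p; this locality replaces statements on boxes of a fixed size. *)
Lemma eq_jw_op k psi phi p : (k.+1 < size p)%N -> sorted adj p ->
  (forall q, same_frame k p q -> psi q = phi q) ->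
  jw_op k psi p = jw_op k phi p.
Proof.
elim: k psi phi p => [|k IH] psi phi p kp sp E /=; first by apply: E; split.
have kp' : (k.+1 < size p)%N by exact: ltnW.
congr (_ - _ * _).
  by apply: IH => // q /same_frameW; apply: E.
apply: (IH) => // q pq; have [sq zq _ _] := pq.
apply: eq_cap_cup; rewrite ?zq // => q' qq'; have [sq' zq' _ _] := qq'.
apply: IH; rewrite ?zq' ?zq // => q'' q'q''.
apply: E; apply: same_frame_trans (same_frameW q'q'').
exact: same_frame_trans (same_frameW pq) qq'.
Qed.

Lemma same_frame_sorted_cat k p q t : (k.+1 < size p)%N ->
  same_frame k p q -> sorted adj (p ++ t) -> sorted adj (q ++ t).
Proof.
move=> kp [sq zq _ dq]; case: t => [|x t]; first by rewrite !cats0.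
have nz (s : seq vertex) : (k.+1 < size s)%N ->
    s = rcons (take (size s).-1 s) (last root_vertex (drop k.+1 s)).
  case/lastP: s => [//|s y]; rewrite size_rcons /= => ks.
  by rewrite drop_rcons // last_rcons -{2}cats1 take_size_cat.
have kq : (k.+1 < size q)%N by rewrite zq.
rewrite {1}(nz p kp) {1}(nz q kq) dq !cat_rcons !sorted_cat_cons.
by case/andP=> _ ->; rewrite andbT -{}dq -nz.
Qed.

(** Strings to the right of f^(k+1) are spectators. *)
Lemma jw_op_cat k psi p t : (k.+1 < size p)%N -> sorted adj (p ++ t) ->
  jw_op k (fun q => psi (q ++ t)) p = jw_op k psi (p ++ t).
Proof.
elim: k psi p => [|k IH] psi p kp sp //=.
have kp' : (k.+1 < size p)%N by exact: ltnW.
have sp1 : sorted adj p by case: (cat_sorted2 sp).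
rewrite IH //; congr (_ - _ * _).
rewrite -IH //; apply: eq_jw_op => // q pq; have [sq zq _ _] := pq.
have sqt := same_frame_sorted_cat kp' pq sp.
have /split_at3 [l [x [y [z [r [lk qE]]]]]] : (k.+2 < size q)%N by rewrite zq.
move: sq sqt; rewrite qE -!catA /= => sq sqt; subst k.
rewrite !cap_cup //; case: eqP => // xz; congr (_ * _).
apply: eq_bigr => w xw; congr (_ * _); rewrite {}xz in sq sqt xw *.
rewrite IH -?catA //; first by rewrite size_cat /=; lia.
by rewrite /= sorted_adj_bulge // (sorted_adj_flat sqt).
Qed.

(** Far commutation: the cup is to the right of the strings of f^(k+1). *)
Lemma cup_jw_op k i psi p : (k < i)%N -> (i < size p)%N -> sorted adj p ->
  cup i (jw_op k psi) p = jw_op k (cup i psi) p.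
Proof.
move=> ki /split_at1 [l [x [r [li ->]]]] sp; rewrite -li in ki *.
have zl : (k.+1 < size (rcons l x))%N by rewrite size_rcons.
have sr : sorted adj (rcons l x ++ r) by rewrite cat_rcons.
rewrite apply_max //.
transitivity (jw_op k (fun q => \sum_(w | adj x w)
    turn dim w x * psi (q ++ [:: w, x & r])) (rcons l x)).
  rewrite (jw_op_sum _ _ _ (fun w q => psi (q ++ [:: w, x & r]))).
  apply: eq_bigr => w xw; congr (_ * _).
  by rewrite jw_op_cat ?cat_rcons ?sorted_adj_bulge.
rewrite -cat_rcons -[RHS]jw_op_cat //; apply: eq_jw_op => //.
  by case: (cat_sorted2 sr).
move=> q qf; have [sq zq _ dq] := qf.
have [m qE] : exists m, q = rcons m x /\ size m = size l.
  case/lastP: q sq zq dq qf => [|m y] sq zq dq qf; first by rewrite size_rcons in zq.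
  exists m; move: zq; rewrite !size_rcons => -[zm]; split=> //; congr rcons.
  by have := congr1 (last root_vertex) dq; rewrite !drop_rcons ?zm // !last_rcons.
case: qE => qE zm; rewrite qE cat_rcons -zm apply_max //.
  by apply: eq_bigr => w _; rewrite cat_rcons.
by rewrite -cat_rcons -qE; apply: same_frame_sorted_cat qf sr.
Qed.

Lemma cap_jw_op k i psi p : (k < i)%N -> (i.+2 < size p)%N -> sorted adj p ->
  cap i (jw_op k psi) p = jw_op k (cap i psi) p.
Proof.
move=> ki /split_at3 [l [x [y [z [r [li ->]]]]]] sp; rewrite -li in ki *.
have zl : (k.+1 < size (rcons l x))%N by rewrite size_rcons.
have sr : sorted adj (rcons l x ++ [:: y, z & r]) by rewrite cat_rcons.
have E : forall q, same_frame k (rcons l x) q ->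
    cap (size l) psi (q ++ [:: y, z & r])
     = (if x == z then turn dim y x else 0) * psi (q ++ r).
  move=> q qf; have [sq zq _ dq] := qf.
  have [m [qE zm]] : exists m, q = rcons m x /\ size m = size l.
    case/lastP: q sq zq dq qf => [|m w] sq zq dq qf; first by rewrite size_rcons in zq.
    exists m; move: zq; rewrite !size_rcons => -[zm]; split=> //; congr rcons.
    by have := congr1 (last root_vertex) dq; rewrite !drop_rcons ?zm // !last_rcons.
  rewrite qE !cat_rcons -zm apply_min //; first by case: eqP; rewrite ?mul0r.
  by rewrite -cat_rcons -qE; apply: same_frame_sorted_cat qf sr.
rewrite -[in RHS]cat_rcons -[RHS]jw_op_cat //.
rewrite (eq_jw_op (phi := fun q => \sum_(u : unit)
    (if x == z then turn dim y x else 0) * psi (q ++ r))) //; first last.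
- by move=> q /E ->; rewrite big_const card_unit /= addr0.
- by case: (cat_sorted2 sr).
rewrite jw_op_sum big_const card_unit /= addr0 apply_min //.
case: eqP => [xz|]; last by rewrite mul0r.
rewrite (jw_op_cat psi) // cat_rcons //.
by move: sp; rewrite xz => /sorted_adj_flat.
Qed.

End JonesWenzl.

(** * The Jones-Wenzl idempotents are killed by cups *)

Section Killing.
Context (R : realType) (dim : vertex -> R).
Hypothesis dim_gt0 : forall v, 0 < dim v.
Hypothesis dim_eigen : forall v, \sum_(w | adj v w) dim w = delta R * dim v.
Implicit Types (l r p q : seq vertex) (psi phi : seq vertex -> R[i]).

Local Notation cup i := (apply_event dim (Max R i)).
Local Notation cap i := (apply_event dim (Min R i)).
Local Notation jw k := (jw_op dim k).

(** This makes the quantum integers increase, hence not vanish. *)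
Lemma delta_ge2 : 2 <= delta R.
Proof.
have -> : 2 = Num.sqrt (2 ^+ 2) :> R by rewrite sqrtr_sqr ger0_norm.
rewrite ler_wsqrtr // -subr_ge0.
have : 1 <= Num.sqrt 5 :> R by rewrite -{1}sqrtr1 ler_wsqrtr // ler1n.
lra.
Qed.

Lemma qnumSS k : qnum R k.+2 = delta R * qnum R k.+1 - qnum R k.
Proof. by []. Qed.

Lemma qnum_incr k : 0 <= qnum R k < qnum R k.+1.
Proof.
elim: k => [|k /andP[q0 q1]]; first by rewrite /= lexx ltr01.
rewrite qnumSS; have := delta_ge2; set d := delta R => d2.
have q2 : 0 < qnum R k.+1 by exact: le_lt_trans q1.
rewrite (ltW q2) andTb; move: q1 q2 d2.
move: d (qnum R k) (qnum R k.+1) => d a c ac c0 d2.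
have : 0 <= (d - 2) * c by rewrite mulr_ge0 ?subr_ge0 // ltW.
by move: ac; lra.
Qed.

Lemma qnum_neq0 k : qnum R k.+1 != 0.
Proof. by case/andP: (qnum_incr k) => q0 q1; rewrite gt_eqF // (le_lt_trans q0). Qed.

Lemma jw_op0 k p : jw k (fun=> 0) p = 0.
Proof.
have := @jw_op_sum R dim k unit pred0 (fun=> 0) (fun _ _ => 0) p.
by under eq_fun do rewrite big_pred0_eq; rewrite big_pred0_eq.
Qed.

Lemma cupB i psi (c : R[i]) phi p :
  cup i (fun q => psi q - c * phi q) p = cup i psi p - c * cup i phi p.
Proof.
have := @apply_event_sum R dim (Max R i) bool predT (fun b => if b then 1 else - c)
          (fun b => if b then psi else phi) p.
rewrite big_bool /= mul1r mulNr => <-; congr (apply_event _ _ _ _).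
by apply: funext => q; rewrite big_bool /= mul1r mulNr.
Qed.

Lemma size_event_max i p : (0 < size p)%N ->
  (strings_below (Max R i) (size p).-1).+1 = (size p).+2.
Proof. by case: p. Qed.

Lemma size_event_min i p : (2 < size p)%N ->
  (strings_below (Min R i) (size p).-1).+1 = (size p).-2.
Proof. by case: p => [|? [|? [|]]]. Qed.

Definition jw_pred k psi := if k is j.+1 then jw j psi else psi.

(** Idempotence, absorption of f^(k) and annihilation by cups are proved together, because
    each of them at level k + 1 uses the others at level k. *)
Definition jw_facts k : Prop := forall psi p, sorted adj p ->
  [/\ (k.+1 < size p)%N -> jw k (jw k psi) p = jw k psi p,
      (k.+1 < size p)%N -> jw_pred k (jw k psi) p = jw k psi p
    & forall i, (i < k)%N -> (k <= size p)%N -> cup i (jw k psi) p = 0].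

(** Closing the last string of f^(k+1) gives [k+2]/[k+1] times f^(k).  The term of Wenzl's
    recursion with a cap and a cup becomes a zigzag, which leaves f^(k) squared; then
    delta [k+1] - [k] = [k+2]. *)
Lemma partial_trace k psi p : (forall j, (j < k)%N -> jw_facts j) ->
  sorted adj p -> (k < size p)%N ->
  cup k (jw k (cap k psi)) p = (qnum R k.+2 / qnum R k.+1)%:C * jw_pred k psi p.
Proof.
case: k => [|k] IH sp kp.
  rewrite /jw_pred /=; have [l [x [r [l0 pE]]]] := split_at1 kp.
  rewrite pE in sp *; rewrite -{1 2}l0 cup_cap //.
  by congr (_%:C * _); rewrite /= mulr1 subr0 divr1.
rewrite [jw k.+1 _]/= cupB [jw_pred _ _]/=.
have kS := ltnSn k; have p0 : (0 < size p)%N by exact: leq_ltn_trans kp.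
rewrite cup_jw_op //.
have -> : jw k (cup k.+1 (cap k.+1 psi)) p = (delta R)%:C * jw k psi p.
  have := @jw_op_sum R dim k unit predT (fun=> (delta R)%:C) (fun=> psi) p.
  rewrite big_const card_unit /= addr0 => <-; apply: eq_jw_op => // q [sq zq _ _].
  rewrite big_const card_unit /= addr0.
  have /split_at1 [l [x [r [lk qE]]]] : (k.+1 < size q)%N by rewrite zq.
  by rewrite qE in sq *; rewrite -lk cup_cap.
have -> : cup k.+1 (jw k (cap k (cup k (jw k (cap k.+1 psi))))) p = jw k psi p.
  rewrite cup_jw_op //.
  have [/(_ kp) <- _ _] := IH k kS psi p sp.
  apply: eq_jw_op => // q [sq zq _ _].
  have kq : (k.+1 < size q)%N by rewrite zq.
  transitivity (cup k.+1 (cap k (cup k (cap k.+1 (jw k psi)))) q).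
    apply: eq_apply_event => q1 sq1; rewrite size_event_max; last by lia.
    move=> zq1; apply: eq_apply_event => q2 sq2.
    rewrite size_event_min; last by lia.
    move=> zq2; apply: eq_apply_event => q3 sq3.
    rewrite size_event_max; last by lia.
    by move=> zq3; rewrite cap_jw_op //; lia.
  have /split_at2 [l [x [y [r [lk qE]]]]] := kq.
  rewrite qE in sq *; rewrite -lk cup_cap_left // cup_cap_right //.
rewrite -mulrBl /jw_coef -rmorphB; congr (_%:C * _).
by rewrite [qnum R k.+3]qnumSS; field; rewrite qnum_neq0.
Qed.

(** Cups at i < k are killed by the first factor f^(k+1) of both terms of the recursion.  For
    the last cup, [partial_trace] turns the second term into the first one. *)
Lemma jw_factsP k : jw_facts k.
Proof.
elim/ltn_ind: k => -[|k] IH psi p sp; first by split.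
have IHk := IH k (ltnSn k).
have kill i q : sorted adj q -> (i <= k)%N -> (k < size q)%N ->
    cup i (jw k.+1 psi) q = 0.
  move=> sq ik kq; rewrite [jw k.+1 _]/= cupB.
  have [ltik | lik] := ltnP i k.
    have [_ _ /(_ i ltik (ltnW kq)) ->] := IHk psi q sq.
    by have [_ _ /(_ i ltik (ltnW kq)) ->] := IHk (cap k (cup k (jw k psi))) q sq; rewrite mulr0 subr0.
  have -> : i = k by lia.
  rewrite partial_trace //; last by move=> j jk; apply: IH; lia.
  rewrite mulrA /jw_coef -rmorphM.
  have -> : qnum R k.+1 / qnum R k.+2 * (qnum R k.+2 / qnum R k.+1) = 1.
    by field; rewrite !qnum_neq0.
  rewrite mul1r; apply/eqP; rewrite subr_eq0; apply/eqP.
  case: (k) IHk kq => [|j] IHj jq //; rewrite [jw_pred _ _]/= -cup_jw_op //.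
  apply: eq_apply_event => q1 sq1; rewrite size_event_max; last by lia.
  by move=> zq1; have [_ <- //] := IHj psi q1 sq1; lia.
have absorb chi q : sorted adj q -> (k.+1 < size q)%N ->
    jw k (jw k.+1 chi) q = jw k.+1 chi q.
  move=> sq kq; rewrite /= jw_opB.
  have [/(_ kq) -> _ _] := IHk chi q sq.
  by have [/(_ kq) -> _ _] := IHk (cap k (cup k (jw k chi))) q sq.
split=> [kp|kp|i ik kp].
- rewrite [LHS]/= absorb //; last by lia.
  rewrite -[RHS]subr0; congr (_ - _).
  rewrite (_ : jw k _ p = 0) ?mulr0 // -[RHS](jw_op0 k p).
  apply: eq_jw_op => //; first by lia.
  move=> q [sq zq _ _].
  transitivity (cap k (fun=> 0) q); last first.
    by rewrite /apply_event big1 // => q1 _; rewrite mulr0.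
  apply: eq_apply_event => q1 sq1; rewrite size_event_min; last by lia.
  move=> zq1; rewrite -(kill k q1) //; last by lia.
  apply: eq_apply_event => q2 sq2; rewrite size_event_max; last by lia.
  by move=> zq2; apply: absorb => //; lia.
- by apply: absorb; lia.
- by apply: kill.
Qed.

Lemma cup_jw_op_eq0 k i psi p : sorted adj p -> (i < k <= size p)%N ->
  cup i (jw k psi) p = 0.
Proof. by move=> sp /andP[ik kp]; have [_ _ ->] := jw_factsP k psi sp. Qed.

Lemma value_loop n b (x : gpa R n b) (g : loop n b) : value x g = x g.
Proof.
rewrite /value; have -> : insub (g : seq vertex) = Some (val g).
  by rewrite insubT ?size_tuple // => H; congr Some; apply: val_inj.
by rewrite /= insubT ?(valP g) // => H; congr (x _); apply: val_inj.
Qed.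

Lemma is_loopP n b (g : seq vertex) : is_loop n b g ->
  exists g' : loop n b, g = g' :> seq vertex.
Proof.
move=> gP; have zg : size g == n.*2 by case/and3P: gP.
by exists (Sub (Tuple zg) gP).
Qed.

Lemma cycle_of_walks x m y t : cycle adj (x :: m ++ y :: rev t) =
  sorted adj (x :: rcons m y) && sorted adj (x :: rcons t y).
Proof.
rewrite /= -cat_rcons rcons_cat cat_path last_rcons -rev_cons; congr (_ && _).
have := rev_path adj x (rcons t y); rewrite last_rcons belast_rcons => ->.
by apply: eq_path => v w; rewrite adj_sym.
Qed.

Definition final_size (D : seq (event R)) n :=
  foldl (fun m e => (strings_below e m.-1).+1) n D.

Lemma run_sum (D : seq (event R)) psi p : sorted adj p ->
  run dim D psi p = \sum_(q : (final_size D (size p)).-tuple vertex | sorted adj q)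
    state_sum dim D p q * psi q.
Proof.
elim: D p => [|e D IH] p sp /=.
  rewrite (bigD1 (in_tuple p)) //= eqxx mul1r big1 ?addr0 // => q /andP[_ qp].
  rewrite (_ : (p == q) = false) ?mul0r //; apply: contraNF qp => /eqP qp.
  by apply/eqP/val_inj.
transitivity (\sum_(q : ((strings_below e (size p).-1).+1).-tuple vertex | sorted adj q)
  weight dim e p q *
  (\sum_(q' : (final_size D (strings_below e (size p).-1).+1).-tuple vertex | sorted adj q')
     state_sum dim D q q' * psi q')).
  by apply: eq_bigr => q sq; rewrite IH // size_tuple.
under [LHS]eq_bigr => q _ do rewrite mulr_sumr.
rewrite exchange_big; apply: eq_bigr => q' _; rewrite mulr_suml; by apply: eq_bigr => q _; rewrite mulrA.
Qed.

(** The recursion that defines the box [jones_wenzl] is the one of [jw_op], but the box is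
    tabulated on loops; the point is that a box labelled by a sum of diagrams acts as the sum
    of the diagrams, with the regions to its right as spectators. *)
Lemma apply_jones_wenzl b k psi p : sorted adj p -> (k.+1 < size p)%N ->
  even_vertex (head root_vertex p) == b ->
  apply_event dim (Box 0 (jones_wenzl dim b k)) psi p = jw k psi p.
Proof.
elim: k psi p => [|k IH] psi p sp kp pb.
  case: p sp kp pb => [|x [|y r]] //= sp _ pb.
  rewrite (@apply_box R dim 0 b 0 _ [::] x [::] y r) //= big_mkcond.
  rewrite (sum_tuple0 (fun t => if path adj x (rcons t y) then _ (x :: y :: rev t) * psi (x :: t ++ y :: r) else 0)) /=.
  have /andP[xy _] := sp; rewrite xy /=.
  have /is_loopP[g gE] : is_loop 1 b [:: x; y].
    by rewrite /is_loop /= xy adj_sym xy pb.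
  by rewrite gE value_loop ffunE -gE /= eqxx mul1r.
have [m [y [r [zm pE]]]] : exists m y r, size m = k.+1 /\ p = head root_vertex p :: m ++ y :: r.
  case: p {sp pb} kp => [//|x p]; rewrite [size _]/= ltnS => /split_at1 [m [y [r [zm ->]]]].
  by exists m, y, r; split.
move: pE pb kp sp; move: (head _ p) => x ->; clear p => pb kp sp.
rewrite (@apply_box R dim k.+1 b 0 _ [::] x m y r) //=.
have sP : sorted adj (x :: rcons m y).
  by move: sp; rewrite -cat_rcons -cat_cons => /cat_sorted2[].
have sP' : path adj x (rcons m y) by [].
have zP : size (x :: rcons m y) = k.+3 by rewrite /= size_rcons zm.
pose framed q := (head root_vertex q == x) && (last root_vertex q == y).
pose chi q := if framed q then psi (q ++ r) else 0.
pose f := Box 0 (jones_wenzl dim b k).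
have chiE : forall D, final_size D k.+3 = k.+3 ->
  \sum_(t : k.+1.-tuple vertex | path adj x (rcons t y))
     state_sum dim D (x :: rcons m y) (x :: rcons t y) * psi (x :: t ++ y :: r)
  = run dim D chi (x :: rcons m y).
  move=> D zD; rewrite run_sum //.
  have -> : final_size D (size (x :: rcons m y)) = k.+3 by rewrite zP.
  rewrite big_mkcond [RHS]big_mkcond.
  pose G q := if sorted adj q then state_sum dim D (x :: rcons m y) q * chi q else 0.
  rewrite (@sum_tuple_frame R k.+3 [:: x] k.+1 [:: y] G) /=; first last.
  - case=> [//|z q] /= [zq]; rewrite take0 eqseq_cons eqxx andbT.
    case: (lastP q) zq => [//|q' w]; rewrite size_rcons => -[zq].
    rewrite drop_rcons ?zq // drop_oversize ?zq //= eqseq_cons andbT.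
    rewrite /G /chi /framed /= last_rcons => /negPf ->.
    by rewrite mulr0 if_same.
  - by rewrite addn1.
  apply: eq_bigr => t _; rewrite /G /= cats1 /chi /framed /= last_rcons !eqxx /=.
  by rewrite cat_rcons.
have D1 : final_size [:: f] k.+3 = k.+3 by [].
have D2 : final_size [:: f; Min R k; Max R k; f] k.+3 = k.+3 by [].
have loopE t : size t = k.+1 -> path adj x (rcons t y) ->
   value (jones_wenzl dim b k.+1) (x :: m ++ y :: rev t)
   = state_sum dim [:: f] (x :: rcons m y) (x :: rcons t y)
     - jw_coef R k * state_sum dim [:: f; Min R k; Max R k; f]
        (x :: rcons m y) (x :: rcons t y).
  move=> zt pt; have spt : sorted adj (x :: rcons t y) by [].
  have /is_loopP[g gE] : is_loop k.+2 b (x :: m ++ y :: rev t).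
    rewrite /is_loop cycle_of_walks sP spt pb andbT /= size_cat zm /= size_rev zt.
    by apply/eqP; lia.
  rewrite gE value_loop /= !ffunE -gE /=.
  rewrite -[m ++ _]cat_rcons take_size_cat ?size_rcons ?zm //.
  rewrite cat_rcons drop_size_cat //.
  by rewrite rev_cons revK.
transitivity (\sum_(t : k.+1.-tuple vertex | path adj x (rcons t y))
   (state_sum dim [:: f] (x :: rcons m y) (x :: rcons t y) * psi (x :: t ++ y :: r)
    - jw_coef R k * (state_sum dim [:: f; Min R k; Max R k; f]
        (x :: rcons m y) (x :: rcons t y) * psi (x :: t ++ y :: r)))).
  by apply: eq_bigr => t pt; rewrite loopE ?size_tuple // mulrBl mulrA.
rewrite sumrB -mulr_sumr !chiE // /run /=.
have chiP q : same_frame k.+1 (x :: rcons m y) q -> chi q = psi (q ++ r).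
  case=> sq zq hq dq; rewrite /chi /framed hq /= eqxx /=.
  rewrite (_ : last _ q == y) //; move: zq dq; case/lastP: q sq hq => [//|q' w] _ _.
  rewrite /= !size_rcons => -[zq]; rewrite !drop_rcons ?zq ?zm //.
  by move/(congr1 (last root_vertex)); rewrite !last_rcons => ->.
have headP q : same_frame k.+1 (x :: rcons m y) q -> even_vertex (head root_vertex q) == b.
  by case=> _ _ ->.
have sr : sorted adj ((x :: rcons m y) ++ r) by rewrite /= cat_rcons.
have kP : (k.+1 < size (x :: rcons m y))%N by rewrite zP.
have fE phi q : same_frame k.+1 (x :: rcons m y) q ->
    apply_event dim f phi q = jw k phi q.
  by move=> qf; have [sq zq _ _] := qf; rewrite IH ?headP // zq.
have refl : same_frame k.+1 (x :: rcons m y) (x :: rcons m y) by split.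
have jwE q : same_frame k.+1 (x :: rcons m y) q ->
    jw k chi q = jw k (fun s => psi (s ++ r)) q.
  move=> qf; have [sq zq _ _] := qf; apply: eq_jw_op; rewrite ?zq // => q'.
  by move=> /same_frameW qq'; apply: chiP; apply: same_frame_trans qf qq'.
rewrite [RHS](_ : _ = jw k.+1 (fun s => psi (s ++ r)) (x :: rcons m y)); last first.
  by rewrite (@jw_op_cat R dim k.+1 psi (x :: rcons m y) r) ?zP //= cat_rcons.
rewrite [RHS]/= fE // jwE //; congr (_ - _ * _); rewrite fE //.
apply: eq_jw_op => // q /same_frameW qf; have [sq zq _ _] := qf.
apply: eq_cap_cup => //; first by rewrite zq zP.
move=> q' qq'; have q'f := same_frame_trans qf qq'.
by rewrite fE // jwE.
Qed.

End Killing.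

(** * The two kinds of diagrams as sums over walks *)

Section Diagrams.
Context (R : realType) (dim : vertex -> R).
Hypothesis dim_gt0 : forall v, 0 < dim v.
Hypothesis dim_eigen : forall v, \sum_(w | adj v w) dim w = delta R * dim v.
Implicit Types (l r p q : seq vertex) (psi phi : seq vertex -> R[i]).

Local Notation sd := (sdim dim).

Lemma run1 e psi : run dim [:: e] psi = apply_event dim e psi.
Proof. by []. Qed.

Lemma run_cons e D psi : run dim (e :: D) psi = apply_event dim e (run dim D psi).
Proof. by []. Qed.

Lemma sum_walk3 x y (G : seq vertex -> R[i]) :
  \sum_(t : 3.-tuple vertex | sorted adj (x :: rcons t y)) G t
  = \sum_(r1 | adj x r1) \sum_(r2 | adj r1 r2) \sum_(r3 | adj r2 r3 && adj r3 y)
      G [:: r1; r2; r3].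
Proof.
rewrite big_mkcond (sum_tupleS _ (fun t => if sorted adj (x :: rcons t y) then G t else 0)).
rewrite [RHS]big_mkcond; apply: eq_bigr => r1 _.
rewrite (sum_tupleS _ (fun t => if sorted adj (x :: rcons (r1 :: t) y) then G (r1 :: t) else 0)) /=.
case: ifP => xr1; last by rewrite big1 // => r2 _; rewrite big1.
rewrite [RHS]big_mkcond; apply: eq_bigr => r2 _ /=.
rewrite (sum_tuple1 (fun t => if adj r1 r2 && path adj r2 (rcons t y) then G [:: r1, r2 & t] else 0)) /=.
case: ifP => r12; last by rewrite big1.
by rewrite [RHS]big_mkcond; apply: eq_bigr => r3 _; rewrite andbT.
Qed.

(** The four maxima create v1, .., v4 and their turns telescope to sd v4 / sd v; the box then
    replaces v1, v2, v3 by r1, r2, r3 on the left of v4. *)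
Lemma run_bent_down b (S : gpa R 4 b) i l v r psi :
  size l = i -> sorted adj (l ++ v :: r) ->
  run dim (bent_down i S) psi (l ++ v :: r)
  = \sum_(v1 | adj v v1) \sum_(v2 | adj v1 v2) \sum_(v3 | adj v2 v3)
    \sum_(v4 | adj v3 v4)
    \sum_(r1 | adj v r1) \sum_(r2 | adj r1 r2) \sum_(r3 | adj r2 r3 && adj r3 v4)
      sd v4 / sd v * value S [:: v; v1; v2; v3; v4; r3; r2; r1]
      * psi (l ++ [:: v, r1, r2, r3, v4, v3, v2, v1, v & r]).
Proof.
move=> li sp; rewrite /bent_down /run /= addn0.
rewrite apply_max //; apply: eq_bigr => v1 vv1.
have s1 : sorted adj ((l ++ [:: v]) ++ [:: v1, v & r]).
  by rewrite -catA sorted_adj_bulge.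
rewrite -[[:: v, v1, v & r]]cat1s catA apply_max ?size_cat ?li //.
rewrite mulr_sumr; apply: eq_bigr => v2 vv2.
have s2 : sorted adj ((l ++ [:: v; v1]) ++ [:: v2, v1, v & r]).
  by rewrite -[[:: v; v1]]cat1s catA -catA sorted_adj_bulge.
rewrite -catA [[:: v] ++ _]/= -[[:: v, v1, v2 & _]](cat_cons v [:: v1]) catA.
rewrite apply_max ?size_cat ?li // !mulr_sumr; apply: eq_bigr => v3 vv3.
have s3 : sorted adj ((l ++ [:: v; v1; v2]) ++ [:: v3, v2, v1, v & r]).
  by rewrite (_ : l ++ _ = (l ++ [:: v; v1]) ++ [:: v2]) -?catA // catA sorted_adj_bulge.
rewrite -catA [[:: v; v1] ++ _]/= -[[:: v, v1, v2, v3 & _]](cat_cons v [:: v1; v2]) catA.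
rewrite apply_max ?size_cat ?li // !mulr_sumr; apply: eq_bigr => v4 vv4.
have s4 : sorted adj (l ++ v :: [:: v1; v2; v3] ++ v4 :: [:: v3, v2, v1, v & r]).
  rewrite (_ : l ++ _ = (l ++ [:: v; v1; v2]) ++ [:: v3, v4, v3, v2, v1, v & r]) -?catA //.
  by rewrite catA sorted_adj_bulge.
rewrite -catA [[:: v; v1; v2] ++ _]/=.
rewrite (@apply_box _ dim 3 b i S l v [:: v1; v2; v3] v4 [:: v3, v2, v1, v & r]) //.
rewrite (sum_walk3 v v4 (fun t => value S (v :: [:: v1; v2; v3] ++ v4 :: rev t) *
  psi (l ++ v :: t ++ [:: v4, v3, v2, v1, v & r]))).
have tE : turn dim v1 v * (turn dim v2 v1 * (turn dim v3 v2 * turn dim v4 v3)) = sd v4 / sd v.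
  by rewrite !turnE //; field; rewrite !sdim_neq0.
rewrite !mulr_sumr; apply: eq_bigr => r1 _.
rewrite !mulr_sumr; apply: eq_bigr => r2 _.
rewrite !mulr_sumr; apply: eq_bigr => r3 _.
by rewrite -tE !mulrA.
Qed.

(** The caps that join S to T identify three regions of T with regions of S. *)
Lemma sum_matching3 v v1 v2 v3 t (H : vertex -> vertex -> vertex -> R[i]) :
  adj v v1 -> adj v1 v2 -> adj v2 v3 ->
  (forall q1 q2 q3 : vertex, adj v q1 -> adj q1 q2 -> adj q2 q3 && adj q3 t ->
     ~~ [&& v1 == q1, v2 == q2 & v3 == q3] -> H q1 q2 q3 = 0) ->
  \sum_(q1 | adj v q1) \sum_(q2 | adj q1 q2) \sum_(q3 | adj q2 q3 && adj q3 t) H q1 q2 q3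
  = if adj t v3 then H v1 v2 v3 else 0.
Proof.
move=> a1 a2 a3 H0; rewrite (bigD1 v1) //= [X in _ + X]big1 ?addr0; last first.
  move=> q1 /andP[d1 /negPf n1]; rewrite big1 // => q2 d2; rewrite big1 // => q3 d3.
  by rewrite H0 // eq_sym n1.
rewrite (bigD1 v2) //= [X in _ + X]big1 ?addr0; last first.
  move=> q2 /andP[d2 /negPf n2]; rewrite big1 // => q3 d3.
  by rewrite H0 // (eq_sym v2) n2 andbF.
case: ifP => d; last first.
  rewrite big1 // => q3 /andP[d3 d4]; rewrite H0 ?d3 //.
  by apply: contraFN d => /and3P[_ _ /eqP ->]; rewrite adj_sym.
rewrite (bigD1 v3) ?a3 1?adj_sym //= big1 ?addr0 //.
by move=> q3 /andP[d3 /negPf n3]; rewrite H0 // (eq_sym v3) n3 !andbF.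
Qed.

Lemma run_three_caps psi l x3 x2 x1 y z1 z2 z3 r : (size l = 5)%N ->
  sorted adj (l ++ [:: x3, x2, x1, y, z1, z2, z3 & r]) ->
  run dim [seq Min R (4.*2.-1 - k) | k <- iota 0 4.-1] psi
     (l ++ [:: x3, x2, x1, y, z1, z2, z3 & r])
  = if [&& x1 == z1, x2 == z2 & x3 == z3] then sd y / sd x3 * psi (l ++ x3 :: r)
    else 0.
Proof.
move=> zl sp; rewrite /run /=.
have E1 : l ++ [:: x3, x2, x1, y, z1, z2, z3 & r]
    = (l ++ [:: x3; x2]) ++ [:: x1, y, z1, z2, z3 & r] by rewrite -catA.
rewrite E1 in sp *; rewrite apply_min ?size_cat ?zl //.
case: eqP => [e1|_] //=; rewrite -{}e1 in sp *; move/sorted_adj_flat: sp => sp.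
have E2 : (l ++ [:: x3; x2]) ++ [:: x1, z2, z3 & r]
    = (l ++ [:: x3]) ++ [:: x2, x1, z2, z3 & r] by rewrite -!catA.
rewrite E2 in sp *; rewrite apply_min ?size_cat ?zl //.
case: eqP => [e2|_] //=; last by rewrite mulr0.
rewrite -{}e2 in sp *; move/sorted_adj_flat: sp; rewrite -catA => sp.
rewrite (@apply_min _ _ _ l x3 x2 z3 r) ?zl //=; case: eqP => [e3|_] //=; last by rewrite !mulr0.
by rewrite !mulrA !turnE //; congr (_ * _); field; rewrite !sdim_neq0.
Qed.

(** The function Phi of the overview: the column of f^(10) at the bottom labels read off g. *)
Definition jw_column (g : seq vertex) : seq vertex -> R[i] :=
  jw_op dim 9 (fun q => (q == rev (rcons g (head root_vertex g)))%:R).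

Lemma apply_jw_column b (g : seq vertex) p : sorted adj p -> size p = 11%N ->
  even_vertex (head root_vertex p) == b ->
  apply_event dim (Box 0 (jones_wenzl dim b 4.*2.+1))
    (fun q => (q == rev (rcons g (head root_vertex g)))%:R) p = jw_column g p.
Proof. by move=> sp zp; apply: apply_jones_wenzl; rewrite ?zp. Qed.

(** Here v is the outer region, v1, v2, v3 are the regions below the successive parallel
    strings that join S to T, and r1, r2, r3, v4 (resp. t1, .., t4) separate the strings that run
    down from S (resp. T). *)
Lemma f_circ_sum b (S T : gpa R 4 b) (g : loop 5 b) :
  let v := head root_vertex g in
  f_circ dim S T g
  = \sum_(v1 | adj v v1) \sum_(v2 | adj v1 v2) \sum_(v3 | adj v2 v3)
    \sum_(v4 | adj v3 v4)
    \sum_(r1 | adj v r1) \sum_(r2 | adj r1 r2) \sum_(r3 | adj r2 r3 && adj r3 v4)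
    \sum_(t1 | adj v t1) \sum_(t2 | adj t1 t2) \sum_(t3 | adj t2 t3)
    \sum_(t4 | adj t3 t4 && adj t4 v3)
      sd v4 * sd t4 / (sd v * sd v3)
      * value S [:: v; v1; v2; v3; v4; r3; r2; r1]
      * value T [:: v; t1; t2; t3; t4; v3; v2; v1]
      * jw_column g [:: v; r1; r2; r3; v4; v3; t4; t3; t2; t1; v].
Proof.
move=> v.
have vb : even_vertex v == b by case/and3P: (valP g).
rewrite /f_circ /of_bottom_diagram ffunE -/v state_sum_run.
rewrite (run_cat dim (circ S T)) (run_cat dim (bent_down 0 S)).
rewrite (@run_bent_down _ S 0 [::] v [::]) //.
apply: eq_bigr => v1 a1; apply: eq_bigr => v2 a2; apply: eq_bigr => v3 a3.
apply: eq_bigr => v4 a4; apply: eq_bigr => r1 b1; apply: eq_bigr => r2 b2.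
apply: eq_bigr => r3 /andP[b3 b4]; rewrite (run_cat dim (bent_down 4.*2 T)) cat0s.
have sym := adj_sym.
have s1 : sorted adj [:: v; r1; r2; r3; v4; v3; v2; v1; v].
  by rewrite /= b1 b2 b3 b4 (sym v4) a4 (sym v3) a3 (sym v2) a2 (sym v1) a1.
rewrite (@run_bent_down _ T _ [:: v; r1; r2; r3; v4; v3; v2; v1] v [::]) //.
rewrite mulr_sumr; apply: eq_bigr => t1 c1.
rewrite mulr_sumr; apply: eq_bigr => t2 c2.
rewrite mulr_sumr; apply: eq_bigr => t3 c3.
rewrite mulr_sumr [RHS]big_mkcondr; apply: eq_bigr => t4 c4.
have E (q1 q2 q3 : vertex) : adj v q1 -> adj q1 q2 -> adj q2 q3 && adj q3 t4 ->
  run dim [seq Min R (4.*2.-1 - k) | k <- iota 0 4.-1]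
    (run dim [:: Box 0 (jones_wenzl dim b 4.*2.+1)] (fun q => (q == rev (rcons g (head root_vertex g)))%:R))
     [:: v; r1; r2; r3; v4; v3; v2; v1; v; q1; q2; q3; t4; t3; t2; t1; v]
  = if [&& v1 == q1, v2 == q2 & v3 == q3] then
      sd v / sd v3 * jw_column g [:: v; r1; r2; r3; v4; v3; t4; t3; t2; t1; v]
    else 0.
  move=> d1 d2 /andP[d3 d4].
  rewrite (@run_three_caps _ [:: v; r1; r2; r3; v4] v3 v2 v1 v q1 q2 q3 [:: t4; t3; t2; t1; v]) //; last first.
    by move: s1; rewrite /= d1 d2 d3 d4 (sym t4) c4 (sym t3) c3 (sym t2) c2 (sym t1) c1.
  case: and3P => // -[_ _ /eqP e3]; congr (_ * _).
  rewrite run1 apply_jw_column //.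
  by rewrite /= b1 b2 b3 b4 (sym v4) a4 e3 d4 (sym t4) c4 (sym t3) c3 (sym t2) c2 (sym t1) c1.
rewrite (@sum_matching3 v v1 v2 v3 t4 (fun q1 q2 q3 : vertex =>
  sd t4 / sd v * value T [:: v; t1; t2; t3; t4; q3; q2; q1] *
  run dim [seq Min R (4.*2.-1 - k) | k <- iota 0 4.-1]
    (run dim [:: Box 0 (jones_wenzl dim b 4.*2.+1)] (fun q => (q == rev (rcons g (head root_vertex g)))%:R))
     [:: v; r1; r2; r3; v4; v3; v2; v1; v; q1; q2; q3; t4; t3; t2; t1; v])) //; last first.
  by move=> q1 q2 q3 d1 d2 d3 /negPf ne; rewrite E // ne mulr0.
case: ifP => d; last by rewrite mulr0.
have d' : adj v2 v3 && adj v3 t4 by rewrite a3 sym.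
rewrite (E _ _ _ a1 a2 d') !eqxx [in LHS]/= !mulrA; congr (_ * _).
by field; rewrite !sdim_neq0.
Qed.

(** Here u is the region between S and the additional arc. *)
Lemma f_jelly_sum b (S : gpa R 4 b) (g : loop 5 (~~ b)) :
  let v := head root_vertex g in
  f_jelly dim S g
  = \sum_(u | adj v u)
    \sum_(v1 | adj u v1) \sum_(v2 | adj v1 v2) \sum_(v3 | adj v2 v3)
    \sum_(v4 | adj v3 v4)
    \sum_(r1 | adj u r1) \sum_(r2 | adj r1 r2) \sum_(r3 | adj r2 r3 && adj r3 v4)
      sd v4 / sd v
      * value S [:: u; v1; v2; v3; v4; r3; r2; r1]
      * jw_column g [:: v; u; r1; r2; r3; v4; v3; v2; v1; u; v].
Proof.
move=> v.
have vb : even_vertex v == ~~ b by case/and3P: (valP g).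
have sym := adj_sym.
rewrite /f_jelly /of_bottom_diagram ffunE -/v state_sum_run.
rewrite (run_cat dim (jelly S)) /jelly run_cons.
rewrite (@apply_max _ _ 0 [::] v [::]) //; apply: eq_bigr => u a0.
rewrite (@run_bent_down _ S 1 [:: v] u [:: v]) //; last by rewrite /= a0 sym a0.
rewrite mulr_sumr; apply: eq_bigr => v1 a1.
rewrite mulr_sumr; apply: eq_bigr => v2 a2.
rewrite mulr_sumr; apply: eq_bigr => v3 a3.
rewrite mulr_sumr; apply: eq_bigr => v4 a4.
rewrite mulr_sumr; apply: eq_bigr => r1 b1.
rewrite mulr_sumr; apply: eq_bigr => r2 b2.
rewrite mulr_sumr; apply: eq_bigr => r3 /andP[b3 b4].
rewrite run1 apply_jw_column //; last first.
  by rewrite /= a0 b1 b2 b3 b4 (sym v4) a4 (sym v3) a3 (sym v2) a2 (sym v1) a1 sym a0.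
rewrite turnE // !mulrA; congr (_ * _ * _); field; by rewrite !sdim_neq0.
Qed.

Lemma jw_column_cup g l x r : sorted adj (l ++ x :: r) -> (size l + size r = 8)%N ->
  \sum_(w | adj x w) turn dim w x * jw_column g (l ++ [:: x, w, x & r]) = 0.
Proof.
move=> sp zp; rewrite -(apply_max dim (jw_column g) (erefl (size l)) sp).
apply: cup_jw_op_eq0 => //.
by rewrite size_cat /= addnS zp !ltnS andbT -zp leq_addr.
Qed.

End Diagrams.

(** * Arithmetic in Z[sqrt 5] *)

(** The pair (a, b) stands for a + b sqrt 5; binary integers make the coefficients cheap to
    compute with. *)
Definition zr5 : Type := (Z * Z)%type.

Section Operations.
Local Open Scope Z_scope.
Definition zr5_add (x y : zr5) : zr5 := (x.1 + y.1, x.2 + y.2).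
Definition zr5_opp (x : zr5) : zr5 := (- x.1, - x.2).
Definition zr5_mul (x y : zr5) : zr5 :=
  let: (a, b) := x in let: (c, d) := y in (a * c + 5 * (b * d), a * d + b * c).
Definition zr5_is0 (x : zr5) : bool := Z.eqb x.1 0 && Z.eqb x.2 0.
End Operations.

Section Evaluation.
Context (R : realType).

Definition sqrt5 : R[i] := (Num.sqrt 5)%:C.
Definition deltaC : R[i] := (delta R)%:C.

Definition Z_val (z : Z) : R[i] := (int_of_Z z)%:~R.

Lemma Z_valD a b : Z_val (Z.add a b) = Z_val a + Z_val b.
Proof. by rewrite /Z_val (rmorphD int_of_Z) rmorphD. Qed.

Lemma Z_valM a b : Z_val (Z.mul a b) = Z_val a * Z_val b.
Proof. by rewrite /Z_val (rmorphM int_of_Z) rmorphM. Qed.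

Lemma Z_valN a : Z_val (Z.opp a) = - Z_val a.
Proof. by rewrite /Z_val (rmorphN int_of_Z) rmorphN. Qed.

Definition zr5_val (x : zr5) : R[i] := Z_val x.1 + Z_val x.2 * sqrt5.

Lemma sqrt5_sqr : sqrt5 * sqrt5 = 5.
Proof. by rewrite /sqrt5 -rmorphM -expr2 sqr_sqrtr ?ler0n // rmorph_nat. Qed.

Lemma deltaC_sqr : deltaC * deltaC = 3 + sqrt5.
Proof.
rewrite /deltaC -rmorphM -expr2 sqr_sqrtr ?addr_ge0 ?sqrtr_ge0 ?ler0n //.
by rewrite rmorphD rmorph_nat.
Qed.

Lemma deltaC_neq0 : deltaC != 0.
Proof.
rewrite /deltaC fmorph_eq0 gt_eqF //; apply: lt_le_trans (delta_ge2 R).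
by rewrite ltr0n.
Qed.

Lemma zr5_valD x y : zr5_val (zr5_add x y) = zr5_val x + zr5_val y.
Proof. by rewrite /zr5_val /= !Z_valD; ring. Qed.

Lemma zr5_valN x : zr5_val (zr5_opp x) = - zr5_val x.
Proof. by rewrite /zr5_val /= !Z_valN; ring. Qed.

Lemma zr5_valM x y : zr5_val (zr5_mul x y) = zr5_val x * zr5_val y.
Proof.
case: x y => [a b] [c d]; rewrite /zr5_val; cbn [zr5_mul fst snd].
rewrite !Z_valD !Z_valM (_ : Z_val (Zpos 5) = sqrt5 * sqrt5); last first.
  by rewrite sqrt5_sqr.
ring.
Qed.

Lemma zr5_val0 x : zr5_is0 x -> zr5_val x = 0.
Proof.
by case: x => a b /andP[/Z.eqb_spec /= -> /Z.eqb_spec /= ->]; rewrite /zr5_val /= mul0r addr0.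
Qed.

End Evaluation.

(** * The vertices of 3333 *)

(** [Some (j, k)] codes the vertex of arm j at distance k + 1 from the center; unlike the
    finite type [vertex], codes reduce well under evaluation. *)
Definition code : Type := option (nat * nat).

Definition decode (x : code) : vertex :=
  if x is Some (j, k) then arm_vertex (inord j) (inord k) else center.

Definition codes : seq code :=
  None :: [seq Some (j, k) | j <- iota 0 4, k <- iota 0 3].

Arguments codes : simpl never.

Definition arms_at_center : seq code := [seq Some (j, 0%N) | j <- iota 0 4].

Definition nbrs (x : code) : seq code :=
  match x with
  | None => arms_at_center
  | Some (j, 0%N) => [:: None; Some (j, 1%N)]
  | Some (j, 1%N) => [:: Some (j, 0%N); Some (j, 2%N)]
  | Some (j, _) => [:: Some (j, 1%N)]
  end.

Definition code_eqb (x y : code) : bool :=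
  match x, y with
  | None, None => true
  | Some (j, k), Some (j', k') => eqn j j' && eqn k k'
  | _, _ => false
  end.

Definition adj_code (x y : code) : bool := has (code_eqb y) (nbrs x).

(** Parity of the distance to the root, which does not depend on the arm. *)
Definition even_code (x : code) : bool := if x is Some (_, k) then ~~ odd k else false.

Lemma code_eqbE x y : code_eqb x y = (x == y).
Proof. by case: x y => [[j k]|] [[j' k']|]. Qed.

Lemma adj_codeE x y : adj_code x y = (y \in nbrs x).
Proof.
rewrite /adj_code -has_pred1; apply: eq_has => z.
by rewrite code_eqbE eq_sym.
Qed.

Lemma codesP x : x \in codes ->
  x = None \/ exists j k, [/\ x = Some (j, k), (j < 4)%N & (k < 3)%N].
Proof.
rewrite inE => /predU1P[->|/allpairsP[[j k] [jI kI ->]]]; first by left.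
by right; exists j, k; rewrite !mem_iota in jI kI.
Qed.

Lemma mem_codes j k : (j < 4)%N -> (k < 3)%N -> Some (j, k) \in codes.
Proof.
move=> j4 k3; rewrite inE; apply/orP; right.
by apply/allpairsP; exists (j, k); split=> //; rewrite mem_iota.
Qed.

Lemma nbrs_codes x y : x \in codes -> y \in nbrs x -> y \in codes.
Proof.
case/codesP=> [->|[j [k [-> j4 k3]]]].
  by case/mapP=> j; rewrite mem_iota => /andP[_ j4] ->; apply: mem_codes.
case: k k3 => [|[|[|//]]] _; rewrite /nbrs !in_cons in_nil orbF.
- by case/orP=> /eqP-> //; apply: mem_codes.
- by case/orP=> /eqP->; apply: mem_codes.
- by move/eqP->; apply: mem_codes.
Qed.

Lemma vertex_decode (v : vertex) : exists2 x, x \in codes & v = decode x.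
Proof.
case: v => [[j k]|]; last by exists None.
exists (Some (nat_of_ord j, nat_of_ord k)); first by rewrite mem_codes.
by rewrite /= !inord_val.
Qed.

Lemma decode_inj : {in codes &, injective decode}.
Proof.
move=> x y /codesP[->|[j [k [-> j4 k3]]]] /codesP[->|[j' [k' [-> j4' k3']]]] //.
by case=> /(congr1 val) + /(congr1 val); rewrite /= !inordK // => -> ->.
Qed.

Lemma adj_decode x y : x \in codes -> y \in codes ->
  adj (decode x) (decode y) = (y \in nbrs x).
Proof.
move=> /codesP[->|[j [k [-> j4 k3]]]] /codesP[->|[j' [k' [-> j4' k3']]]] //;
  rewrite /adj /=.
- transitivity (k' == 0%N); first by rewrite orbF -val_eqE /= inordK.
  apply/eqP/mapP => [->|[i _ [_ ->//]]].
  by exists j'; rewrite ?mem_iota.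
- rewrite -val_eqE /= inordK //.
  by case: k k3 => [|[|[|]]].
- rewrite -!val_eqE /= !inordK //.
  case: k k3 => [|[|[|//]]] _; case: k' k3' => [|[|[|//]]] _;
  rewrite /= !in_cons in_nil /eq_op /= /eq_op /= ?andbF ?andbT ?orbF //= eq_sym //.
Qed.

Lemma uniq_nbrs x : x \in codes -> uniq (nbrs x).
Proof.
case/codesP=> [->|[j [k [-> _ k3]]]] //; case: k k3 => [|[|[|//]]] _ //.
by rewrite /= andbT inE; apply/eqP; case.
Qed.

Lemma sum_nbrs (V : nmodType) x (f : vertex -> V) : x \in codes ->
  \sum_(w | adj (decode x) w) f w = \sum_(y <- nbrs x) f (decode y).
Proof.
move=> xc.
have inj : {in nbrs x &, injective decode}.
  by move=> y z yx zx; apply: decode_inj; apply: nbrs_codes xc _.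
rewrite -(big_map decode predT f) big_uniq /=; last by rewrite map_inj_in_uniq ?uniq_nbrs.
apply: eq_bigl => w; apply/idP/mapP => [|[y yx ->]]; last first.
  by rewrite adj_decode // (nbrs_codes xc yx).
case: (vertex_decode w) => y yc ->; rewrite adj_decode // => yx.
by exists y.
Qed.

(** * Pushing walks towards the center *)

(** The spoke position of the same parity on the same arm, see [flatten_one]. *)
Definition flat (x : code) : code :=
  if x is Some (j, k) then (if odd k then None else Some (j, 0%N)) else None.

Definition leaf (x : code) : bool := if x is Some (_, 2%N) then true else false.

Definition walk : rel code := fun x y => y \in nbrs x.

Lemma walk_sym : {in codes &, symmetric walk}.
Proof. by move=> x y xc yc; rewrite /walk -!adj_decode // adj_sym. Qed.

Lemma even_vertex_decode x : x \in codes -> even_vertex (decode x) = even_code x.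
Proof.
case/codesP=> [->|[j [k [-> j4 k3]]]] //; rewrite /even_vertex /dist_root /=.
rewrite -val_eqE /= !inordK //.
by case: j j4 => [|j] _; case: k k3 => [|[|[|]]] //= _; rewrite ?addnE /= ?negbK //.
Qed.

Lemma nbrs_even x y : x \in codes -> y \in nbrs x -> even_code y = ~~ even_code x.
Proof.
case/codesP=> [->|[j [k [-> j4 k3]]]].
  by rewrite /nbrs /arms_at_center => /mapP[i _ ->].
case: k k3 => [|[|[|//]]] _; rewrite /nbrs !in_cons in_nil orbF.
- by case/orP=> /eqP->.
- by case/orP=> /eqP->.
- by move/eqP->.
Qed.

Lemma sorted_decode s : all (mem codes) s ->
  sorted adj [seq decode x | x <- s] = sorted walk s.
Proof.
case: s => [//|x s] /= /andP[]; elim: s x => [//|y s IH] x xc /= /andP[yc sc].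
by rewrite adj_decode // IH.
Qed.

Section Gauge.
Context (R : realType) (dim : vertex -> R).
Hypothesis dim_gt0 : forall v, 0 < dim v.
Hypothesis dim_eigen : forall v, \sum_(w | adj v w) dim w = delta R * dim v.

(** The sign by which the value changes when x is replaced by [flat x]. *)
Definition eps (x : code) : R[i] := if x is Some (_, k.+1) then -1 else 1.

Lemma eps_sqr x : eps x * eps x = 1.
Proof. by case: x => [[j [|k]]|] /=; rewrite ?mulr1 // mulrNN mulr1. Qed.

(** If x = z, then x has two neighbours unless it is the center, and the vanishing sum
    exchanges them up to sign.  If x <> z, then y is the only vertex between them and is already
    flat.  Leaves are excluded: their only neighbour would have value 0. *)
Lemma flatten_one (h : code -> R[i]) x y z : x \in codes -> z \in codes ->
  y \in nbrs x -> y \in nbrs z -> ~~ leaf x -> ~~ leaf z ->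
  (x = z -> \sum_(w <- nbrs x) h w = 0) -> h y = eps y * h (flat y).
Proof.
move=> xc zc xy zy xl zl h0.
have sum2 (a b : code) : h a + h b = 0 -> h b = - h a.
  by move/eqP; rewrite addrC addr_eq0 => /eqP.
have yc := nbrs_codes xc xy.
case/codesP: (yc) xy zy => [->|[j [k [-> j4 k3]]]]; first by rewrite mul1r.
case: k k3 yc => [|[|[|//]]] _ yc xy zy; first by rewrite mul1r.
- have n1 w : w \in codes -> ~~ leaf w -> Some (j, 1%N) \in nbrs w -> w = Some (j, 0%N).
    move=> wc wl; rewrite -[_ \in _]/(walk _ _) walk_sym ?mem_codes // /walk /nbrs !in_cons in_nil orbF.
    by case/orP=> /eqP wE; move: wl; rewrite wE.
  have xE := n1 x xc xl xy; have zE := n1 z zc zl zy.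
  move: h0; rewrite xE zE /= => /(_ erefl).
  by rewrite !big_cons big_nil addr0 => /sum2 ->; rewrite mulN1r.
- have n1 w : w \in codes -> Some (j, 2%N) \in nbrs w -> w = Some (j, 1%N).
    move=> wc; rewrite -[_ \in _]/(walk _ _) walk_sym ?mem_codes // /walk /nbrs !in_cons in_nil orbF.
    by move/eqP.
  have xE := n1 x xc xy; have zE := n1 z zc zy.
  move: h0; rewrite xE zE /= => /(_ erefl).
  by rewrite !big_cons big_nil addr0 => /sum2 ->; rewrite mulN1r.
Qed.

Local Notation sd x := (sdim dim (decode x)).

(** The rescaling for which caps sum with coefficient 1 ([uncappable_sum]); the extra factors
    sd g_0 and sd g_4 do the same for rotations ([gauge_fourier]). *)
Definition gauge b (S : gpa R 4 b) (g : seq code) : R[i] :=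
  (\prod_(x <- g) sd x) * (sd (nth None g 0) * sd (nth None g 4))
    * value S [seq decode x | x <- g].

Definition closed_walk (g : seq code) : bool :=
  [&& all (mem codes) g, size g == 8 & cycle walk g].

Lemma is_loop_decode b g : closed_walk g -> even_code (head None g) == b ->
  is_loop 4 b [seq decode x | x <- g].
Proof.
case/and3P=> gc /eqP zg gw gb; rewrite /is_loop size_map zg eqxx /=.
case: g gc zg gw gb => [//|x g] /= /andP[xc gc] _ gw gb.
rewrite /= even_vertex_decode // gb andbT -map_rcons.
rewrite -[path _ _ _]/(sorted adj [seq decode y | y <- x :: rcons g x]).
by rewrite sorted_decode //= all_rcons xc gc andbT.
Qed.

Lemma closed_walk_rot n g : closed_walk g -> closed_walk (rot n g).
Proof.
case/and3P=> gc zg gw; apply/and3P; split.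
- by rewrite (perm_all (s2 := g)) ?perm_rot.
- by rewrite size_rot.
- by rewrite rot_cycle.
Qed.

(** The dimension factors of the Fourier transform are exactly the change of gauge: in the
    rescaled picture it is a pure rotation. *)
Lemma gauge_fourier b (S : gpa R 4 b) g :
  closed_walk g -> even_code (head None g) == ~~ b ->
  gauge (fourier dim S) g = gauge S (rot 1 g).
Proof.
move=> gP gb; have /is_loopP[g' gE] := is_loop_decode gP gb.
rewrite /gauge gE value_loop ffunE -gE -map_rot.
case/and3P: gP => _ /eqP zg _.
move: g zg {gE gb} => [|x0[|x1[|x2[|x3[|x4[|x5[|x6[|x7[|//]]]]]]]]] // _.
rewrite /label /= !big_cons !big_nil.
rewrite sqrtrM ?mulr_ge0 ?ltW // sqrtrV ?mulr_ge0 ?ltW // !sqrtrM ?ltW //.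
rewrite !rmorphM /= fmorphV rmorphM -!/(sdim dim _) !mulrA; congr (_ * _).
by field; rewrite !sdim_neq0.
Qed.

Lemma dual_gen_fourier b (S : gpa R 4 b) : dual_gen dim 1 S = fourier dim S.
Proof. by apply/ffunP=> g; rewrite ffunE invr1 mul1r. Qed.

Lemma apply_box_delta b n (S : gpa R n.+1 b) x m y t : size m = n -> size t = n ->
  sorted adj (x :: rcons m y) -> sorted adj (x :: rcons t y) ->
  apply_event dim (Box 0 S) (fun q => (q == x :: rcons t y)%:R) (x :: rcons m y)
  = value S (x :: m ++ y :: rev t).
Proof.
move=> zm zt sm st; rewrite -cats1 in sm *.
rewrite (@apply_box R dim n b 0 S [::] x m y [::]) //=.
have zt' : size t == n by apply/eqP.
rewrite (bigD1 (Tuple zt')) //= big1 => [|t' /andP[_ t't]].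
  by rewrite cats1 eqxx mulr1 addr0.
rewrite cats1 eqseq_cons eqseq_rcons !eqxx andbT /=.
by rewrite (_ : (tval t' == t) = false) ?mulr0 //; apply/negbTE.
Qed.

(** A cap that joins two neighbouring top strings of the box, in rescaled form; the shapes
    of (l, r) are the three positions of the cap. *)
Lemma uncappable_sum b (S : gpa R 4 b) l x r a c t :
  uncappable dim S -> size t = 3%N ->
  all (mem codes) (l ++ x :: r) -> all (mem codes) t ->
  sorted walk (l ++ x :: r) -> sorted walk (a :: rcons t c) ->
  (l = [::] /\ exists d, r = [:: d; c] /\ x = a) \/
  (l = [:: a] /\ r = [:: c]) \/ ((exists d, l = [:: a; d]) /\ r = [::] /\ x = c) ->
  \sum_(w <- nbrs x) gauge S (l ++ [:: x, w, x & r] ++ rev t) = 0.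
Proof.
move=> [unc _ _ _] zt pc tc pw tw shape.
have xc : x \in codes by move: pc; rewrite all_cat /= => /and3P[].
have [zl [hd [la zr]]] : (size l < 3)%N /\ head None (l ++ x :: r) = a /\
   last None (l ++ x :: r) = c /\ (size l + size r = 2)%N.
  by case: shape => [[-> [d [-> ->]]]|[[-> ->]|[[d ->] [-> ->]]]].
have ac : a \in codes.
  by move: pc; rewrite -hd; case: (l) => [|? ?] /= /andP[].
have cc : c \in codes.
  move: pc; rewrite -la; case: (lastP (l ++ x :: r)) (erefl (l ++ x :: r)) => [|s y].
    by case: (l).
  by rewrite last_rcons all_rcons => _ /andP[].
have := unc (size l) zl [seq decode y | y <- l ++ x :: r]
            [seq decode y | y <- a :: rcons t c].
rewrite size_map size_cat [size (x :: r)]/= addnS zr => /(_ erefl).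
rewrite sorted_decode // => /(_ pw).
rewrite (state_sum_run dim [:: Max R (size l); Box 0 S]) run_cons run1.
rewrite map_cat /= apply_max ?size_map //; last first.
  by rewrite -map_cons -map_cat sorted_decode.
rewrite sum_nbrs // => E.
pose C := (\prod_(y <- l ++ [:: x, x & r] ++ rev t) sd y) * (sd a * sd c) * sd x.
transitivity (C * 0); last by rewrite mulr0.
rewrite -[in RHS]E mulr_sumr; apply: eq_big_seq => w wx.
have wc := nbrs_codes xc wx.
have [m [zm mE]] : exists m, size m = 3%N /\ l ++ [:: x, w, x & r] = a :: rcons m c.
  case: shape => [[-> [d [-> ->]]]|[[-> ->]|[[d ->] [-> ->]]]].
  - by exists [:: w; a; d].
  - by exists [:: x; w; x].
  - by exists [:: d; c; w].
have mw : sorted walk (a :: rcons m c).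
  rewrite -mE -sorted_decode ?map_cat /=; last first.
    by move: pc; rewrite !all_cat /= => /and3P[-> -> ->]; rewrite wc.
  rewrite sorted_adj_bulge ?adj_decode //.
  by rewrite -map_cons -map_cat sorted_decode.
have mc : all (mem codes) (a :: rcons m c).
  rewrite -mE; move: pc; rewrite !all_cat /= => /and3P[-> -> ->].
  by rewrite wc.
rewrite (_ : _ ++ _ = decode a :: rcons (map decode m) (decode c)); last first.
  by rewrite -map_rcons -map_cons -mE map_cat.
rewrite [map decode (rcons t c)]map_rcons.
have tcc : all (mem codes) (a :: rcons t c) by rewrite /= ac all_rcons /= cc.
rewrite apply_box_delta ?size_map -?map_rcons -?map_cons ?sorted_decode //.
have gE : l ++ [:: x, w, x & r] ++ rev t = a :: m ++ c :: rev t.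
  by rewrite catA mE cat_cons cat_rcons.
rewrite -[gauge _ _]/(gauge S (l ++ [:: x, w, x & r] ++ rev t)) gE /gauge /C turnE //.
rewrite -map_rev -!map_cons -!map_cat -!map_cons.
rewrite (_ : nth None _ 4 = c); last first.
  by rewrite /= nth_cat zm.
have -> : \prod_(y <- a :: m ++ c :: rev t) sd y
    = sd w * \prod_(y <- l ++ [:: x, x & r] ++ rev t) sd y.
  rewrite -cat_rcons -cat_cons -mE -!catA !big_cat /= !big_cons ?big_cat /=; ring.
rewrite [nth _ _ _]/=; field; exact: sdim_neq0.
Qed.

End Gauge.

(** * The tables of A and B *)

Section Tables.
Local Open Scope Z_scope.
(** The entries of the tables, multiplied by 8. *)
Definition ztable : seq (seq nat * (zr5 * zr5)) :=
  [:: ([:: 1; 1; 1; 2]%N, ((4, -2), (-15, 7)));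
      ([:: 1; 1; 1; 3]%N, ((-7, 3), (-3, 1)));
      ([:: 1; 1; 2; 2]%N, ((-6, 2), (8, -4)));
      ([:: 1; 1; 2; 3]%N, ((3, -1), (2, 0)));
      ([:: 1; 1; 3; 2]%N, ((3, -1), (2, 0)));
      ([:: 1; 1; 3; 3]%N, ((6, -2), (8, -4)));
      ([:: 1; 2; 1; 2]%N, ((-2, 2), (10, -6)));
      ([:: 1; 2; 1; 3]%N, ((-1, -1), (4, -2)));
      ([:: 1; 2; 2; 2]%N, ((4, -2), (-15, 7)));
      ([:: 1; 2; 2; 3]%N, ((-1, 1), (5, -3)));
      ([:: 1; 2; 3; 2]%N, ((-1, 1), (1, 1)));
      ([:: 1; 2; 3; 3]%N, ((-2, 0), (-7, 3)));
      ([:: 1; 3; 1; 3]%N, ((6, -2), (4, 0)));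
      ([:: 1; 3; 2; 2]%N, ((-1, 1), (5, -3)));
      ([:: 1; 3; 2; 3]%N, ((2, 0), (-5, 1)));
      ([:: 1; 3; 3; 2]%N, ((-2, 0), (-7, 3)));
      ([:: 1; 3; 3; 3]%N, ((-7, 3), (-3, 1)));
      ([:: 2; 2; 2; 3]%N, ((3, -1), (18, -8)));
      ([:: 2; 2; 3; 3]%N, ((0, 0), (-16, 8)));
      ([:: 2; 3; 2; 3]%N, ((-4, 0), (-14, 6)));
      ([:: 2; 3; 3; 3]%N, ((3, -1), (18, -8)))].
End Tables.

Definition necklace_value (t : seq (seq nat * zr5)) (w : seq nat) : zr5 :=
  head (Z0, Z0) [seq e.2 | e <- t & has (fun k => rot k w == e.1) (iota 0 4)].

Definition signed_sum (f : nat -> zr5) (k : nat) : zr5 :=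
  if k is 0%N then zr5_opp (zr5_add (f 1%N) (zr5_add (f 2%N) (f 3%N))) else f k.

(** The values on all the words: the table gives those without the letter 0 up to rotation,
    and vanishing letter sums determine the others. *)
Definition expand (t : seq (seq nat * zr5)) : seq (seq (seq (seq zr5))) :=
  let four (T : Type) (f : nat -> T) := [seq f k | k <- iota 0 4] in
  four _ (fun a => four _ (fun b => four _ (fun c => four _ (fun d =>
    signed_sum (fun a => signed_sum (fun b => signed_sum (fun c => signed_sum (fun d =>
      necklace_value t [:: a; b; c; d]) d) c) b) a)))).

Definition ztableA := [seq (e.1, e.2.1) | e <- ztable].
Definition ztableB := [seq (e.1, e.2.2) | e <- ztable].

Definition arrayA := Eval vm_compute in expand ztableA.
Definition arrayB := Eval vm_compute in expand ztableB.

Definition entry (t : seq (seq (seq (seq zr5)))) (a b c d : nat) : zr5 :=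
  nth (Z0, Z0) (nth [::] (nth [::] (nth [::] t a) b) c) d.

Definition zr5_eqb (x y : zr5) : bool := Z.eqb x.1 y.1 && Z.eqb x.2 y.2.

Definition word_ok (s : seq (seq nat * zr5)) t (a b c d : nat) : bool :=
  if [&& eqn a b, eqn b c & eqn c d] then zr5_is0 (entry t a b c d) else
  has (fun e => zr5_eqb e.2 (entry t a b c d)
    && has (fun k => rot k [:: a; b; c; d] == e.1) (iota 0 4)) s.

(** What characterizes the expanded table: it agrees with the table on words without 0, it is
    invariant under rotation, and its sums over the first letter vanish. *)
Definition array_ok (s : seq (seq nat * zr5)) t : bool :=
  let l := iota 0 4 in let l' := iota 1 3 in
  [&& all (fun a => all (fun b => all (fun c => all (fun d => word_ok s t a b c d) l') l') l') l',
      all (fun a => all (fun b => all (fun c => all (fun d =>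
        zr5_eqb (entry t a b c d) (entry t b c d a)) l) l) l) l
    & all (fun b => all (fun c => all (fun d =>
        zr5_is0 (zr5_add (entry t 0 b c d) (zr5_add (entry t 1 b c d)
          (zr5_add (entry t 2 b c d) (entry t 3 b c d))))) l) l) l].

Lemma arrayA_ok : array_ok ztableA arrayA.
Proof. by vm_compute. Qed.

Lemma arrayB_ok : array_ok ztableB arrayB.
Proof. by vm_compute. Qed.

(** * The normal form of an uncappable rotation-invariant element *)

Lemma nbrs_sym x y : x \in codes -> y \in codes -> (y \in nbrs x) = (x \in nbrs y).
Proof. exact: walk_sym. Qed.

Lemma flat_codes x : x \in codes -> flat x \in codes.
Proof. by case/codesP=> [->|[j [k [-> j4 k3]]]] //=; case: ifP => // _; apply: mem_codes. Qed.

Lemma flat_nbrs x y : x \in codes -> even_code x = false ->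
  y \in nbrs x -> flat y \in nbrs x.
Proof.
case/codesP=> [->|[j [k [-> j4 k3]]]].
  by move=> _; rewrite /nbrs /arms_at_center => /mapP[i il ->]; apply/mapP; exists i.
case: k k3 => [|[|[|//]]] // _ _; rewrite /nbrs !in_cons in_nil orbF.
by case/orP=> /eqP->; rewrite eqxx.
Qed.

Lemma odd_not_leaf x : even_code x = false -> ~~ leaf x.
Proof. by case: x => [[j [|[|[|k]]]]|]. Qed.

Section Generators.
Context (R : realType) (dim : vertex -> R).
Hypothesis dim_gt0 : forall v, 0 < dim v.
Hypothesis dim_eigen : forall v, \sum_(w | adj v w) dim w = delta R * dim v.

Local Notation s5 := (@Num.sqrt R 5).
Local Notation sd x := (sdim dim (decode x)).
Local Notation leg j k := (dim (decode (Some (j, k)))).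

(** The dimension of a leaf, which fixes the scale of the eigenvector. *)
Definition unit_dim : R := dim center / (delta R * (1 + s5)).

Lemma s5_gt0 : 0 < s5. Proof. by rewrite sqrtr_gt0 ltr0n. Qed.

Lemma delta_gt0 : 0 < delta R.
Proof. by apply: lt_le_trans (delta_ge2 R); rewrite ltr0n. Qed.

Lemma delta_sqr : delta R * delta R = 3 + s5.
Proof. by rewrite -expr2 sqr_sqrtr // addr_ge0 ?ler0n // ltW // s5_gt0. Qed.

(** The eigenvector equation, solved from the leaf to the center. *)
Lemma dims j : (j < 4)%N ->
  [/\ leg j 0%N = (2 + s5) * unit_dim, leg j 1%N = delta R * unit_dim
    & leg j 2%N = unit_dim].
Proof.
move=> j4.
have e2 := dim_eigen (decode (Some (j, 2%N))).
have e1 := dim_eigen (decode (Some (j, 1%N))).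
have e0 := dim_eigen (decode (Some (j, 0%N))).
rewrite !sum_nbrs ?mem_codes // !big_cons !big_nil !addr0 in e0 e1 e2.
rewrite e2 mulrA delta_sqr in e1.
have {}e1 : leg j 0%N = (2 + s5) * leg j 2%N by rewrite -[LHS](addrK (leg j 2%N)) e1; ring.
rewrite e1 e2 in e0.
have e3 : dim center = delta R * (1 + s5) * leg j 2%N.
  by rewrite -[LHS](addrK (delta R * leg j 2%N)) [X in X - _]e0; ring.
have tE : leg j 2%N = unit_dim.
  rewrite /unit_dim e3; field.
  by rewrite (gt_eqF delta_gt0) gt_eqF // addr_gt0 // s5_gt0.
by rewrite e1 e2 tE.
Qed.

Lemma dim_center : dim center = delta R * (1 + s5) * unit_dim.
Proof.
rewrite /unit_dim; field.
by rewrite (gt_eqF delta_gt0) gt_eqF // addr_gt0 // s5_gt0.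
Qed.

Lemma unit_dim_gt0 : 0 < unit_dim.
Proof. by rewrite /unit_dim divr_gt0 // mulr_gt0 ?delta_gt0 // addr_gt0 // s5_gt0. Qed.

Lemma closed_walkE x0 o0 x1 o1 x2 o2 x3 o3 :
  closed_walk [:: x0; o0; x1; o1; x2; o2; x3; o3] ->
  [/\ [/\ x0 \in codes, o0 \in codes, x1 \in codes & o1 \in codes],
      [/\ x2 \in codes, o2 \in codes, x3 \in codes & o3 \in codes],
      [/\ o0 \in nbrs x0, x1 \in nbrs o0, o1 \in nbrs x1 & x2 \in nbrs o1] &
      [/\ o2 \in nbrs x2, x3 \in nbrs o2, o3 \in nbrs x3 & x0 \in nbrs o3]].
Proof.
rewrite /closed_walk /walk /= !andbT => /andP[].
by move=> /and5P[-> -> -> ->] /and4P[-> -> -> ->] /and5P[-> -> -> ->] /and4P[-> -> -> ->].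
Qed.

Section NormalForm.
Context (S : gpa R 4 true).
Hypothesis S_uncappable : uncappable dim S.
Hypothesis S_rho : rho dim S = S.

(** Invariance under rho, which is a rotation by two steps. *)
Lemma gauge_rot2 x0 o0 x1 o1 x2 o2 x3 o3 :
  closed_walk [:: x0; o0; x1; o1; x2; o2; x3; o3] -> even_code x0 ->
  gauge dim S [:: x1; o1; x2; o2; x3; o3; x0; o0]
  = gauge dim S [:: x0; o0; x1; o1; x2; o2; x3; o3].
Proof.
move=> gP ge; rewrite -[in RHS]S_rho /rho.
have [[x0c _ _ _] _ [a0 _ _ _] _] := closed_walkE gP.
apply/esym; apply: etrans (gauge_fourier dim_gt0 (fourier dim S) gP _) _.
  by rewrite /= ge.
have gP1 := closed_walk_rot 1 gP; apply: etrans (gauge_fourier dim_gt0 S gP1 _) _ => //.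
by rewrite /= (nbrs_even x0c a0) ge.
Qed.

(** The vertices next to x1 are odd, so they are not leaves; rotating afterwards brings the
    next even vertex to the same position. *)
Lemma flatten_even x0 o0 x1 o1 x2 o2 x3 o3 :
  closed_walk [:: x0; o0; x1; o1; x2; o2; x3; o3] -> even_code x0 ->
  gauge dim S [:: x0; o0; x1; o1; x2; o2; x3; o3]
  = eps R x1 * gauge dim S [:: flat x1; o1; x2; o2; x3; o3; x0; o0]
  /\ closed_walk [:: flat x1; o1; x2; o2; x3; o3; x0; o0].
Proof.
move=> gP xe; have [[x0c o0c x1c o1c] [x2c o2c x3c o3c] [a0 a1 a2 a3] [a4 a5 a6 a7]] := closed_walkE gP.
have oe0 : even_code o0 = false by rewrite (nbrs_even x0c a0) xe.
have xe1 : even_code x1 by rewrite (nbrs_even o0c a1) oe0.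
have oe1 : even_code o1 = false by rewrite (nbrs_even x1c a2) xe1.
have a1' : x1 \in nbrs o1 by rewrite -[_ \in _]/(walk _ _) walk_sym.
have [f1 f2] : flat x1 \in nbrs o0 /\ o1 \in nbrs (flat x1).
  by split; [|rewrite -[_ \in _]/(walk _ _) walk_sym ?flat_codes //]; apply: flat_nbrs.
have gP' : closed_walk [:: x0; o0; flat x1; o1; x2; o2; x3; o3].
  by rewrite /closed_walk /= /walk x0c o0c o1c x2c o2c x3c o3c a0 a3 a4 a5 a6 a7
    f1 f2 flat_codes.
split; last exact: (closed_walk_rot 2 gP').
rewrite (gauge_rot2 gP' xe).
pose h y := gauge dim S [:: x0; o0; y; o1; x2; o2; x3; o3].
apply: (@flatten_one R h o0 x1 o1) => //; rewrite ?odd_not_leaf // => o01.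
subst o1; rewrite /h.
apply: (@uncappable_sum R dim dim_gt0 true S [:: x0] o0 [:: x2] x0 x2 [:: o3; x3; o2]) => //=.
- by rewrite x0c o0c x2c.
- by rewrite o3c x3c o2c.
- by rewrite /walk a0 a3.
- by rewrite /walk (nbrs_sym x0c o3c) a7 (nbrs_sym o3c x3c) a6 (nbrs_sym x3c o2c) a5 (nbrs_sym o2c x2c) a4.
- by right; left.
Qed.

(** The neighbours of an odd vertex may be leaves, so the even vertices have to be flattened
    first. *)
Lemma flatten_odd x0 o0 x1 o1 x2 o2 x3 o3 :
  closed_walk [:: x0; o0; x1; o1; x2; o2; x3; o3] -> even_code x0 ->
  ~~ leaf x0 -> ~~ leaf x1 ->
  gauge dim S [:: x0; o0; x1; o1; x2; o2; x3; o3]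
  = eps R o0 * gauge dim S [:: x0; flat o0; x1; o1; x2; o2; x3; o3].
Proof.
move=> gP xe l0 l1; have [[x0c o0c x1c o1c] [x2c o2c x3c o3c] [a0 a1 a2 a3] [a4 a5 a6 a7]] := closed_walkE gP.
pose h y := gauge dim S [:: x0; y; x1; o1; x2; o2; x3; o3].
apply: (@flatten_one R h x0 o0 x1) => //; first by rewrite -nbrs_sym.
move=> x01; subst x1; rewrite /h.
apply: (@uncappable_sum R dim dim_gt0 true S [::] x0 [:: o1; x2] x0 x2 [:: o3; x3; o2]) => //=.
- by rewrite x0c o1c x2c.
- by rewrite o3c x3c o2c.
- by rewrite /walk a2 a3.
- by rewrite /walk (nbrs_sym x0c o3c) a7 (nbrs_sym o3c x3c) a6 (nbrs_sym x3c o2c) a5 (nbrs_sym o2c x2c) a4.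
- by left; split=> //; exists o1.
Qed.

Definition arm_of (x : code) : nat := if x is Some (j, _) then j else 0.

Lemma flat_even x : x \in codes -> even_code x -> flat x = Some (arm_of x, 0%N).
Proof. by case: x => [[j k]|] //= _ /negPf ->. Qed.

Lemma flat_odd x : x \in codes -> even_code x = false -> flat x = None.
Proof. by case: x => [[j k]|] //= _ /negbFE ->. Qed.

Lemma flatten_odd_rot a o0 b o1 x2 o2 x3 o3 :
  closed_walk [:: Some (a, 0%N); o0; Some (b, 0%N); o1; x2; o2; x3; o3] ->
  gauge dim S [:: Some (a, 0%N); o0; Some (b, 0%N); o1; x2; o2; x3; o3]
  = eps R o0 * gauge dim S [:: Some (b, 0%N); o1; x2; o2; x3; o3; Some (a, 0%N); None]
  /\ closed_walk [:: Some (b, 0%N); o1; x2; o2; x3; o3; Some (a, 0%N); None].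
Proof.
move=> gP; have [[x0c o0c x1c o1c] [x2c o2c x3c o3c] [a0 a1 a2 a3] [a4 a5 a6 a7]] := closed_walkE gP.
have oe0 : even_code o0 = false by rewrite (nbrs_even x0c a0).
have gP' : closed_walk [:: Some (a, 0%N); None; Some (b, 0%N); o1; x2; o2; x3; o3].
  rewrite /closed_walk /walk /= x0c x1c o1c x2c o2c x3c o3c a2 a3 a4 a5 a6 a7 /= andbT.
  case/codesP: x1c => [//|[j [k [[-> _] j4 _]]]].
  by apply/mapP; exists j; rewrite ?mem_iota.
split; last exact: (closed_walk_rot 2 gP').
by rewrite (gauge_rot2 gP') // (flatten_odd gP) // (flat_odd o0c oe0).
Qed.

(** The value on the loop ell(abcd), rescaled. *)
Definition spoke_gauge (a b c d : nat) : R[i] :=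
  gauge dim S [:: Some (a, 0%N); None; Some (b, 0%N); None; Some (c, 0%N); None; Some (d, 0%N); None].

(** First the four even vertices are moved to the spokes, then the four odd ones to the
    center, rotating by two steps after each move. *)
Lemma gauge_normal_form x0 o0 x1 o1 x2 o2 x3 o3 :
  closed_walk [:: x0; o0; x1; o1; x2; o2; x3; o3] -> even_code x0 ->
  gauge dim S [:: x0; o0; x1; o1; x2; o2; x3; o3]
  = eps R x0 * eps R o0 * eps R x1 * eps R o1 * eps R x2 * eps R o2 * eps R x3 * eps R o3
    * spoke_gauge (arm_of x0) (arm_of x1) (arm_of x2) (arm_of x3).
Proof.
move=> gP xe; have [[x0c o0c x1c o1c] [x2c o2c x3c o3c] [a0 a1 a2 a3] [a4 a5 a6 a7]] := closed_walkE gP.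
have oe0 : even_code o0 = false by rewrite (nbrs_even x0c a0) xe.
have xe1 : even_code x1 by rewrite (nbrs_even o0c a1) oe0.
have oe1 : even_code o1 = false by rewrite (nbrs_even x1c a2) xe1.
have xe2 : even_code x2 by rewrite (nbrs_even o1c a3) oe1.
have oe2 : even_code o2 = false by rewrite (nbrs_even x2c a4) xe2.
have xe3 : even_code x3 by rewrite (nbrs_even o2c a5) oe2.
have oe3 : even_code o3 = false by rewrite (nbrs_even x3c a6) xe3.
have fe x : x \in codes -> even_code x -> even_code (flat x) /\ ~~ leaf (flat x).
  by move=> xc ev; rewrite flat_even.
have [e1 P1] := flatten_even gP xe; rewrite e1.
have [g1 l1] := fe _ x1c xe1; have [e2 P2] := flatten_even P1 g1; rewrite e2.
have [g2 l2] := fe _ x2c xe2; have [e3 P3] := flatten_even P2 g2; rewrite e3.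
have [g3 l3] := fe _ x3c xe3; have [e4 P4] := flatten_even P3 g3; rewrite e4.
move: P4; rewrite !flat_even // => P4.
have [h1 Q1] := flatten_odd_rot P4; rewrite h1.
have [h2 Q2] := flatten_odd_rot Q1; rewrite h2.
have [h3 Q3] := flatten_odd_rot Q2; rewrite h3.
have [h4 Q4] := flatten_odd_rot Q3; rewrite h4 /spoke_gauge.
ring.
Qed.

Lemma spoke_gauge_rot a b c d : (a < 4)%N -> (b < 4)%N -> (c < 4)%N -> (d < 4)%N ->
  spoke_gauge b c d a = spoke_gauge a b c d.
Proof.
move=> a4 b4 c4 d4; apply: gauge_rot2 => //.
have sp j : (j < 4)%N -> Some (j, 0%N) \in arms_at_center.
  by move=> j4; apply/mapP; exists j; rewrite ?mem_iota.
by rewrite /closed_walk /walk /= !mem_codes // !sp.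
Qed.

(** Capping at the center: the four neighbours of the center are the four letters. *)
Lemma spoke_gauge_sum b c d : (b < 4)%N -> (c < 4)%N -> (d < 4)%N ->
  spoke_gauge 0 b c d + spoke_gauge 1 b c d + spoke_gauge 2 b c d
    + spoke_gauge 3 b c d = 0.
Proof.
move=> b4 c4 d4.
have sp j : (j < 4)%N -> Some (j, 0%N) \in arms_at_center.
  by move=> j4; apply/mapP; exists j; rewrite ?mem_iota.
have E := @uncappable_sum R dim dim_gt0 true S [:: Some (d, 0%N)] None [:: Some (b, 0%N)]
  (Some (d, 0%N)) (Some (b, 0%N)) [:: None; Some (c, 0%N); None] S_uncappable erefl.
have {}E : \sum_(w <- nbrs None) gauge dim S [:: Some (d, 0%N); None; w; None; Some (b, 0%N); None; Some (c, 0%N); None] = 0.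
  apply: E; rewrite /= ?mem_codes //.
  - by rewrite /walk /= sp.
  - by rewrite /walk /= !sp.
  - by right; left.
move: E; rewrite /nbrs /arms_at_center big_map unlock /= addr0 !addrA => E.
by rewrite (@spoke_gauge_rot d 0 b c) // (@spoke_gauge_rot d 1 b c) // (@spoke_gauge_rot d 2 b c) // (@spoke_gauge_rot d 3 b c).
Qed.

End NormalForm.
End Generators.

(** * The values of the generators *)

Lemma inord1 : inord 1 = 1 :> 'I_4.
Proof. by apply: val_inj; rewrite /= inordK. Qed.

Lemma inord2 : inord 2 = 2 :> 'I_4.
Proof. by apply: val_inj; rewrite /= inordK. Qed.

Lemma inord3 : inord 3 = 3 :> 'I_4.
Proof. by apply: val_inj; rewrite /= inordK. Qed.

Section TableValues.
Context (R : realType).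
Local Notation s5 := (@Num.sqrt R 5).

Definition zr5_real (x : zr5) : R := (int_of_Z x.1)%:~R + (int_of_Z x.2)%:~R * s5.

Lemma zr5_valE x : zr5_val R x = (zr5_real x)%:C.
Proof. by rewrite /zr5_val /zr5_real rmorphD rmorphM /= /Z_val !rmorph_int. Qed.

Lemma tableE : table R =
  [seq (map inord e.1, (zr5_real e.2.1 / 8, zr5_real e.2.2 / 8)) | e <- ztable].
Proof.
rewrite /table /ztable /=.
rewrite inord1 inord2 inord3.
rewrite /zr5_real.
do 21 (congr (_ :: _); first by (congr (_, (_, _)); rewrite /= /Pos.to_nat /=; lra)).
Qed.

Definition tabulated (t : seq (seq 'I_4 * R)) (s : seq (seq nat * zr5)) : Prop :=
  t = [seq (map inord e.1, zr5_real e.2 / 8) | e <- s].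

Lemma tableA_tabulated : tabulated (tableA R) ztableA.
Proof. by rewrite /tabulated /tableA tableE -!map_comp. Qed.

Lemma tableB_tabulated : tabulated (tableB R) ztableB.
Proof. by rewrite /tabulated /tableB tableE -!map_comp. Qed.

End TableValues.

Section SpokeValues.
Context (R : realType) (dim : vertex -> R).
Hypothesis dim_gt0 : forall v, 0 < dim v.
Hypothesis dim_eigen : forall v, \sum_(w | adj v w) dim w = delta R * dim v.
Local Notation s5 := (@Num.sqrt R 5).

(** The product of [sdim] over a loop ell(a), with the two extra factors of [gauge]. *)
Definition spoke_scale : R[i] :=
  (((2 + s5) * unit_dim dim) ^+ 3 * (delta R * (1 + s5) * unit_dim dim) ^+ 2)%:C.

Lemma spoke_gaugeE (S : gpa R 4 true) a b c d :
  (a < 4)%N -> (b < 4)%N -> (c < 4)%N -> (d < 4)%N ->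
  spoke_gauge dim S a b c d
    = spoke_scale * value S (ell [seq inord i | i <- [:: a; b; c; d]]).
Proof.
move=> a4 b4 c4 d4.
have -> : ell [seq inord i | i <- [:: a; b; c; d]]
   = [seq decode x | x <- [:: Some (a, 0%N); None; Some (b, 0%N); None;
                              Some (c, 0%N); None; Some (d, 0%N); None]].
  have i0 : inord 0 = 0 :> 'I_3 by apply: val_inj; rewrite /= inordK.
  by rewrite /= i0.
rewrite /spoke_gauge /gauge; congr (_ * _).
have su j : (j < 4)%N -> sdim dim (decode (Some (j, 0%N)))
     = (Num.sqrt ((2 + s5) * unit_dim dim))%:C.
  by move=> j4; rewrite /sdim; have [-> _ _] := dims dim_eigen j4.
rewrite !big_cons big_nil mulr1 /= !su // /spoke_scale -(dim_center dim).
set u := (2 + s5) * _.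
have u0 : 0 <= u by rewrite mulr_ge0 ?addr_ge0 ?ler0n ?sqrtr_ge0 // ltW // unit_dim_gt0.
have -> : u = Num.sqrt u * Num.sqrt u by rewrite -expr2 sqr_sqrtr.
have <- : Num.sqrt (dim center) * Num.sqrt (dim center) = dim center.
  by rewrite -expr2 sqr_sqrtr // ltW.
rewrite !(rmorphM, rmorphXn) /=.
have -> : Num.sqrt (Num.sqrt u * Num.sqrt u) = Num.sqrt u by rewrite -expr2 sqr_sqrtr.
rewrite /sdim; ring.
Qed.

Section Generator.
Context (kappa : R) (S : gpa R 4 true) (t : seq (seq 'I_4 * R)).
Context (s : seq (seq nat * zr5)) (arr : seq (seq (seq (seq zr5)))).
Hypothesis S_gen : is_generator dim kappa t S.
Hypothesis ts : tabulated t s.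
Hypothesis arr_ok : array_ok s arr.

(** Rotations and letter sums determine the values on all words from those on the words
    without 0, for S as for the expanded table; the proof removes the zeros one position after
    the other, rotating each position in turn to the front. *)
Lemma spoke_gauge_entry a b c d :
  (a < 4)%N -> (b < 4)%N -> (c < 4)%N -> (d < 4)%N ->
  spoke_gauge dim S a b c d = spoke_scale * (kappa%:C / 8) * zr5_val R (entry arr a b c d).
Proof.
move: a b c d; have [S_unc S_rho [S1 S2 S3] S_tab] := S_gen.
have /and3P[ok_base ok_rot ok_sum] := arr_ok.
pose f a b c d := spoke_scale * (kappa%:C / 8) * zr5_val R (entry arr a b c d).
pose P a b c d := spoke_gauge dim S a b c d = f a b c d.
have zr5_eqP x y : zr5_eqb x y -> x = y.
  by case: x y => [x1 x2] [y1 y2] /andP[/Z.eqb_spec /= -> /Z.eqb_spec /= ->].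
have in4 k : (k < 4)%N -> k \in iota 0 4 by rewrite mem_iota.
have f_rot a b c d : (a < 4)%N -> (b < 4)%N -> (c < 4)%N -> (d < 4)%N ->
    f a b c d = f b c d a.
  move=> a4 b4 c4 d4; congr (_ * zr5_val _ _); apply: zr5_eqP.
  by move: ok_rot => /allP/(_ _ (in4 a a4))/allP/(_ _ (in4 b b4))/allP/(_ _ (in4 c c4))/allP/(_ _ (in4 d d4)).
have P_rot a b c d : (a < 4)%N -> (b < 4)%N -> (c < 4)%N -> (d < 4)%N ->
    P b c d a -> P a b c d.
  by move=> a4 b4 c4 d4; rewrite /P (spoke_gauge_rot dim_gt0 S_rho a4) // (f_rot a).
have P_zero b c d : (b < 4)%N -> (c < 4)%N -> (d < 4)%N ->
    P 1%N b c d -> P 2%N b c d -> P 3%N b c d -> P 0%N b c d.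
  move=> b4 c4 d4; rewrite /P => p1 p2 p3.
  have := spoke_gauge_sum dim_gt0 S_unc S_rho b4 c4 d4.
  have : f 0%N b c d + f 1%N b c d + f 2%N b c d + f 3%N b c d = 0.
    rewrite /f -!mulrDr.
    move: ok_sum => /allP/(_ _ (in4 b b4))/allP/(_ _ (in4 c c4))/allP/(_ _ (in4 d d4)).
    by move/(zr5_val0 R); rewrite !zr5_valD !addrA => ->; rewrite mulr0.
  by rewrite p1 p2 p3 => <- /addIr/addIr/addIr.
have lt4 k : (0 < k < 4)%N -> (k < 4)%N by case/andP.
have P_base a b c d : (0 < a < 4)%N -> (0 < b < 4)%N -> (0 < c < 4)%N -> (0 < d < 4)%N ->
    P a b c d.
  move=> a4 b4 c4 d4.
  have in3 k : (0 < k < 4)%N -> k \in iota 1 3 by rewrite mem_iota.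
  move: ok_base => /allP/(_ _ (in3 a a4))/allP/(_ _ (in3 b b4))/allP/(_ _ (in3 c c4))/allP/(_ _ (in3 d d4)).
  rewrite /word_ok; case: and3P => [[/eqP ab /eqP bc /eqP cd]|_].
    subst d c b => e0; rewrite /P /f (zr5_val0 R e0) mulr0.
    have a4' := lt4 a a4; rewrite (spoke_gaugeE S a4' a4' a4' a4').
    case: a a4 {a4' b4 c4 d4 e0} => [//|[|[|[|//]]]] _; rewrite [map _ _]/=.
    - by rewrite inord1 S1 mulr0.
    - by rewrite inord2 S2 mulr0.
    - by rewrite inord3 S3 mulr0.
  case/hasP=> e es /andP[/zr5_eqP ee /hasP[k _ /eqP ke]].
  have := S_tab (map inord e.1, zr5_real R e.2 / 8).
  rewrite ts => /(_ (map_f _ es)) /=; rewrite -ke => vE.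
  have kE : spoke_gauge dim S a b c d = spoke_scale * (kappa * (zr5_real R e.2 / 8))%:C.
    have [[[a4' b4'] c4'] d4'] := (lt4 a a4, lt4 b b4, lt4 c c4, lt4 d d4).
    rewrite -vE; case: k {ke vE} => [|[|[|[|k]]]].
    - by rewrite rot0 (spoke_gaugeE S a4' b4' c4' d4').
    - rewrite -(spoke_gauge_rot dim_gt0 S_rho a4' b4' c4' d4').
      by rewrite (spoke_gaugeE S b4' c4' d4' a4').
    - rewrite -(spoke_gauge_rot dim_gt0 S_rho a4' b4' c4' d4').
      rewrite -(spoke_gauge_rot dim_gt0 S_rho b4' c4' d4' a4').
      by rewrite (spoke_gaugeE S c4' d4' a4' b4').
    - rewrite (spoke_gauge_rot dim_gt0 S_rho d4' a4' b4' c4').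
      by rewrite (spoke_gaugeE S d4' a4' b4' c4').
    - by rewrite rot_oversize // (spoke_gaugeE S a4' b4' c4' d4').
  rewrite /P /f kE -ee zr5_valE -mulrA; congr (_ * _).
  by rewrite !rmorphM fmorphV rmorph_nat mulrAC mulrA.
suff Pall a b c d : (a < 4)%N -> (b < 4)%N -> (c < 4)%N -> (d < 4)%N -> P a b c d.
  exact: Pall.
clearbody P; move: a b c d.
have P1 a b c d : (a < 4)%N -> (0 < b < 4)%N -> (0 < c < 4)%N -> (0 < d < 4)%N ->
    P a b c d.
  move=> a4 b4 c4 d4; have [[b4' c4'] d4'] := (lt4 b b4, lt4 c c4, lt4 d d4).
  by case: a a4 => [_|a a4]; [apply: P_zero => //|]; apply: P_base.
have P2 a b c d : (a < 4)%N -> (b < 4)%N -> (0 < c < 4)%N -> (0 < d < 4)%N ->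
    P a b c d.
  move=> a4 b4 c4 d4; have [c4' d4'] := (lt4 c c4, lt4 d d4).
  case: b b4 => [b4|b b4]; last exact: P1.
  apply: (P_rot) => //; apply: (P_zero) => //; do 3 (apply: (P_rot) => //); exact: P1.
have P3 a b c d : (a < 4)%N -> (b < 4)%N -> (c < 4)%N -> (0 < d < 4)%N -> P a b c d.
  move=> a4 b4 c4 d4; have d4' := lt4 d d4.
  case: c c4 => [c4|c c4]; last exact: P2.
  do 2 (apply: (P_rot) => //); apply: (P_zero) => //; do 2 (apply: (P_rot) => //); exact: P2.
move=> a b c d a4 b4 c4; case: d => [|d] d4; last exact: P3.
by do 3 (apply: (P_rot) => //); apply: (P_zero) => //; apply: (P_rot) => //; exact: P3.
Qed.

End Generator.
End SpokeValues.

(** * Linear combinations of words *)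

(** A complete tree of depth n with four branches at each node is a formal combination of
    the words of length n in the letters 0, 1, 2, 3. *)
Inductive word_tree : Type := Leaf of zr5 | Node of word_tree & word_tree & word_tree & word_tree.

Fixpoint null_tree (n : nat) : word_tree :=
  if n is m.+1 then let t := null_tree m in Node t t t t else Leaf (Z0, Z0).

Fixpoint has_depth (n : nat) (t : word_tree) : bool :=
  match n, t with
  | 0%N, Leaf _ => true
  | m.+1, Node t0 t1 t2 t3 =>
      [&& has_depth m t0, has_depth m t1, has_depth m t2 & has_depth m t3]
  | _, _ => false
  end.

Fixpoint sub_tree (t u : word_tree) : word_tree :=
  match t, u with
  | Leaf x, Leaf y => Leaf (zr5_add x (zr5_opp y))
  | Node t0 t1 t2 t3, Node u0 u1 u2 u3 =>
      Node (sub_tree t0 u0) (sub_tree t1 u1) (sub_tree t2 u2) (sub_tree t3 u3)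
  | _, _ => t
  end.

Fixpoint insert (c : zr5) (w : seq nat) (t : word_tree) : word_tree :=
  match w, t with
  | [::], Leaf x => Leaf (zr5_add c x)
  | k :: w', Node t0 t1 t2 t3 =>
      match k with
      | 0%N => Node (insert c w' t0) t1 t2 t3
      | 1%N => Node t0 (insert c w' t1) t2 t3
      | 2%N => Node t0 t1 (insert c w' t2) t3
      | _ => Node t0 t1 t2 (insert c w' t3)
      end
  | _, _ => t
  end.

(** Since the sum over the four letters vanishes at each position, branch 0 can be subtracted
    from the others and dropped.  What remains is a combination of words without 0, and each of
    them must have coefficient 0 or be a word that is known to vanish. *)
Fixpoint vanishing_modulo_sums (n : nat) (zero : pred (seq nat)) (t : word_tree) : bool :=
  match n, t with
  | 0%N, Leaf c => zr5_is0 c || zero [::]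
  | m.+1, Node t0 t1 t2 t3 =>
      [&& vanishing_modulo_sums m (fun w => zero (1%N :: w)) (sub_tree t1 t0),
          vanishing_modulo_sums m (fun w => zero (2%N :: w)) (sub_tree t2 t0)
        & vanishing_modulo_sums m (fun w => zero (3%N :: w)) (sub_tree t3 t0)]
  | _, _ => false
  end.

Definition is_word (n : nat) (w : seq nat) : bool :=
  (size w == n) && all (fun k => (k < 4)%N) w.

Definition swap03 (k : nat) : nat :=
  match k with 0%N => 3%N | 3%N => 0%N | _ => k end.

(** The elimination removes the letter 0, but a relation whose base vertex lies on arm 0 has
    to keep it, because its vanishing words involve the base letter; there 3 is removed instead. *)
Definition relabel (b : bool) (w : seq nat) : seq nat := if b then map swap03 w else w.

Definition collect (b : bool) (n : nat) (l : seq (zr5 * seq nat)) : word_tree :=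
  foldr (fun e t => insert e.1 (relabel b e.2) t) (null_tree n) l.

(** The words in corr are known to vanish and may be added freely.  This is needed for the
    vanishing words that consist of the eliminated letter, which after the elimination are
    spread over all the words. *)
Definition cancels (b : bool) (n : nat) (zero : pred (seq nat))
    (corr l : seq (zr5 * seq nat)) : bool :=
  [&& all (fun e => is_word n e.2) l,
      all (fun e => is_word n e.2 && zero e.2) corr
    & vanishing_modulo_sums n (fun w => zero (relabel b w)) (collect b n (corr ++ l))].

Section Soundness.
Context (R : realType).
Implicit Types Psi : seq nat -> R[i].

Definition lsum Psi (l : seq (zr5 * seq nat)) : R[i] :=
  \sum_(e <- l) zr5_val R e.1 * Psi e.2.

Fixpoint tree_val Psi (t : word_tree) : R[i] :=
  match t with
  | Leaf c => zr5_val R c * Psi [::]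
  | Node t0 t1 t2 t3 =>
      tree_val (fun w => Psi (0%N :: w)) t0 + tree_val (fun w => Psi (1%N :: w)) t1
      + tree_val (fun w => Psi (2%N :: w)) t2 + tree_val (fun w => Psi (3%N :: w)) t3
  end.

Lemma zr5_val_null : zr5_val R (Z0, Z0) = 0.
Proof. exact: zr5_val0. Qed.

Lemma null_tree_depth n : has_depth n (null_tree n).
Proof. by elim: n => //= n ->. Qed.

Lemma null_tree_val Psi n : tree_val Psi (null_tree n) = 0.
Proof.
elim: n Psi => [|n IH] Psi; last by rewrite /= !IH !addr0.
by rewrite -[LHS]/(zr5_val R (Z0, Z0) * Psi [::]) zr5_val_null mul0r.
Qed.

Lemma sub_tree_depth n t u : has_depth n t -> has_depth n u -> has_depth n (sub_tree t u).
Proof.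
elim: n t u => [|n IH] [x|t0 t1 t2 t3] [y|u0 u1 u2 u3] //=.
by move=> /and4P[? ? ? ?] /and4P[? ? ? ?]; rewrite !IH.
Qed.

Lemma sub_tree_val Psi n t u : has_depth n t -> has_depth n u ->
  tree_val Psi (sub_tree t u) = tree_val Psi t - tree_val Psi u.
Proof.
elim: n t u Psi => [|n IH] [x|t0 t1 t2 t3] [y|u0 u1 u2 u3] Psi //.
  by move=> _ _; rewrite [sub_tree _ _]/= /tree_val zr5_valD zr5_valN mulrBl.
move=> /and4P[? ? ? ?] /and4P[? ? ? ?] /=.
rewrite !IH // !opprD; move: (tree_val _ _) (tree_val _ _) (tree_val _ _).
move=> a0 b0 a1; move: (tree_val _ _) (tree_val _ _) (tree_val _ _) => b1 a2 b2.
move: (tree_val _ _) (tree_val _ _) => a3 b3; ring.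
Qed.

Lemma insert_depth n c w t : has_depth n t -> has_depth n (insert c w t).
Proof.
elim: n w t => [|n IH] [|k w] [x|t0 t1 t2 t3] //=.
by case: k => [|[|[|k]]] /and4P[? ? ? ?]; rewrite /= ?IH //; apply/and4P; split=> //; apply: IH.
Qed.

Lemma insert_val Psi n c w t : has_depth n t -> is_word n w ->
  tree_val Psi (insert c w t) = zr5_val R c * Psi w + tree_val Psi t.
Proof.
elim: n w t Psi => [|n IH] [|k w] [x|t0 t1 t2 t3] Psi //.
  by move=> _ _; rewrite [insert _ _ _]/= /tree_val zr5_valD mulrDl.
move=> /and4P[? ? ? ?]; rewrite /is_word /= eqSS => /and3P[zw k4 wl].
have ww : is_word n w by rewrite /is_word zw.
case: k k4 => [|[|[|[|//]]]] _ /=; rewrite IH //;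
  move: (tree_val _ t0) (tree_val _ t1) (tree_val _ t2) (tree_val _ t3);
  move: (zr5_val R c) (Psi _); move=> *; ring.
Qed.

Definition letter_sums_vanish n Psi : Prop :=
  forall w w', (size w + size w').+1 = n -> all (fun k => (k < 4)%N) (w ++ w') ->
  Psi (w ++ 0%N :: w') + Psi (w ++ 1%N :: w') + Psi (w ++ 2%N :: w')
    + Psi (w ++ 3%N :: w') = 0.

Lemma tree_val_sum Psi0 Psi1 Psi2 Psi3 n t : has_depth n t ->
  (forall w, is_word n w -> Psi0 w + Psi1 w + Psi2 w + Psi3 w = 0) ->
  tree_val Psi0 t + tree_val Psi1 t + tree_val Psi2 t + tree_val Psi3 t = 0.
Proof.
elim: n t Psi0 Psi1 Psi2 Psi3 => [|n IH] [x|t0 t1 t2 t3] Psi0 Psi1 Psi2 Psi3 //.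
  by move=> _ /(_ [::] isT) E; rewrite /= -!mulrDr E mulr0.
move=> /and4P[d0 d1 d2 d3] E /=.
have E' k t : (k < 4)%N -> has_depth n t ->
    tree_val (fun w => Psi0 (k :: w)) t + tree_val (fun w => Psi1 (k :: w)) t
    + tree_val (fun w => Psi2 (k :: w)) t + tree_val (fun w => Psi3 (k :: w)) t = 0.
  move=> k4 dt; apply: IH => // w /andP[zw wl]; apply: E.
  by rewrite /is_word /= eqSS zw k4.
have := E' 0%N t0 isT d0; have := E' 1%N t1 isT d1.
have := E' 2%N t2 isT d2; have := E' 3%N t3 isT d3.
do 16 (move: (tree_val _ _) => ?).
move=> e3 e2 e1 e0.
have := congr2 +%R (congr2 +%R e0 e1) (congr2 +%R e2 e3).
by rewrite !addr0 => <-; ring.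
Qed.

Lemma dead_val n (zero : pred (seq nat)) Psi t : has_depth n t -> letter_sums_vanish n Psi ->
  (forall w, is_word n w -> zero w -> Psi w = 0) ->
  vanishing_modulo_sums n zero t -> tree_val Psi t = 0.
Proof.
elim: n zero Psi t => [|n IH] zero Psi [x|t0 t1 t2 t3] //.
  move=> _ _ z /orP[/(zr5_val0 R) x0|/(z [::] isT) P0] /=.
    by rewrite [X in X * _]x0 mul0r.
  by rewrite P0 mulr0.
move=> /and4P[d0 d1 d2 d3] sums z /and3P[k1 k2 k3].
have step k t : (k < 4)%N -> has_depth n t -> vanishing_modulo_sums n (fun w => zero (k :: w)) (sub_tree t t0) ->
    tree_val (fun w => Psi (k :: w)) t = tree_val (fun w => Psi (k :: w)) t0.
  move=> k4 dt kt; apply/eqP; rewrite -subr_eq0 -(sub_tree_val _ dt d0); apply/eqP.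
  apply: IH kt; first exact: sub_tree_depth.
    by move=> w w' zw wl; apply: (sums (k :: w) w'); rewrite ?addSn ?zw //= k4.
  by move=> w /andP[zw wl]; apply: z; rewrite /is_word /= eqSS zw k4.
rewrite /= (step 1%N) // (step 2%N) // (step 3%N) //.
apply: (@tree_val_sum _ _ _ _ n) => // w /andP[/eqP zw wl].
by apply: (sums [::] w); rewrite //= add0n zw.
Qed.

Lemma collect_depth b n l : has_depth n (collect b n l).
Proof. by elim: l => [|e l IH]; [exact: null_tree_depth|exact: insert_depth]. Qed.

Lemma swap03K : involutive swap03.
Proof. by case=> [|[|[|[|]]]]. Qed.

Lemma swap03_lt4 k : (swap03 k < 4)%N = (k < 4)%N.
Proof. by case: k => [|[|[|[|]]]]. Qed.

Lemma relabelK b : involutive (relabel b).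
Proof. by move=> w; case: b => //=; rewrite mapK //; apply: swap03K. Qed.

Lemma is_word_relabel b n w : is_word n (relabel b w) = is_word n w.
Proof.
case: b => //=; rewrite /is_word size_map all_map; congr (_ && _).
by apply: eq_all => k /=; rewrite swap03_lt4.
Qed.

Lemma collect_val b n l Psi : all (fun e => is_word n e.2) l ->
  tree_val (fun w => Psi (relabel b w)) (collect b n l) = lsum Psi l.
Proof.
elim: l => [|e l IH] /=; first by rewrite null_tree_val /lsum big_nil.
case/andP=> ew lw; rewrite (insert_val _ _ (collect_depth b n l)) ?is_word_relabel //.
by rewrite relabelK IH // /lsum big_cons.
Qed.

Lemma lsum_cat Psi l l' : lsum Psi (l ++ l') = lsum Psi l + lsum Psi l'.
Proof. by rewrite /lsum big_cat. Qed.

(** Soundness of the test, for any function Psi of words that satisfies the relations. *)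
Lemma cancels_lsum b n (zero : pred (seq nat)) corr l Psi : letter_sums_vanish n Psi ->
  (forall w, is_word n w -> zero w -> Psi w = 0) ->
  cancels b n zero corr l -> lsum Psi l = 0.
Proof.
move=> sums z /and3P[lw cw dd].
have cl : lsum Psi corr = 0.
  rewrite /lsum big_seq big1 // => e ec.
  by have /andP[ew /(z _ ew) ->] := allP cw e ec; rewrite mulr0.
have -> : lsum Psi l = lsum Psi (corr ++ l) by rewrite lsum_cat cl add0r.
rewrite -(@collect_val b n); last first.
  rewrite all_cat lw andbT; apply: sub_all cw => e; by case/andP.
apply: dead_val dd; first exact: collect_depth.
- move=> w w' zw wl.
  have rl v : all (fun k => (k < 4)%N) (relabel b v) = all (fun k => (k < 4)%N) v.
    by case: (b) => //=; rewrite all_map; apply: eq_all => k /=; rewrite swap03_lt4.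
  have rc v v' : relabel b (v ++ v') = relabel b v ++ relabel b v'.
    by case: (b) => //=; rewrite map_cat.
  have sz v : size (relabel b v) = size v by case: (b) => //=; rewrite size_map.
  have := sums (relabel b w) (relabel b w'); rewrite !sz zw -rc rl => /(_ erefl wl).
  rewrite !rc; case: (b) => //= <-; ring.
- by move=> w ww; apply: z; rewrite is_word_relabel.
Qed.

End Soundness.

Local Arguments walk : simpl never.

(** * The Jones-Wenzl column on words *)

Definition good (q : seq code) : bool := all (mem codes) q && sorted walk q.

Lemma good_replace l x m m' y r : good (l ++ x :: m ++ y :: r) ->
  good (x :: rcons m' y) -> good (l ++ x :: m' ++ y :: r).
Proof.
rewrite /good !all_cat /= !all_cat /= !sorted_cat_cons !cat_path /=.
case/andP=> /and5P[lc xc _ yc rc] /and4P[lw _ _ rw].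
rewrite all_rcons rcons_path => /andP[/and3P[_ _ m'c] /andP[m'w yw]].
by rewrite lc xc yc rc lw rw m'c m'w yw.
Qed.

Lemma good_flat l x y r : good (l ++ [:: x, y, x & r]) -> good (l ++ x :: r).
Proof.
rewrite /good !all_cat !sorted_cat_cons /=.
case/andP=> /and5P[lc xc _ _ rc] /and4P[lw _ _ rw].
by rewrite lc xc rc lw rw.
Qed.

Lemma good_sub l q r : good (l ++ q ++ r) -> good q.
Proof.
rewrite /good !all_cat => /andP[/and3P[_ -> _]] /=.
by case/cat_sorted2 => _ /cat_sorted2[].
Qed.

Fixpoint four_in_a_row (s : seq nat) : bool :=
  if s is a :: s' then
    (if s' is [:: b, c, d & _] then [&& eqn a b, eqn a c & eqn a d] else false)
    || four_in_a_row s'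
  else false.

Definition spine_pre (x : code) : seq code :=
  match x with
  | None => [::]
  | Some (j, 0%N) => [:: x]
  | Some (j, 1%N) => [:: x; Some (j, 0%N)]
  | Some (j, _) => [:: x; Some (j, 1%N); Some (j, 0%N)]
  end.

Definition spokes (w : seq nat) : seq code :=
  flatten [seq [:: Some (k, 0%N); None] | k <- w].

(** The normal form of a walk of length 10 from x to x: straight to the center, then out and
    back along the spokes of w, and back to x. *)
Definition spine (x : code) (w : seq nat) : seq code :=
  spine_pre x ++ None :: spokes w ++ rev (spine_pre x).

(** The number of free spokes that make [spine x w] a walk of length 10. *)
Definition spine_length (x : code) : nat :=
  match x with None => 5 | Some (_, k) => if k is k'.+1 then 4 - k else 4 end.

(** From a base vertex with k > 0, the first and the last spoke visited are the base arm,
    and they belong to the way to and from the center. *)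
Definition inner_word (x : code) (w : seq nat) : seq nat :=
  match x with
  | Some (_, _.+1) => behead (belast 0%N (behead w))
  | _ => w
  end.

(** Four equal spokes in a row, where a base vertex that is a spoke counts at both ends.  On the outer
    vertices of an arm, where the way to the center is longer, fewer letters suffice. *)
Definition zero_word (x : code) (w : seq nat) : bool :=
  match x, w with
  | Some (j, 0%N), _ => four_in_a_row (j :: rcons w j)
  | None, _ => four_in_a_row w
  | Some (j, 1%N), [:: a; b; c] => (eqn a j && eqn b j) || (eqn b j && eqn c j)
  | Some (j, 2%N), [:: a; b] => eqn a j || eqn b j
  | _, _ => false
  end.

Section Column.
Context (R : realType) (dim : vertex -> R).
Hypothesis dim_gt0 : forall v, 0 < dim v.
Hypothesis dim_eigen : forall v, \sum_(w | adj v w) dim w = delta R * dim v.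
Context (g : seq vertex).

Local Notation sd x := (sdim dim (decode x)).

(** The column Phi with the rescaling for which cups sum with coefficient 1. *)
Definition column (q : seq code) : R[i] :=
  (\prod_(x <- q) sd x) * jw_column dim g [seq decode x | x <- q].

Lemma column_sum l x r : good (l ++ x :: r) -> (size l + size r = 8)%N ->
  \sum_(w <- nbrs x) column (l ++ [:: x, w, x & r]) = 0.
Proof.
case/andP=> qc qw zq.
have xc : x \in codes by move: qc; rewrite all_cat /= => /and3P[].
have := @jw_column_cup R dim dim_gt0 dim_eigen g [seq decode y | y <- l] (decode x)
  [seq decode y | y <- r].
rewrite -map_cons -map_cat sorted_decode // => /(_ qw); rewrite !size_map => /(_ zq).
rewrite sum_nbrs // => E.
pose C := (\prod_(y <- l ++ [:: x, x & r]) sd y) * sd x.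
transitivity (C * 0); last by rewrite mulr0.
rewrite -[in RHS]E mulr_sumr; apply: eq_big_seq => w wx.
rewrite -!map_cons -map_cat /column /C turnE // !big_cat /= !big_cons.
move: (sdim_neq0 dim_gt0 (decode x)).
move: (sdim dim (decode x)) (sdim dim (decode w)) (\prod_(j <- l) _).
move: (\prod_(j <- r) _) (jw_column _ _ _) => a b c d f a0.
by field.
Qed.

Lemma flatten_at l x y z r : good (l ++ [:: x, y, z & r]) -> (size l + size r = 8)%N ->
  ~~ leaf x -> ~~ leaf z ->
  column (l ++ [:: x, y, z & r]) = eps R y * column (l ++ [:: x, flat y, z & r]).
Proof.
move=> gq zq lx lz.
have : good [:: x; y; z] by apply: (@good_sub l _ r).
case/andP=> /= /and4P[xc yc zc _] /and3P[xy yz _].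
apply: (@flatten_one R (fun y => column (l ++ [:: x, y, z & r])) x y z) => //.
  by rewrite nbrs_sym.
by move=> xz; subst z; apply: column_sum zq; apply: good_flat gq.
Qed.

Lemma flatten_at_even l x y z r : good (l ++ [:: x, y, z & r]) ->
  (size l + size r = 8)%N -> even_code y ->
  column (l ++ [:: x, y, z & r]) = eps R y * column (l ++ [:: x, flat y, z & r])
  /\ good (l ++ [:: x, flat y, z & r]).
Proof.
move=> gq zq ye.
have : good [:: x; y; z] by apply: (@good_sub l _ r).
case/andP=> /= /and4P[xc yc zc _] /and3P[xy yz _].
have xo : even_code x = false by move: ye; rewrite (nbrs_even xc xy) => /negbTE.
have zo : even_code z = false by rewrite (nbrs_even yc yz) ye.
split; first by apply: flatten_at; rewrite ?odd_not_leaf.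
apply: (@good_replace l x [:: y] [:: flat y] z r) => //.
rewrite /good /= xc zc flat_codes //= /walk flat_nbrs // nbrs_sym ?flat_codes //.
by rewrite flat_nbrs // nbrs_sym.
Qed.

Lemma flatten_at_odd l a y b r : good (l ++ [:: Some (a, 0%N), y, Some (b, 0%N) & r]) ->
  (size l + size r = 8)%N ->
  column (l ++ [:: Some (a, 0%N), y, Some (b, 0%N) & r])
    = eps R y * column (l ++ [:: Some (a, 0%N), None, Some (b, 0%N) & r])
  /\ good (l ++ [:: Some (a, 0%N), None, Some (b, 0%N) & r]).
Proof.
move=> gq zq.
have : good [:: Some (a, 0%N); y; Some (b, 0%N)] by apply: (@good_sub l _ r).
case/andP=> /= /and4P[xc yc zc _] /and3P[xy yz _].
have yo : even_code y = false by rewrite (nbrs_even xc xy).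
split; first by rewrite flatten_at // (flat_odd yc yo).
apply: (@good_replace l (Some (a, 0%N)) [:: y] [:: None] (Some (b, 0%N)) r) => //.
rewrite /good /= xc zc /=.
case/codesP: zc => [//|[j [k [[-> _] j4 _]]]].
by rewrite /walk /=; apply/andP; split=> //; apply/mapP; exists j; rewrite ?mem_iota.
Qed.

Section Zeros.
Context (j : nat).
Hypothesis j4 : (j < 4)%N.
Local Notation u := (Some (j, 0%N) : code).
Local Notation m := (Some (j, 1%N) : code).
Local Notation e := (Some (j, 2%N) : code).

Lemma arm_good q : all (fun x => if x is Some (i, k) then (i == j) && (k < 3)%N else true) q ->
  all (mem codes) q.
Proof.
move=> /allP qP; apply/allP=> x /qP; case: x => [[i k]|] // /andP[/eqP -> k3].
exact: mem_codes.
Qed.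

Lemma walk_um : walk u m. Proof. by rewrite /walk /= !inE eqxx. Qed.
Lemma walk_mu : walk m u. Proof. by rewrite /walk /= !inE eqxx. Qed.
Lemma walk_me : walk m e. Proof. by rewrite /walk /= !inE eqxx orbT. Qed.
Lemma walk_em : walk e m. Proof. by rewrite /walk /= !inE eqxx. Qed.

Definition arm_walks := (walk_um, walk_mu, walk_me, walk_em).

(** A leaf e has a single neighbour, so the cup relation at e is a single term. *)
Lemma column_leaf l r : good (l ++ [:: e, m, e & r]) -> (size l + size r = 8)%N ->
  column (l ++ [:: e, m, e & r]) = 0.
Proof.
move=> gq zq; have := @column_sum l e r; rewrite big_seq1; apply=> //.
exact: good_flat gq.
Qed.

Lemma good_arm x q : all (fun y => if y is Some (i, k) then (i == j) && (k < 3)%N else true) (x :: q) ->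
  path walk x q -> good (x :: q).
Proof. by move=> /arm_good qc qw; rewrite /good qc. Qed.

Local Ltac sizes zq := by rewrite ?size_cat /= ?(addnS, addSn, addn0) zq.

(** Unflattening: exchanging u for e twice leads to the pattern of [column_leaf]. *)
Lemma column_mumum l r : good (l ++ [:: m, u, m, u, m & r]) -> (size l + size r = 6)%N ->
  column (l ++ [:: m, u, m, u, m & r]) = 0.
Proof.
move=> gq zq.
have g3 : good (l ++ [:: m, e, m, e, m & r]).
  apply: (@good_replace l m [:: u; m; u] [:: e; m; e] m r) => //.
  by apply: good_arm; rewrite /= ?arm_walks ?eqxx.
have z3 : column (l ++ [:: m, e, m, e, m & r]) = 0.
  by have := @column_leaf (l ++ [:: m]) (m :: r); rewrite -catA size_cat; apply=> //=; lia.
have zA : (size l + size [:: e, m & r] = 8)%N.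
  by rewrite /=; lia.
have [e1 g2] := @flatten_at_even l m e m [:: e, m & r] g3 zA isT.
have [e2 _] := @flatten_at_even (l ++ [:: m; u]) m e m r ltac:(by rewrite -catA) ltac:(sizes zq) isT.
move: e1 e2; rewrite z3 -!catA /= !mulN1r => /esym/eqP; rewrite oppr_eq0 => /eqP -> /esym/eqP.
by rewrite oppr_eq0 => /eqP.
Qed.

(** Unflattening the three visits of the center between four visits of u reduces to
    [column_mumum].  The lemmas that follow are the same argument near the base vertex, where part
    of the pattern is supplied by the way from or to x. *)
Lemma column_run l r : good (l ++ [:: u, None, u, None, u, None, u & r]) ->
  (size l + size r = 4)%N -> column (l ++ [:: u, None, u, None, u, None, u & r]) = 0.
Proof.
move=> gq zq.
have g3 : good (l ++ [:: u, m, u, m, u, m, u & r]).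
  apply: (@good_replace l u [:: None; u; None; u; None] [:: m; u; m; u; m] u r) => //.
  by apply: good_arm; rewrite /= ?arm_walks ?eqxx.
have z3 : column (l ++ [:: u, m, u, m, u, m, u & r]) = 0.
  by have := @column_mumum (l ++ [:: u]) (u :: r); rewrite -catA size_cat; apply=> //=; lia.
have [e1 g2] := @flatten_at_odd l j m j [:: m, u, m, u & r] g3 ltac:(sizes zq).
have [e2 g1] := @flatten_at_odd (l ++ [:: u; None]) j m j [:: m, u & r] ltac:(by rewrite -catA) ltac:(sizes zq).
have [e3 _] := @flatten_at_odd (l ++ [:: u; None; u; None]) j m j r ltac:(by move: g1; rewrite -!catA) ltac:(sizes zq).
move: e1 e2 e3; rewrite z3 -!catA /= !mulN1r => /esym/eqP; rewrite oppr_eq0 => /eqP -> /esym/eqP.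
by rewrite oppr_eq0 => /eqP -> /esym/eqP; rewrite oppr_eq0 => /eqP.
Qed.

Lemma column_run_middle l r : good (l ++ [:: m, u, None, u, None, u & r]) ->
  (size l + size r = 5)%N -> column (l ++ [:: m, u, None, u, None, u & r]) = 0.
Proof.
move=> gq zq.
have g3 : good (l ++ [:: m, u, m, u, m, u & r]).
  apply: (@good_replace l m [:: u; None; u; None] [:: u; m; u; m] u r) => //.
  by apply: good_arm; rewrite /= ?arm_walks ?eqxx.
have z3 : column (l ++ [:: m, u, m, u, m, u & r]) = 0.
  by apply: column_mumum => //=; lia.
have [e2 g1] := @flatten_at_odd (l ++ [:: m]) j m j [:: m, u & r] ltac:(by rewrite -catA) ltac:(sizes zq).
have [e3 _] := @flatten_at_odd (l ++ [:: m; u; None]) j m j r ltac:(by move: g1; rewrite -!catA) ltac:(sizes zq).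
move: e2 e3; rewrite -!catA /= z3 !mulN1r => /esym/eqP; rewrite oppr_eq0 => /eqP -> /esym/eqP.
by rewrite oppr_eq0 => /eqP.
Qed.

Lemma column_run_end l r : good (l ++ [:: e, m, u, None, u & r]) ->
  (size l + size r = 6)%N -> column (l ++ [:: e, m, u, None, u & r]) = 0.
Proof.
move=> gq zq.
have g3 : good (l ++ [:: e, m, e, m, u & r]).
  apply: (@good_replace l e [:: m; u; None] [:: m; e; m] u r) => //.
  by apply: good_arm; rewrite /= ?arm_walks ?eqxx.
have z3 : column (l ++ [:: e, m, e, m, u & r]) = 0.
  by apply: column_leaf => //=; lia.
have [e2 g1] := @flatten_at_even (l ++ [:: e]) m e m [:: u & r] ltac:(by rewrite -catA) ltac:(sizes zq) isT.
have [e3 _] := @flatten_at_odd (l ++ [:: e; m]) j m j r ltac:(by move: g1; rewrite -!catA) ltac:(sizes zq).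
move: e2 e3; rewrite -!catA /= z3 !mulN1r => /esym/eqP; rewrite oppr_eq0 => /eqP -> /esym/eqP.
by rewrite oppr_eq0 => /eqP.
Qed.

Lemma column_run_middle' l r : good (l ++ [:: u, None, u, None, u, m & r]) ->
  (size l + size r = 5)%N -> column (l ++ [:: u, None, u, None, u, m & r]) = 0.
Proof.
move=> gq zq.
have g3 : good (l ++ [:: u, m, u, m, u, m & r]).
  apply: (@good_replace l u [:: None; u; None; u] [:: m; u; m; u] m r) => //.
  by apply: good_arm; rewrite /= ?arm_walks ?eqxx.
have z3 : column (l ++ [:: u, m, u, m, u, m & r]) = 0.
  by have := @column_mumum (l ++ [:: u]) r; rewrite -catA size_cat; apply=> //=; lia.
have [e2 g1] := @flatten_at_odd l j m j [:: m, u, m & r] g3 ltac:(sizes zq).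
have [e3 _] := @flatten_at_odd (l ++ [:: u; None]) j m j (m :: r) ltac:(by move: g1; rewrite -!catA) ltac:(sizes zq).
move: e2 e3; rewrite -!catA /= z3 !mulN1r => /esym/eqP; rewrite oppr_eq0 => /eqP -> /esym/eqP.
by rewrite oppr_eq0 => /eqP.
Qed.

Lemma column_run_end' l r : good (l ++ [:: u, None, u, m, e & r]) ->
  (size l + size r = 6)%N -> column (l ++ [:: u, None, u, m, e & r]) = 0.
Proof.
move=> gq zq.
have g3 : good (l ++ [:: u, m, e, m, e & r]).
  apply: (@good_replace l u [:: None; u; m] [:: m; e; m] e r) => //.
  by apply: good_arm; rewrite /= ?arm_walks ?eqxx.
have z3 : column (l ++ [:: u, m, e, m, e & r]) = 0.
  by have := @column_leaf (l ++ [:: u; m]) r; rewrite -catA size_cat; apply=> //=; lia.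
have [e2 g1] := @flatten_at_even (l ++ [:: u]) m e m [:: e & r] ltac:(by rewrite -catA) ltac:(sizes zq) isT.
have [e3 _] := @flatten_at_odd l j m j [:: m, e & r] ltac:(by move: g1; rewrite -!catA) ltac:(sizes zq).
move: e2 e3; rewrite -!catA /= z3 !mulN1r => /esym/eqP; rewrite oppr_eq0 => /eqP -> /esym/eqP.
by rewrite oppr_eq0 => /eqP.
Qed.

End Zeros.
End Column.

Lemma walk_center k : (k < 4)%N -> walk None (Some (k, 0%N)).
Proof. by move=> k4; apply/mapP; exists k; rewrite ?mem_iota. Qed.

Lemma walk_to_center k : walk (Some (k, 0%N)) None.
Proof. by rewrite /walk /= !inE. Qed.

Lemma spokes_cat w w' : spokes (w ++ w') = spokes w ++ spokes w'.
Proof. by rewrite /spokes map_cat flatten_cat. Qed.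

Lemma size_spokes w : size (spokes w) = (size w).*2.
Proof. by elim: w => //= k w ->. Qed.

Lemma spokes_last w : exists2 m, None :: spokes w = rcons m None & size m = (size w).*2.
Proof.
elim/last_ind: w => [|w k [m mE zm]]; first by exists [::].
exists (rcons (None :: spokes w) (Some (k, 0%N))).
  by rewrite -cats1 spokes_cat -!cats1 /= -catA.
by rewrite !size_rcons /= size_spokes.
Qed.

Lemma spokes_codes w : all (fun k => (k < 4)%N) w -> all (mem codes) (spokes w).
Proof. by elim: w => //= k w IH /andP[k4 /IH ->]; rewrite mem_codes. Qed.

Lemma spokes_path w : all (fun k => (k < 4)%N) w ->
  path walk None (spokes w) /\ last None (spokes w) = None.
Proof.
elim: w => //= k w IH /andP[k4 /IH[-> ->]].
by rewrite walk_center // walk_to_center.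
Qed.

Lemma spine_good x w : x \in codes -> all (fun k => (k < 4)%N) w -> good (spine x w).
Proof.
move=> xc wl; have [pw lw] := spokes_path wl.
rewrite /good /spine all_cat /= all_cat all_rev spokes_codes //= sorted_cat_cons cat_path pw lw /=.
case/codesP: xc => [->//|[j [k [-> j4 k3]]]].
case: k k3 => [|[|[|//]]] _ /=; rewrite ?mem_codes //= ?walk_to_center ?walk_center //.
- by rewrite !arm_walks.
- by rewrite !arm_walks.
Qed.

Section Spine.
Context (R : realType) (dim : vertex -> R).
Hypothesis dim_gt0 : forall v, 0 < dim v.
Hypothesis dim_eigen : forall v, \sum_(w | adj v w) dim w = delta R * dim v.
Context (g : seq vertex).

Local Notation col := (column dim g).

(** The cup relation at the center. *)
Lemma spine_sums x : x \in codes ->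
  letter_sums_vanish (spine_length x) (fun w => col (spine x w)).
Proof.
move=> xc w w' zw wl.
have [m mE zm] := spokes_last w.
have E k : spine x (w ++ k :: w') = (spine_pre x ++ m)
    ++ [:: None, Some (k, 0%N), None & spokes w' ++ rev (spine_pre x)].
  rewrite /spine spokes_cat -cat_cons -cat_cons mE -!catA cat_rcons /=.
  by [].
have E0 : spine x (w ++ w') = (spine_pre x ++ m) ++ None :: spokes w' ++ rev (spine_pre x).
  by rewrite /spine spokes_cat -!cat_cons mE -!catA cat_rcons.
have := @column_sum R dim dim_gt0 dim_eigen g (spine_pre x ++ m) None (spokes w' ++ rev (spine_pre x)).
rewrite -E0 => /(_ (spine_good xc wl)).
rewrite !size_cat size_rev size_spokes zm => sum0.
rewrite !E -[RHS]sum0; last first.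
  case/codesP: xc zw => [->|[j [k [-> j4 k3]]]] /=; last case: k k3 => [|[|[|//]]] _ /=; lia.
by rewrite /nbrs /arms_at_center /= !big_cons big_nil addr0 !addrA.
Qed.

Lemma spine_zero x w : x \in codes -> is_word (spine_length x) w ->
  zero_word x w -> col (spine x w) = 0.
Proof.
move=> xc /andP[/eqP zw wl]; have := spine_good xc wl.
case/codesP: xc zw => [->|[j [k [-> j4 k3]]]].
  case: w wl => [|a [|b [|c [|d [|e []]]]]] // /and5P[a4 b4 c4 d4 _] _ gq.
  rewrite /zero_word /= !orbF => /orP[/and3P[/eqP e1 /eqP e2 /eqP e3]|/and3P[/eqP e1 /eqP e2 /eqP e3]].
    by subst b c d; apply: (@column_run R dim dim_gt0 dim_eigen g a a4 [:: None] [:: None; Some (e, 0%N); None]).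
  by subst c d e; apply: (@column_run R dim dim_gt0 dim_eigen g b b4 [:: None; Some (a, 0%N); None] [:: None]).
case: k k3 => [|[|[|//]]] _.
- case: w wl => [|a [|b [|c [|d []]]]] // /and5P[a4 b4 c4 d4 _] _ gq.
  rewrite /zero_word /= !orbF => /or3P[] /and3P[/eqP e1 /eqP e2 /eqP e3].
  + by subst a b c; apply: (@column_run R dim dim_gt0 dim_eigen g j j4 [::] [:: None; Some (d, 0%N); None; Some (j, 0%N)]).
  + by subst b c d; apply: (@column_run R dim dim_gt0 dim_eigen g a a4 [:: Some (j, 0%N); None] [:: None; Some (j, 0%N)]).
  + by subst c d j; apply: (@column_run R dim dim_gt0 dim_eigen g b b4 [:: Some (b, 0%N); None; Some (a, 0%N); None] [::]).
- case: w wl => [|a [|b [|c []]]] // /and4P[a4 b4 c4 _] _ gq.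
  rewrite /zero_word => /orP[] /andP[/eqP e1 /eqP e2].
  + by subst a b; apply: (@column_run_middle R dim dim_gt0 dim_eigen g j j4 [::] [:: None; Some (c, 0%N); None; Some (j, 0%N); Some (j, 1%N)]).
  + by subst b c; apply: (@column_run_middle' R dim dim_gt0 dim_eigen g j j4 [:: Some (j, 1%N); Some (j, 0%N); None; Some (a, 0%N); None] [::]).
- case: w wl => [|a [|b []]] // /and3P[a4 b4 _] _ gq.
  rewrite /zero_word => /orP[] /eqP e1; subst.
  + by apply: (@column_run_end R dim dim_gt0 dim_eigen g j j4 [::] [:: None; Some (b, 0%N); None; Some (j, 0%N); Some (j, 1%N); Some (j, 2%N)]).
  + by apply: (@column_run_end' R dim dim_gt0 dim_eigen g j j4 [:: Some (j, 2%N); Some (j, 1%N); Some (j, 0%N); None; Some (a, 0%N); None] [::]).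
Qed.

Local Notation ep := (eps R).

(** The even vertices are flattened first; then the odd ones have only spokes as neighbours,
    except p1 and p9 when x is a leaf, where they are forced and their signs cancel. *)
Lemma normal_even x p1 p2 p3 p4 p5 p6 p7 p8 p9 : even_code x ->
  good [:: x; p1; p2; p3; p4; p5; p6; p7; p8; p9; x] ->
  col [:: x; p1; p2; p3; p4; p5; p6; p7; p8; p9; x]
  = ep p1 * ep p2 * ep p3 * ep p4 * ep p5 * ep p6 * ep p7 * ep p8 * ep p9
    * col (spine x (inner_word x [:: arm_of p2; arm_of p4; arm_of p6; arm_of p8])).
Proof.
move=> xe gq.
have [/= xw qw] := andP gq.
move: xw qw => /and5P[xc c1 c2 c3] /and5P[c4 c5 c6 c7] /and4P[c8 c9 _ _].
move=> /and5P[w1 w2 w3 w4] /and5P[w5 w6 w7 w8] /andP[w9 w10].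
have n1 : even_code p1 = false by rewrite (nbrs_even xc w1) xe.
have n2 : even_code p2 by rewrite (nbrs_even c1 w2) n1.
have n3 : even_code p3 = false by rewrite (nbrs_even c2 w3) n2.
have n4 : even_code p4 by rewrite (nbrs_even c3 w4) n3.
have n5 : even_code p5 = false by rewrite (nbrs_even c4 w5) n4.
have n6 : even_code p6 by rewrite (nbrs_even c5 w6) n5.
have n7 : even_code p7 = false by rewrite (nbrs_even c6 w7) n6.
have n8 : even_code p8 by rewrite (nbrs_even c7 w8) n7.
have fl := @flatten_at_even R dim dim_gt0 dim_eigen g.
have fo := @flatten_at_odd R dim dim_gt0 dim_eigen g.
have [e2 g2] := fl [:: x] p1 p2 p3 [:: p4; p5; p6; p7; p8; p9; x] gq erefl n2.
rewrite flat_even //= in e2 g2.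
have [e4 g4] := fl [:: x; p1; Some (arm_of p2, 0%N)] p3 p4 p5 [:: p6; p7; p8; p9; x] g2 erefl n4.
rewrite flat_even //= in e4 g4.
have [e6 g6] := fl [:: x; p1; Some (arm_of p2, 0%N); p3; Some (arm_of p4, 0%N)] p5 p6 p7 [:: p8; p9; x] g4 erefl n6.
rewrite flat_even //= in e6 g6.
have [e8 g8] := fl [:: x; p1; Some (arm_of p2, 0%N); p3; Some (arm_of p4, 0%N); p5; Some (arm_of p6, 0%N)] p7 p8 p9 [:: x] g6 erefl n8.
rewrite flat_even //= in e8 g8.
rewrite e2 e4 e6 e8 => {e2 e4 e6 e8 g2 g4 g6}.
move: (ep p2) (ep p4) (ep p6) (ep p8) => E2 E4 E6 E8.
have a2 : p2 \in nbrs p1 by [].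
have a8 : p9 \in nbrs p8 by [].
clear fl; case/codesP: (xc) xe w1 w10 g8 => [-> //|[j [k [-> j4 k3]]]].
case: k k3 => [|[|[|//]]] _ // _ w1 w10 g8.
- move: (arm_of p2) (arm_of p4) (arm_of p6) (arm_of p8) g8 => a b d e g8.
  have [e1 {}g8] := fo [::] j p1 a [:: p3; Some (b, 0%N); p5; Some (d, 0%N); p7; Some (e, 0%N); p9; Some (j, 0%N)] g8 erefl.
  have [e3 {}g8] := fo [:: Some (j, 0%N); None] a p3 b [:: p5; Some (d, 0%N); p7; Some (e, 0%N); p9; Some (j, 0%N)] g8 erefl.
  have [e5 {}g8] := fo [:: Some (j, 0%N); None; Some (a, 0%N); None] b p5 d [:: p7; Some (e, 0%N); p9; Some (j, 0%N)] g8 erefl.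
  have [e7 {}g8] := fo [:: Some (j, 0%N); None; Some (a, 0%N); None; Some (b, 0%N); None] d p7 e [:: p9; Some (j, 0%N)] g8 erefl.
  have [e9 _] := fo [:: Some (j, 0%N); None; Some (a, 0%N); None; Some (b, 0%N); None; Some (d, 0%N); None] e p9 j [::] g8 erefl.
  rewrite /= in e1 e3 e5 e7 e9; rewrite e1 e3 e5 e7 e9 /inner_word /spine /=.
  by ring.
- have m1 : p1 = Some (j, 1%N) by move: w1; rewrite /walk /= !inE => /eqP.
  have m9 : p9 = Some (j, 1%N).
    by move: w10; rewrite andbT /walk nbrs_sym ?mem_codes // !inE => /eqP.
  have k1 : arm_of p2 = j.
    by move: a2; rewrite m1 /= !inE => /orP[] /eqP ->.
  have k2 : arm_of p8 = j.
    by move: a8; rewrite nbrs_sym // m9 /= !inE => /orP[] /eqP ->.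
  rewrite k1 k2 in g8 *; rewrite m1 m9 in g8 *.
  move: (arm_of p4) (arm_of p6) g8 => a b g8.
  have [e3 {}g8] := fo [:: Some (j, 2%N); Some (j, 1%N)] j p3 a [:: p5; Some (b, 0%N); p7; Some (j, 0%N); Some (j, 1%N); Some (j, 2%N)] g8 erefl.
  have [e5 {}g8] := fo [:: Some (j, 2%N); Some (j, 1%N); Some (j, 0%N); None] a p5 b [:: p7; Some (j, 0%N); Some (j, 1%N); Some (j, 2%N)] g8 erefl.
  have [e7 {}g8] := fo [:: Some (j, 2%N); Some (j, 1%N); Some (j, 0%N); None; Some (a, 0%N); None] b p7 j [:: Some (j, 1%N); Some (j, 2%N)] g8 erefl.
  rewrite /= in e3 e5 e7; rewrite e3 e5 e7 /inner_word /spine /=.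
  by ring.
Qed.

(** As in [normal_even], but the even positions are now the odd indices. *)
Lemma normal_odd x p1 p2 p3 p4 p5 p6 p7 p8 p9 : even_code x = false ->
  good [:: x; p1; p2; p3; p4; p5; p6; p7; p8; p9; x] ->
  col [:: x; p1; p2; p3; p4; p5; p6; p7; p8; p9; x]
  = ep p1 * ep p2 * ep p3 * ep p4 * ep p5 * ep p6 * ep p7 * ep p8 * ep p9
    * col (spine x (inner_word x [:: arm_of p1; arm_of p3; arm_of p5; arm_of p7; arm_of p9])).
Proof.
move=> xe gq.
have [/= xw qw] := andP gq.
move: xw qw => /and5P[xc c1 c2 c3] /and5P[c4 c5 c6 c7] /and4P[c8 c9 _ _].
move=> /and5P[w1 w2 w3 w4] /and5P[w5 w6 w7 w8] /andP[w9 w10].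
have n1 : even_code p1 by rewrite (nbrs_even xc w1) xe.
have n2 : even_code p2 = false by rewrite (nbrs_even c1 w2) n1.
have n3 : even_code p3 by rewrite (nbrs_even c2 w3) n2.
have n4 : even_code p4 = false by rewrite (nbrs_even c3 w4) n3.
have n5 : even_code p5 by rewrite (nbrs_even c4 w5) n4.
have n6 : even_code p6 = false by rewrite (nbrs_even c5 w6) n5.
have n7 : even_code p7 by rewrite (nbrs_even c6 w7) n6.
have n8 : even_code p8 = false by rewrite (nbrs_even c7 w8) n7.
have n9 : even_code p9 by rewrite (nbrs_even c8 w9) n8.
have fl := @flatten_at_even R dim dim_gt0 dim_eigen g.
have fo := @flatten_at_odd R dim dim_gt0 dim_eigen g.
have [e1 g1] := fl [::] x p1 p2 [:: p3; p4; p5; p6; p7; p8; p9; x] gq erefl n1.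
have [e3 g3] := fl [:: x; flat p1] p2 p3 p4 [:: p5; p6; p7; p8; p9; x] g1 erefl n3.
have [e5 g5] := fl [:: x; flat p1; p2; flat p3] p4 p5 p6 [:: p7; p8; p9; x] g3 erefl n5.
have [e7 g7] := fl [:: x; flat p1; p2; flat p3; p4; flat p5] p6 p7 p8 [:: p9; x] g5 erefl n7.
have [e9 g9] := fl [:: x; flat p1; p2; flat p3; p4; flat p5; p6; flat p7] p8 p9 x [::] g7 erefl n9.
rewrite !flat_even //= in e1 e3 e5 e7 e9 g9.
rewrite e1 e3 e5 e7 e9 => {e1 e3 e5 e7 e9 g1 g3 g5 g7 fl}.
have A1 : x = None \/ x = Some (arm_of x, 1%N) /\ arm_of p1 = arm_of x /\ arm_of p9 = arm_of x.
  have w10' : p9 \in nbrs x by rewrite andbT in w10; rewrite nbrs_sym.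
  case/codesP: (xc) xe w1 w10' => [->|[j [k [-> j4 k3]]]]; first by left.
  case: k k3 => [|[|[|//]]] _ // _; rewrite /walk /= !inE => z1 z9; right.
  by split=> //; case/orP: z1 => /eqP ->; case/orP: z9 => /eqP ->.
move: (arm_of p1) (arm_of p3) (arm_of p5) (arm_of p7) (arm_of p9) A1 g9 => a b d e f A1 g9.
have [e2 {}g9] := fo [:: x] a p2 b [:: p4; Some (d, 0%N); p6; Some (e, 0%N); p8; Some (f, 0%N); x] g9 erefl.
have [e4 {}g9] := fo [:: x; Some (a, 0%N); None] b p4 d [:: p6; Some (e, 0%N); p8; Some (f, 0%N); x] g9 erefl.
have [e6 {}g9] := fo [:: x; Some (a, 0%N); None; Some (b, 0%N); None] d p6 e [:: p8; Some (f, 0%N); x] g9 erefl.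
have [e8 _] := fo [:: x; Some (a, 0%N); None; Some (b, 0%N); None; Some (d, 0%N); None] e p8 f [:: x] g9 erefl.
rewrite /= in e2 e4 e6 e8; rewrite e2 e4 e6 e8.
have -> : spine x (inner_word x [:: a; b; d; e; f])
   = [:: x; Some (a, 0%N); None; Some (b, 0%N); None; Some (d, 0%N); None;
         Some (e, 0%N); None; Some (f, 0%N); x].
  by case: A1 => [->//|[-> [-> ->]]].
by ring.
Qed.

End Spine.

(** * The relations as combinations of words *)

Definition bind (S T : Type) (l : seq S) (f : S -> seq T) : seq T :=
  flatten [seq f x | x <- l].

Definition paths (x y : code) : seq (code * code * code * code) :=
  bind (nbrs x) (fun p1 => bind (nbrs p1) (fun p2 => bind (nbrs p2) (fun p3 =>
    [seq (p1, p2, p3, p4) | p4 <- nbrs p3 & adj_code p4 y]))).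

(** 1 / dim x, in a unit that depends only on the parity of x; see [inv_dim_recip]. *)
Definition recip_dim (x : code) : zr5 :=
  match x with
  | None => (Zneg 1, Zpos 1)
  | Some (_, 0%N) => (Zneg 2, Zpos 1)
  | Some (_, 1%N) => (Zpos 4, Z0)
  | _ => (Zpos 1, Z0)
  end.

(** eps x / (dim x)^2, in the square of the same unit. *)
Definition signed_recip_dim2 (x : code) : zr5 :=
  match x with
  | None => (Zpos 6, Zneg 2)
  | Some (_, 0%N) => (Zpos 9, Zneg 4)
  | Some (_, 1%N) => (Zneg 16, Z0)
  | _ => (Zneg 1, Z0)
  end.

(** The letters of a loop are the arms of its even vertices; for a loop with an odd base
    point the generator is a Fourier transform, that is, the loop is rotated by one step. *)
Definition entry_at arr (x p1 p2 p3 p4 p5 p6 p7 : code) : zr5 :=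
  if even_code x then entry arr (arm_of x) (arm_of p2) (arm_of p4) (arm_of p6)
  else entry arr (arm_of p1) (arm_of p3) (arm_of p5) (arm_of p7).

(** The word of the normal form of the walk (x, p1, .., p9, x). *)
Definition word_at (x p1 p2 p3 p4 p5 p6 p7 p8 p9 : code) : seq nat :=
  inner_word x (if even_code x then [:: arm_of p2; arm_of p4; arm_of p6; arm_of p8]
                else [:: arm_of p1; arm_of p3; arm_of p5; arm_of p7; arm_of p9]).

Definition recip_dim4 (p : code * code * code * code) : zr5 :=
  let: (p1, p2, p3, p4) := p in
  zr5_mul (zr5_mul (recip_dim p1) (recip_dim p2)) (zr5_mul (recip_dim p3) (recip_dim p4)).

(** The combination of words that f (S o T) contributes, summed over S and T with the
    coefficients M and a common factor c.  The sum is a product of two sums for fixed v1, v2, v3,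
    and the factors that depend on one of them only are computed once. *)
Definition circ_list (c : zr5) (x : code) (M : zr5 * zr5 * (zr5 * zr5)) arrA arrB : seq (zr5 * seq nat) :=
  bind (nbrs x) (fun v1 => bind (nbrs v1) (fun v2 => bind (nbrs v2) (fun v3 =>
    let W := zr5_mul c (zr5_mul (recip_dim v1) (zr5_mul (recip_dim v2) (signed_recip_dim2 v3))) in
    let L := [seq (let: (r1, r2, r3, r4) := r in let w := zr5_mul W (recip_dim4 r) in
        (r, zr5_mul w (entry_at arrA x v1 v2 v3 r4 r3 r2 r1),
            zr5_mul w (entry_at arrB x v1 v2 v3 r4 r3 r2 r1))) | r <- paths x v3] in
    let T := [seq (let: (t1, t2, t3, t4) := t in let w := recip_dim4 t in
        let tA := zr5_mul w (entry_at arrA x t1 t2 t3 t4 v3 v2 v1) in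
        let tB := zr5_mul w (entry_at arrB x t1 t2 t3 t4 v3 v2 v1) in
        (t, zr5_add (zr5_mul M.1.1 tA) (zr5_mul M.1.2 tB),
            zr5_add (zr5_mul M.2.1 tA) (zr5_mul M.2.2 tB))) | t <- paths x v3] in
    bind L (fun l => let: (r1, r2, r3, r4, lA, lB) := l in
      [seq (let: (t1, t2, t3, t4, tA, tB) := t in
         (zr5_add (zr5_mul lA tA) (zr5_mul lB tB),
          word_at x r1 r2 r3 r4 v3 t4 t3 t2 t1)) | t <- T])))).

Definition jelly_list (c : zr5) (x : code) arr : seq (zr5 * seq nat) :=
  bind (nbrs x) (fun u =>
  bind (nbrs u) (fun v1 => bind (nbrs v1) (fun v2 => bind (nbrs v2) (fun v3 =>
    let W := zr5_mul c (zr5_mul (signed_recip_dim2 u) (zr5_mul (recip_dim v1) (zr5_mul (recip_dim v2) (recip_dim v3)))) in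
    [seq (let: (r1, r2, r3, r4) := r in
       (zr5_mul (zr5_mul W (recip_dim4 r)) (entry_at arr u v1 v2 v3 r4 r3 r2 r1),
        word_at x u r1 r2 r3 r4 v3 v2 v1 u)) | r <- paths u v3])))).

Definition zr5_of (a b : Z) : zr5 := (a, b).
Section RowDef. Local Open Scope Z_scope.
(** Row i of 24 R, or of 24 times the second matrix divided by delta. *)
Definition row (i : bool) (x : code) : zr5 * zr5 * (zr5 * zr5) :=
  match even_code x, i with
  | true, false => (zr5_of (-24) 12, zr5_of (-6) (-6), (zr5_of (-6) (-6), zr5_of 2 (-2)))
  | true, true => (zr5_of 18 (-18), zr5_of 24 (-12), (zr5_of 24 (-12), zr5_of 6 6))
  | false, false => (zr5_of 18 (-12), zr5_of (-9) 3, (zr5_of (-9) 3, zr5_of 1 3))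
  | false, true => (zr5_of (-63) 27, zr5_of (-18) 12, (zr5_of (-18) 12, zr5_of 9 (-3)))
  end.
End RowDef.
(** The difference of the two sides of relation i, divided by the common factor.  The
    constants 1536 = 24 * 64 and 6144 = 24 * 256 and the factor 199 + 89 sqrt 5 compare the
    normalization of one generator with that of two, see [scale_even] and [scale_odd]. *)
Definition relation_list (i : bool) (x : code) : seq (zr5 * seq nat) :=
  jelly_list (if even_code x then (Zpos 1536, Z0) else (Zpos 6144, Z0)) x (if i then arrayB else arrayA)
  ++ circ_list (zr5_opp (zr5_mul (zr5_mul (recip_dim x) (recip_dim x)) (Zpos 199, Zpos 89))) x (row i x)
       arrayA arrayB.

Section Correction.
Local Open Scope Z_scope.
(** Multiples of vanishing words found by solving the linear system that [cancels] leaves: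
    the words have the eliminated letter in four consecutive places. *)
Definition correction (i : bool) (x : code) : seq (zr5 * seq nat) :=
  match x with
  | Some (0%N, 0%N) =>
      [:: (if i then zr5_of (-662962176) 296484864 else zr5_of 409731072 (-183238656),
           [:: 3; 3; 3; 3]%N)]
  | Some (1%N, 0%N) =>
      [:: (if i then zr5_of 1325924352 (-592969728) else zr5_of 0 0, [:: 0; 0; 0; 0]%N)]
  | Some (2%N, 0%N) =>
      [:: (if i then zr5_of (-662962176) 296484864 else zr5_of (-409731072) 183238656,
           [:: 0; 0; 0; 0]%N)]
  | Some (_, 0%N) =>
      [:: (if i then zr5_of (-662962176) 296484864 else zr5_of 409731072 (-183238656),
           [:: 0; 0; 0; 0]%N)]
  | Some _ => [::]
  | None =>
      let c (k : nat) := match k with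
        | 1%N => if i then zr5_of 331481088 (-148242432) else zr5_of (-289275904) 129368064
        | 2%N => if i then zr5_of (-867827712) 388104192 else zr5_of 42205184 (-18874368)
        | _ => if i then zr5_of 536346624 (-239861760) else zr5_of 247070720 (-110493696)
        end in
      [seq (c k, [:: 0; 0; 0; 0; k]%N) | k <- [:: 1; 2; 3]%N]
      ++ [seq (c k, [:: k; 0; 0; 0; 0]%N) | k <- [:: 1; 2; 3]%N]
  end.
End Correction.

Definition on_root_arm (x : code) : bool := if x is Some (0%N, _) then true else false.

Definition certified (i : bool) (x : code) : bool :=
  cancels (on_root_arm x) (spine_length x) (zero_word x) (correction i x) (relation_list i x).

(** The computational heart of the proof: 26 relations between words. *)
Lemma all_certified : all (fun x => certified false x && certified true x) codes.
Proof. by vm_compute. Qed.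

(** * Enumerating walks *)

Lemma lsum_bind (R : realType) Psi (T : Type) (l : seq T) f :
  @lsum R Psi (bind l f) = \sum_(x <- l) lsum Psi (f x).
Proof. by rewrite /lsum /bind big_flatten big_map. Qed.

Lemma sum_bind (V : nmodType) (S T : Type) (l : seq S) (f : S -> seq T) (F : T -> V) :
  \sum_(y <- bind l f) F y = \sum_(x <- l) \sum_(y <- f x) F y.
Proof. by rewrite /bind big_flatten big_map. Qed.

Lemma mem_bind (S T : eqType) (l : seq S) (f : S -> seq T) y :
  reflect (exists2 x, x \in l & y \in f x) (y \in bind l f).
Proof. exact: flatten_mapP. Qed.

Lemma pathsP x y p1 p2 p3 p4 : (p1, p2, p3, p4) \in paths x y ->
  [/\ p1 \in nbrs x, p2 \in nbrs p1, p3 \in nbrs p2, p4 \in nbrs p3 & y \in nbrs p4].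
Proof.
case/mem_bind=> q1 a1 /mem_bind[q2 a2] /mem_bind[q3 a3] /mapP[q4].
by rewrite mem_filter adj_codeE => /andP[a5 a4] [-> -> -> ->].
Qed.

Lemma sum_paths (V : nmodType) x y (F : vertex -> vertex -> vertex -> vertex -> V) :
  x \in codes -> y \in codes ->
  \sum_(p1 | adj (decode x) p1) \sum_(p2 | adj p1 p2) \sum_(p3 | adj p2 p3)
    \sum_(p4 | adj p3 p4 && adj p4 (decode y)) F p1 p2 p3 p4
  = \sum_(p <- paths x y)
      F (decode p.1.1.1) (decode p.1.1.2) (decode p.1.2) (decode p.2).
Proof.
move=> xc yc; rewrite /paths sum_nbrs // sum_bind; apply: eq_big_seq => p1 a1.
have c1 := nbrs_codes xc a1; rewrite sum_nbrs // sum_bind; apply: eq_big_seq => p2 a2.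
have c2 := nbrs_codes c1 a2; rewrite sum_nbrs // sum_bind; apply: eq_big_seq => p3 a3.
have c3 := nbrs_codes c2 a3; rewrite big_mkcondr sum_nbrs //.
rewrite big_map big_filter [RHS]big_mkcond.
apply: eq_big_seq => p4 a4; have c4 := nbrs_codes c3 a4.
by rewrite adj_decode // adj_codeE.
Qed.

(** The diagrams sum over the middle region first; in the lists the walk is enumerated in
    order. *)
Lemma sum_path_reorder (V : nmodType) v w (F : vertex -> vertex -> vertex -> vertex -> V) :
  \sum_(p4 | adj w p4) \sum_(p1 | adj v p1) \sum_(p2 | adj p1 p2)
    \sum_(p3 | adj p2 p3 && adj p3 p4) F p1 p2 p3 p4
  = \sum_(p1 | adj v p1) \sum_(p2 | adj p1 p2) \sum_(p3 | adj p2 p3)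
    \sum_(p4 | adj p3 p4 && adj p4 w) F p1 p2 p3 p4.
Proof.
rewrite exchange_big; apply: eq_bigr => p1 _.
rewrite exchange_big; apply: eq_bigr => p2 _.
rewrite (exchange_big_dep (adj p2)) /=; last by move=> ? ? _ /andP[].
apply: eq_bigr => p3 a3; apply: eq_bigl => p4.
by rewrite a3 /= andbC (adj_sym w).
Qed.

(** * The weights of the sums over walks *)

Section Weights.
Context (R : realType) (dim : vertex -> R).
Hypothesis dim_gt0 : forall v, 0 < dim v.
Hypothesis dim_eigen : forall v, \sum_(w | adj v w) dim w = delta R * dim v.

Local Notation sd x := (sdim dim (decode x)).
Local Notation zv := (zr5_val R).

Definition inv_dim (x : code) : R[i] := (sd x)^-1 * (sd x)^-1.

(** The inverse dimensions of the vertices of one parity lie in this unit times Z[sqrt 5]: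
    delta occurs in the dimensions of the odd vertices only. *)
Definition weight_unit (b : bool) : R[i] :=
  (if b then (unit_dim dim)^-1 else (4 * delta R * unit_dim dim)^-1)%:C.

Lemma inv_dim_recip x : x \in codes -> inv_dim x = zv (recip_dim x) * weight_unit (even_code x).
Proof.
have t0 := unit_dim_gt0 dim_gt0; have d0 := delta_gt0 R; have s0 := s5_gt0 R.
have ss : Num.sqrt (5 : R) * Num.sqrt 5 = 5 by rewrite -expr2 sqr_sqrtr.
have E : inv_dim x = ((dim (decode x))^-1)%:C.
  by rewrite /inv_dim -invfM sdim_sqr // fmorphV.
move=> xc; rewrite {}E zr5_valE /weight_unit -rmorphM; congr (_ %:C).
have inv1 : (1 + Num.sqrt 5)^-1 = (Num.sqrt 5 - 1) / 4 :> R.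
  apply: (@mulIf _ (1 + Num.sqrt (5 : R))); first by rewrite gt_eqF // addr_gt0.
  rewrite mulVf; last by rewrite gt_eqF // addr_gt0.
  by rewrite (_ : _ * _ = (Num.sqrt 5 * Num.sqrt 5 - 1) / 4); [rewrite ss; lra|ring].
have inv2 : (2 + Num.sqrt 5)^-1 = Num.sqrt 5 - 2 :> R.
  apply: (@mulIf _ (2 + Num.sqrt (5 : R))); first by rewrite gt_eqF // addr_gt0.
  rewrite mulVf; last by rewrite gt_eqF // addr_gt0.
  by rewrite (_ : _ * _ = (Num.sqrt 5 * Num.sqrt 5 - 4)); [rewrite ss; lra|ring].
case/codesP: xc => [->|[j [k [-> j4 k3]]]].
  rewrite [decode _]/= dim_center /zr5_real [recip_dim _]/=.
  move: inv1 t0 d0; move: (unit_dim dim) (delta R) (Num.sqrt 5) => t d s inv1 t0 d0.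
  rewrite !invfM inv1 /fst /snd (_ : int_of_Z (Zneg 1) = -1) // (_ : int_of_Z (Zpos 1) = 1) //.
  by rewrite /=; field; rewrite !gt_eqF.
have [e0 e1 e2] := dims dim_eigen j4.
case: k k3 => [|[|[|//]]] _; rewrite ?e0 ?e1 ?e2 /zr5_real [recip_dim _]/=;
  move: inv2 t0 d0; move: (unit_dim dim) (delta R) (Num.sqrt 5) => t d s inv2 t0 d0.
- rewrite invfM inv2 /fst /snd (_ : int_of_Z (Zneg 2) = -2) // (_ : int_of_Z (Zpos 1) = 1) //.
  by rewrite /=; field; rewrite gt_eqF.
- rewrite /fst /snd (_ : int_of_Z (Zpos 4) = 4) // (_ : int_of_Z Z0 = 0) //.
  by rewrite /=; field; rewrite !gt_eqF.
- rewrite /fst /snd (_ : int_of_Z (Zpos 1) = 1) // (_ : int_of_Z Z0 = 0) //.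
  by rewrite /=; field; rewrite gt_eqF.
Qed.

Lemma inv_dim_signed_recip x : x \in codes ->
  eps R x * (inv_dim x * inv_dim x)
  = zv (signed_recip_dim2 x) * (weight_unit (even_code x) * weight_unit (even_code x)).
Proof.
move=> xc; rewrite inv_dim_recip //.
have -> : zv (signed_recip_dim2 x) = eps R x * (zv (recip_dim x) * zv (recip_dim x)).
  rewrite -zr5_valM.
  case/codesP: xc => [->|[j [k [-> j4 k3]]]]; last case: k k3 => [|[|[|//]]] _.
  - by rewrite mul1r.
  - by rewrite mul1r.
  - by rewrite mulN1r -zr5_valN.
  - by rewrite mulN1r -zr5_valN.
by move: (zv _) (weight_unit _) (eps R x) => a b c; ring.
Qed.

End Weights.

Lemma sign_sqr_cancel (F : fieldType) (e a b : F) : e * e = 1 -> a = (e * e) * b -> a = b.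
Proof. by move=> -> ->; rewrite mul1r. Qed.

(** The three hypotheses express the values by their normal forms.  Each sign occurs an even
    number of times, except e3: the vertex v3 is on the boundary of S, of T and of f^(10).  The
    remaining powers of square roots of dimensions are even once x ^+ 3 is pulled out. *)
Lemma circ_algebra (F : fieldType) (x v1 v2 v3 r1 r2 r3 r4 t1 t2 t3 t4 : F)
    (ex e1 e2 e3 f1 f2 f3 f4 h1 h2 h3 h4 s t c K S T C : F) :
  [/\ x != 0, v1 != 0, v2 != 0 & v3 != 0] -> [/\ r1 != 0, r2 != 0, r3 != 0 & r4 != 0] ->
  [/\ t1 != 0, t2 != 0, t3 != 0 & t4 != 0] ->
  [/\ ex * ex = 1, e1 * e1 = 1, e2 * e2 = 1 & e3 * e3 = 1] ->
  [/\ f1 * f1 = 1, f2 * f2 = 1, f3 * f3 = 1 & f4 * f4 = 1] ->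
  [/\ h1 * h1 = 1, h2 * h2 = 1, h3 * h3 = 1 & h4 * h4 = 1] ->
  x * (v1 * (v2 * (v3 * (r4 * (r3 * (r2 * (r1 * 1))))))) * (x * r4) * s
    = ex * e1 * e2 * e3 * f4 * f3 * f2 * f1 * (K * S) ->
  x * (t1 * (t2 * (t3 * (t4 * (v3 * (v2 * (v1 * 1))))))) * (x * t4) * t
    = ex * h1 * h2 * h3 * h4 * e3 * e2 * e1 * (K * T) ->
  x * (r1 * (r2 * (r3 * (r4 * (v3 * (t4 * (t3 * (t2 * (t1 * (x * 1)))))))))) * c
    = f1 * f2 * f3 * f4 * e3 * h4 * h3 * h2 * h1 * C ->
  x ^+ 3 * (r4 * t4 / (x * v3) * s * t * c)
  = K * K * (x^-1 * x^-1 * (x^-1 * x^-1)) * (e3 * (v3^-1 * v3^-1 * (v3^-1 * v3^-1)))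
    * (v1^-1 * v1^-1 * (v2^-1 * v2^-1))
    * (r1^-1 * r1^-1 * (r2^-1 * r2^-1) * (r3^-1 * r3^-1 * (r4^-1 * r4^-1)))
    * (t1^-1 * t1^-1 * (t2^-1 * t2^-1) * (t3^-1 * t3^-1 * (t4^-1 * t4^-1)))
    * S * T * C.
Proof.
move=> [x0 v10 v20 v30] [r10 r20 r30 r40] [t10 t20 t30 t40].
move=> [exx e11 e22 e33] [f11 f22 f33 f44] [h11 h22 h33 h44] sE tE cE.
rewrite (canRL (mulKf _) sE) ?mulf_neq0 ?oner_neq0 // (canRL (mulKf _) tE) ?mulf_neq0 ?oner_neq0 //.
rewrite (canRL (mulKf _) cE) ?mulf_neq0 ?oner_neq0 //.
apply: (sign_sqr_cancel exx); apply: (sign_sqr_cancel e11); apply: (sign_sqr_cancel e22).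
apply: (sign_sqr_cancel e33); apply: (sign_sqr_cancel f11); apply: (sign_sqr_cancel f22).
apply: (sign_sqr_cancel f33); apply: (sign_sqr_cancel f44); apply: (sign_sqr_cancel h11).
apply: (sign_sqr_cancel h22); apply: (sign_sqr_cancel h33); apply: (sign_sqr_cancel h44).
clear sE tE cE exx e11 e22 e33 f11 f22 f33 f44 h11 h22 h33 h44.
by field; rewrite ?x0 ?v10 ?v20 ?v30 ?r10 ?r20 ?r30 ?r40 ?t10 ?t20 ?t30 ?t40.
Qed.

(** The vertex u is on the boundary of the box once and on that of f^(10) twice, so its
    sign remains. *)
Lemma jelly_algebra (F : fieldType) (x u v1 v2 v3 r1 r2 r3 r4 : F)
    (eu e1 e2 e3 f1 f2 f3 f4 s c K S C : F) :
  [/\ x != 0, u != 0, v1 != 0, v2 != 0 & v3 != 0] ->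
  [/\ r1 != 0, r2 != 0, r3 != 0 & r4 != 0] ->
  [/\ eu * eu = 1, e1 * e1 = 1, e2 * e2 = 1 & e3 * e3 = 1] ->
  [/\ f1 * f1 = 1, f2 * f2 = 1, f3 * f3 = 1 & f4 * f4 = 1] ->
  u * (v1 * (v2 * (v3 * (r4 * (r3 * (r2 * (r1 * 1))))))) * (u * r4) * s
    = eu * e1 * e2 * e3 * f4 * f3 * f2 * f1 * (K * S) ->
  x * (u * (r1 * (r2 * (r3 * (r4 * (v3 * (v2 * (v1 * (u * (x * 1)))))))))) * c
    = eu * f1 * f2 * f3 * f4 * e3 * e2 * e1 * eu * C ->
  x ^+ 3 * (r4 / x * s * c)
  = K * (eu * (u^-1 * u^-1 * (u^-1 * u^-1)))
    * (v1^-1 * v1^-1 * (v2^-1 * v2^-1) * (v3^-1 * v3^-1))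
    * (r1^-1 * r1^-1 * (r2^-1 * r2^-1) * (r3^-1 * r3^-1 * (r4^-1 * r4^-1)))
    * S * C.
Proof.
move=> [x0 u0 v10 v20 v30] [r10 r20 r30 r40].
move=> [euu e11 e22 e33] [f11 f22 f33 f44] sE cE.
rewrite (canRL (mulKf _) sE) ?mulf_neq0 ?oner_neq0 //.
rewrite (canRL (mulKf _) cE) ?mulf_neq0 ?oner_neq0 //.
apply: (sign_sqr_cancel euu); apply: (sign_sqr_cancel e11); apply: (sign_sqr_cancel e22).
apply: (sign_sqr_cancel e33); apply: (sign_sqr_cancel f11); apply: (sign_sqr_cancel f22).
apply: (sign_sqr_cancel f33); apply: (sign_sqr_cancel f44).
clear sE cE euu e11 e22 e33 f11 f22 f33 f44.
by field; rewrite ?x0 ?u0 ?v10 ?v20 ?v30 ?r10 ?r20 ?r30 ?r40.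
Qed.

Section Values.
Context (R : realType) (dim : vertex -> R).
Hypothesis dim_gt0 : forall v, 0 < dim v.
Hypothesis dim_eigen : forall v, \sum_(w | adj v w) dim w = delta R * dim v.

Local Notation sd x := (sdim dim (decode x)).
Local Notation zv := (zr5_val R).
Local Notation ep := (eps R).
Local Notation id x := (inv_dim dim x).

(** The generator or its dual generator, according to the shading. *)
Definition shaded (b : bool) (S : gpa R 4 true) : gpa R 4 b :=
  if b is true then S else fourier dim S.

(** Everything that the sums below use about a generator. *)
Definition spoke_values (S : gpa R 4 true) arr (K : R[i]) : Prop :=
  [/\ uncappable dim S, rho dim S = S
    & forall a b c d, (a < 4)%N -> (b < 4)%N -> (c < 4)%N -> (d < 4)%N ->
        spoke_gauge dim S a b c d = K * zv (entry arr a b c d)].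

Lemma arm_of_lt4 x : x \in codes -> (arm_of x < 4)%N.
Proof. by case/codesP=> [->|[j [k [-> j4 _]]]]. Qed.

Lemma gauge_entry S arr K x p1 p2 p3 p4 p5 p6 p7 : spoke_values S arr K ->
  closed_walk [:: x; p1; p2; p3; p4; p5; p6; p7] ->
  gauge dim (shaded (even_code x) S) [:: x; p1; p2; p3; p4; p5; p6; p7]
  = ep x * ep p1 * ep p2 * ep p3 * ep p4 * ep p5 * ep p6 * ep p7
    * (K * zv (entry_at arr x p1 p2 p3 p4 p5 p6 p7)).
Proof.
case=> unc srho tab cw.
have [[xc c1 c2 c3] [c4 c5 c6 c7] [a0 _ _ _] _] := closed_walkE cw.
rewrite /entry_at; case: (boolP (even_code x)) => [xe|/negbTE xo].
  rewrite [shaded _ _]/= (gauge_normal_form dim_gt0 unc srho cw xe).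
  by rewrite tab ?arm_of_lt4.
rewrite [shaded _ _]/=.
have cw1 := closed_walk_rot 1 cw.
rewrite (gauge_fourier dim_gt0 S cw); last by rewrite /= xo.
have e1 : even_code p1 by rewrite (nbrs_even xc a0) xo.
rewrite (gauge_normal_form dim_gt0 unc srho cw1 e1) tab ?arm_of_lt4 //.
move: (K * _) (ep x) (ep p1) (ep p2) (ep p3) (ep p4) (ep p5) (ep p6) (ep p7) => *; ring.
Qed.

Variable g : seq vertex.
Local Notation Psi x := (fun w => column dim g (spine x w)).

Lemma column_entry x p1 p2 p3 p4 p5 p6 p7 p8 p9 :
  good [:: x; p1; p2; p3; p4; p5; p6; p7; p8; p9; x] ->
  column dim g [:: x; p1; p2; p3; p4; p5; p6; p7; p8; p9; x]
  = ep p1 * ep p2 * ep p3 * ep p4 * ep p5 * ep p6 * ep p7 * ep p8 * ep p9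
    * Psi x (word_at x p1 p2 p3 p4 p5 p6 p7 p8 p9).
Proof.
move=> gq; rewrite /word_at; case: (boolP (even_code x)) => [xe|/negbTE xo].
  exact: normal_even.
exact: normal_odd.
Qed.

Lemma circ_leaf S T arrS arrT K x v1 v2 v3 r1 r2 r3 r4 t1 t2 t3 t4 :
  spoke_values S arrS K -> spoke_values T arrT K ->
  x \in codes -> v1 \in nbrs x -> v2 \in nbrs v1 -> v3 \in nbrs v2 ->
  (r1, r2, r3, r4) \in paths x v3 -> (t1, t2, t3, t4) \in paths x v3 ->
  sd x ^+ 3 * (sd r4 * sd t4 / (sd x * sd v3)
    * value (shaded (even_code x) S) [seq decode y | y <- [:: x; v1; v2; v3; r4; r3; r2; r1]]
    * value (shaded (even_code x) T) [seq decode y | y <- [:: x; t1; t2; t3; t4; v3; v2; v1]]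
    * jw_column dim g [seq decode y | y <- [:: x; r1; r2; r3; r4; v3; t4; t3; t2; t1; x]])
  = K * K * (id x * id x) * (ep v3 * (id v3 * id v3)) * (id v1 * id v2)
    * (id r1 * id r2 * (id r3 * id r4)) * (id t1 * id t2 * (id t3 * id t4))
    * zv (entry_at arrS x v1 v2 v3 r4 r3 r2 r1) * zv (entry_at arrT x t1 t2 t3 t4 v3 v2 v1)
    * Psi x (word_at x r1 r2 r3 r4 v3 t4 t3 t2 t1).
Proof.
move=> Sv Tv xc a1 a2 a3 /pathsP[b1 b2 b3 b4 b5] /pathsP[d1 d2 d3 d4 d5].
have cv1 := nbrs_codes xc a1; have cv2 := nbrs_codes cv1 a2; have cv3 := nbrs_codes cv2 a3.
have cr1 := nbrs_codes xc b1; have cr2 := nbrs_codes cr1 b2; have cr3 := nbrs_codes cr2 b3.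
have cr4 := nbrs_codes cr3 b4.
have ct1 := nbrs_codes xc d1; have ct2 := nbrs_codes ct1 d2; have ct3 := nbrs_codes ct2 d3.
have ct4 := nbrs_codes ct3 d4.
have SE := @gauge_entry S arrS K x v1 v2 v3 r4 r3 r2 r1 Sv.
have TE := @gauge_entry T arrT K x t1 t2 t3 t4 v3 v2 v1 Tv.
have CE := @column_entry x r1 r2 r3 r4 v3 t4 t3 t2 t1.
have sy u w : u \in codes -> w \in codes -> w \in nbrs u -> u \in nbrs w.
  by move=> uc wc; rewrite nbrs_sym.
have [a1' a2' a3'] := And3 (sy _ _ xc cv1 a1) (sy _ _ cv1 cv2 a2) (sy _ _ cv2 cv3 a3).
have [b1' b2' b3' b4' b5'] := And5 (sy _ _ xc cr1 b1) (sy _ _ cr1 cr2 b2)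
  (sy _ _ cr2 cr3 b3) (sy _ _ cr3 cr4 b4) (sy _ _ cr4 cv3 b5).
have [d4' d5'] := conj (sy _ _ ct3 ct4 d4) (sy _ _ ct4 cv3 d5).
have [d1' d2' d3'] := And3 (sy _ _ xc ct1 d1) (sy _ _ ct1 ct2 d2) (sy _ _ ct2 ct3 d3).
have {}SE := SE ltac:(by rewrite /closed_walk /walk /= xc cv1 cv2 cv3 cr1 cr2 cr3 cr4 a1 a2 a3 b1' b2' b3' b4' b5').
have {}TE := TE ltac:(by rewrite /closed_walk /walk /= xc cv1 cv2 cv3 ct1 ct2 ct3 ct4 d1 d2 d3 d4 d5 a1' a2' a3').
have {}CE := CE ltac:(by rewrite /good /walk /= xc cv3 ct1 ct2 ct3 ct4 cr1 cr2 cr3 cr4 b1 b2 b3 b4 b5 d1' d2' d3' d4' d5').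
have n y : sd y != 0 by apply: sdim_neq0.
rewrite /gauge in SE TE; rewrite [LHS]/column in CE.
rewrite !big_cons !big_nil in CE; rewrite !big_cons !big_nil in SE; rewrite !big_cons !big_nil in TE.
apply: (circ_algebra _ _ _ _ _ _ SE TE CE); split; by [exact: n|exact: eps_sqr].
Qed.

Lemma jelly_leaf S arr K x u v1 v2 v3 r1 r2 r3 r4 :
  spoke_values S arr K ->
  x \in codes -> u \in nbrs x -> v1 \in nbrs u -> v2 \in nbrs v1 -> v3 \in nbrs v2 ->
  (r1, r2, r3, r4) \in paths u v3 ->
  sd x ^+ 3 * (sd r4 / sd x
    * value (shaded (even_code u) S) [seq decode y | y <- [:: u; v1; v2; v3; r4; r3; r2; r1]]
    * jw_column dim g [seq decode y | y <- [:: x; u; r1; r2; r3; r4; v3; v2; v1; u; x]])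
  = K * (ep u * (id u * id u)) * (id v1 * id v2 * id v3)
    * (id r1 * id r2 * (id r3 * id r4))
    * zv (entry_at arr u v1 v2 v3 r4 r3 r2 r1)
    * Psi x (word_at x u r1 r2 r3 r4 v3 v2 v1 u).
Proof.
move=> Sv xc a0 a1 a2 a3 /pathsP[b1 b2 b3 b4 b5].
have cu := nbrs_codes xc a0.
have cv1 := nbrs_codes cu a1; have cv2 := nbrs_codes cv1 a2; have cv3 := nbrs_codes cv2 a3.
have cr1 := nbrs_codes cu b1; have cr2 := nbrs_codes cr1 b2; have cr3 := nbrs_codes cr2 b3.
have cr4 := nbrs_codes cr3 b4.
have SE := @gauge_entry S arr K u v1 v2 v3 r4 r3 r2 r1 Sv.
have CE := @column_entry x u r1 r2 r3 r4 v3 v2 v1 u.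
have sy y w : y \in codes -> w \in codes -> w \in nbrs y -> y \in nbrs w.
  by move=> yc wc; rewrite nbrs_sym.
have [a0' a1' a2' a3'] := And4 (sy _ _ xc cu a0) (sy _ _ cu cv1 a1) (sy _ _ cv1 cv2 a2) (sy _ _ cv2 cv3 a3).
have [b1' b2' b3' b4' b5'] := And5 (sy _ _ cu cr1 b1) (sy _ _ cr1 cr2 b2)
  (sy _ _ cr2 cr3 b3) (sy _ _ cr3 cr4 b4) (sy _ _ cr4 cv3 b5).
have {}SE := SE ltac:(by rewrite /closed_walk /walk /= cu cv1 cv2 cv3 cr1 cr2 cr3 cr4 a1 a2 a3 b1' b2' b3' b4' b5').
have {}CE := CE ltac:(by rewrite /good /walk /= xc cu cv1 cv2 cv3 cr1 cr2 cr3 cr4 b1 b2 b3 b4 b5 a0 a0' a1' a2' a3').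
have n y : sd y != 0 by apply: sdim_neq0.
rewrite /gauge in SE; rewrite [LHS]/column in CE.
rewrite !big_cons !big_nil in CE; rewrite !big_cons !big_nil in SE.
apply: (jelly_algebra _ _ _ _ SE CE); split; by [exact: n|exact: eps_sqr].
Qed.

Lemma paths_even x y p1 p2 p3 p4 : x \in codes -> (p1, p2, p3, p4) \in paths x y ->
  [/\ p1 \in codes, p2 \in codes, p3 \in codes & p4 \in codes] /\
  [/\ even_code p1 = ~~ even_code x, even_code p2 = even_code x,
      even_code p3 = ~~ even_code x & even_code p4 = even_code x].
Proof.
move=> xc /pathsP[a1 a2 a3 a4 _].
have c1 := nbrs_codes xc a1; have c2 := nbrs_codes c1 a2; have c3 := nbrs_codes c2 a3.
have c4 := nbrs_codes c3 a4.
have e1 := nbrs_even xc a1; have e2 := nbrs_even c1 a2; have e3 := nbrs_even c2 a3.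
have e4 := nbrs_even c3 a4; split=> //.
by rewrite e4 e3 e2 e1 !negbK.
Qed.

Lemma inv_dim_path x y p1 p2 p3 p4 : x \in codes -> (p1, p2, p3, p4) \in paths x y ->
  id p1 * id p2 * (id p3 * id p4)
  = zv (recip_dim4 (p1, p2, p3, p4))
    * (weight_unit dim (even_code x) * weight_unit dim (~~ even_code x)) ^+ 2.
Proof.
move=> xc pP; have [[c1 c2 c3 c4] [e1 e2 e3 e4]] := paths_even xc pP.
have E := inv_dim_recip dim_gt0 dim_eigen.
rewrite !E // e1 e2 e3 e4 /recip_dim4 !zr5_valM.
move: (zv _) (zv _) (zv _) (zv _) (weight_unit _ _) (weight_unit _ _) => *; ring.
Qed.

Local Notation p1 p := (p.1.1.1).
Local Notation p2 p := (p.1.1.2).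
Local Notation p3 p := (p.1.2).
Local Notation p4 p := (p.2).

Definition circ_sum x arrS arrT : R[i] :=
  \sum_(v1 <- nbrs x) \sum_(v2 <- nbrs v1) \sum_(v3 <- nbrs v2)
  \sum_(r <- paths x v3) \sum_(t <- paths x v3)
    zv (recip_dim v1) * (zv (recip_dim v2) * zv (signed_recip_dim2 v3)) * zv (recip_dim4 r) * zv (recip_dim4 t)
    * zv (entry_at arrS x v1 v2 v3 (p4 r) (p3 r) (p2 r) (p1 r))
    * zv (entry_at arrT x (p1 t) (p2 t) (p3 t) (p4 t) v3 v2 v1)
    * Psi x (word_at x (p1 r) (p2 r) (p3 r) (p4 r) v3 (p4 t) (p3 t) (p2 t) (p1 t)).

Definition jelly_sum x arr : R[i] :=
  \sum_(u <- nbrs x) \sum_(v1 <- nbrs u) \sum_(v2 <- nbrs v1) \sum_(v3 <- nbrs v2)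
  \sum_(r <- paths u v3)
    zv (signed_recip_dim2 u) * (zv (recip_dim v1) * (zv (recip_dim v2) * zv (recip_dim v3))) * zv (recip_dim4 r)
    * zv (entry_at arr u v1 v2 v3 (p4 r) (p3 r) (p2 r) (p1 r))
    * Psi x (word_at x u (p1 r) (p2 r) (p3 r) (p4 r) v3 v2 v1 u).

End Values.

Section Sums.
Context (R : realType) (dim : vertex -> R).
Hypothesis dim_gt0 : forall v, 0 < dim v.
Hypothesis dim_eigen : forall v, \sum_(w | adj v w) dim w = delta R * dim v.

Local Notation sd x := (sdim dim (decode x)).
Local Notation zv := (zr5_val R).
Local Notation wu b := (weight_unit dim b).

(** Counted with multiplicity, seven inverse dimensions of each parity occur: those of v3 and
    of the base vertex twice, the others once. *)
Lemma f_circ_value b (g : loop 5 b) S T arrS arrT K x :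
  spoke_values dim S arrS K -> spoke_values dim T arrT K ->
  x \in codes -> head root_vertex g = decode x ->
  sd x ^+ 3 * f_circ dim (shaded dim b S) (shaded dim b T) g
  = K * K * (zv (recip_dim x) * zv (recip_dim x)) * (wu b * wu (~~ b)) ^+ 7
    * circ_sum dim g x arrS arrT.
Proof.
move=> Sv Tv xc gx.
have eb : even_code x = b.
  by apply/eqP; rewrite -even_vertex_decode // -gx; case/and3P: (valP g).
have -> := f_circ_sum dim_gt0 (shaded dim b S) (shaded dim b T) g; rewrite gx /circ_sum.
subst b; rewrite sum_nbrs // !mulr_sumr; apply: eq_big_seq => v1 a1.
have c1 := nbrs_codes xc a1; have e1 := nbrs_even xc a1.
rewrite sum_nbrs // !mulr_sumr; apply: eq_big_seq => v2 a2.
have c2 := nbrs_codes c1 a2; have e2 := nbrs_even c1 a2.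
rewrite sum_nbrs // !mulr_sumr; apply: eq_big_seq => v3 a3.
have c3 := nbrs_codes c2 a3; have e3 := nbrs_even c2 a3.
rewrite sum_path_reorder sum_paths // !mulr_sumr.
apply: eq_big_seq => -[[[r1 r2] r3] r4] rP.
rewrite sum_paths // !mulr_sumr.
apply: eq_big_seq => -[[[t1 t2] t3] t4] tP.
have := circ_leaf dim_gt0 dim_eigen g Sv Tv xc a1 a2 a3 rP tP.
rewrite ![map _ _]/= => ->.
rewrite (inv_dim_path dim_gt0 dim_eigen xc rP) (inv_dim_path dim_gt0 dim_eigen xc tP).
rewrite (inv_dim_signed_recip dim_gt0 dim_eigen c3) !(inv_dim_recip dim_gt0 dim_eigen) //.
rewrite e3 e2 e1 !negbK; cbn [fst snd].
move: (zv (recip_dim x)) (zv (recip_dim v1)) (zv (recip_dim v2)) (zv (signed_recip_dim2 v3)) (zv (recip_dim4 _)) (zv (recip_dim4 _)) => a0 b1 b2 b3 b4 b5.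
move: (zv _) (zv _) (wu _) (wu _) (column _ _ _) => *; ring.
Qed.

(** Here u has the parity b of the box and counts twice. *)
Lemma f_jelly_value b (g : loop 5 (~~ b)) S arr K x :
  spoke_values dim S arr K -> x \in codes -> head root_vertex g = decode x ->
  sd x ^+ 3 * f_jelly dim (shaded dim b S) g
  = K * (wu b ^+ 5 * wu (~~ b) ^+ 4) * jelly_sum dim g x arr.
Proof.
move=> Sv xc gx.
have eb : even_code x = ~~ b.
  by apply/eqP; rewrite -even_vertex_decode // -gx; case/and3P: (valP g).
have {}eb : ~~ even_code x = b by rewrite eb negbK.
have -> := f_jelly_sum dim_gt0 (shaded dim b S) g; rewrite gx /jelly_sum.
subst b; rewrite sum_nbrs // !mulr_sumr; apply: eq_big_seq => u a0.
have c0 := nbrs_codes xc a0; have e0 := nbrs_even xc a0.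
rewrite sum_nbrs // !mulr_sumr; apply: eq_big_seq => v1 a1.
have c1 := nbrs_codes c0 a1; have e1 := nbrs_even c0 a1.
rewrite sum_nbrs // !mulr_sumr; apply: eq_big_seq => v2 a2.
have c2 := nbrs_codes c1 a2; have e2 := nbrs_even c1 a2.
rewrite sum_nbrs // !mulr_sumr; apply: eq_big_seq => v3 a3.
have c3 := nbrs_codes c2 a3; have e3 := nbrs_even c2 a3.
rewrite sum_path_reorder sum_paths // !mulr_sumr.
apply: eq_big_seq => -[[[r1 r2] r3] r4] rP.
have := jelly_leaf dim_gt0 dim_eigen g Sv xc a0 a1 a2 a3 rP.
rewrite ![map _ _]/= e0 => ->.
rewrite (inv_dim_path dim_gt0 dim_eigen c0 rP).
rewrite (inv_dim_signed_recip dim_gt0 dim_eigen c0) !(inv_dim_recip dim_gt0 dim_eigen) //.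
cbn [fst snd]; move: (column _ _ _) => col; rewrite e3 e2 e1 e0 !negbK.
move: (zv (recip_dim v1)) (zv (recip_dim v2)) (zv (recip_dim v3)) (zv (signed_recip_dim2 u)) (zv (recip_dim4 _)) => b1 b2 b3 b4 b5.
move: (zv _) (wu _) (wu _) => *; ring.
Qed.

Variable g : seq vertex.
Local Notation Psi x := (fun w => column dim g (spine x w)).

Lemma lsum_jelly_list c x arr :
  lsum (Psi x) (jelly_list c x arr) = zv c * jelly_sum dim g x arr.
Proof.
rewrite /jelly_list /jelly_sum !lsum_bind mulr_sumr; apply: eq_bigr => u _.
rewrite !lsum_bind mulr_sumr; apply: eq_bigr => v1 _.
rewrite !lsum_bind mulr_sumr; apply: eq_bigr => v2 _.
rewrite !lsum_bind mulr_sumr; apply: eq_bigr => v3 _.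
rewrite /lsum big_map mulr_sumr; apply: eq_bigr => -[[[r1 r2] r3] r4] _ /=.
rewrite !zr5_valM; move: (zv _) (zv _) (zv _) (zv _) (zv _) (zv _) (zv _).
move: (column _ _ _) => *; ring.
Qed.

Lemma lsum_circ_list c x M arrA arrB :
  lsum (Psi x) (circ_list c x M arrA arrB)
  = zv c * (zv M.1.1 * circ_sum dim g x arrA arrA + zv M.1.2 * circ_sum dim g x arrA arrB
            + zv M.2.1 * circ_sum dim g x arrB arrA + zv M.2.2 * circ_sum dim g x arrB arrB).
Proof.
rewrite /circ_list /circ_sum !lsum_bind !mulr_sumr -!big_split mulr_sumr.
apply: eq_bigr => v1 _; rewrite /= !lsum_bind !mulr_sumr -!big_split mulr_sumr.
apply: eq_bigr => v2 _; rewrite /= !lsum_bind !mulr_sumr -!big_split mulr_sumr.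
apply: eq_bigr => v3 _; rewrite /= !lsum_bind big_map !mulr_sumr -!big_split mulr_sumr.
apply: eq_bigr => -[[[r1 r2] r3] r4] _; rewrite /= /lsum -map_comp big_map.
rewrite !mulr_sumr -!big_split mulr_sumr.
apply: eq_bigr => -[[[t1 t2] t3] t4] _.
rewrite /= !(zr5_valM, zr5_valD).
move: (zv (recip_dim v1)) (zv (recip_dim v2)) (zv (signed_recip_dim2 v3)) => b1 b2 b3.
move: (zv (recip_dim r1)) (zv (recip_dim r2)) (zv (recip_dim r3)) (zv (recip_dim r4)) => b4 b5 b6 b7.
move: (zv (recip_dim t1)) (zv (recip_dim t2)) (zv (recip_dim t3)) (zv (recip_dim t4)) => b8 b9 c1 c2.
move: (zv (entry_at _ _ _ _ _ _ _ _ _)) => q1; move: (zv (entry_at _ _ _ _ _ _ _ _ _)) => q2.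
move: (zv (entry_at _ _ _ _ _ _ _ _ _)) => q3; move: (zv (entry_at _ _ _ _ _ _ _ _ _)) => q4.
move: (zv _) (zv _) (zv _) (zv _) (zv _) (column _ _ _) => *; ring.
Qed.

End Sums.

(** * The relations for kappa = 1 *)

(** Both sides share the factor sx; V and W collect the units of the inverse dimensions, and
    the hypothesis on 24 V n compares the two normalizations. *)
Lemma relation_algebra (F : numFieldType) (sx K W V w n c d : F)
    (j J m1 m2 m3 m4 c1 c2 c3 c4 F1 F2 F3 F4 : F) :
  sx != 0 -> c != 0 ->
  sx * J = K * V * j ->
  sx * F1 = K * K * w * W * c1 -> sx * F2 = K * K * w * W * c2 ->
  sx * F3 = K * K * w * W * c3 -> sx * F4 = K * K * w * W * c4 ->
  c * j = w * n * (m1 * c1 + m2 * c2 + m3 * c3 + m4 * c4) ->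
  24 * V * n = c * d * K * W ->
  J = d * (m1 / 24) * F1 + d * (m2 / 24) * F2 + d * (m3 / 24) * F3 + d * (m4 / 24) * F4.
Proof.
move=> sx0 c0 eJ e1 e2 e3 e4 ej en.
apply: (mulfI sx0); apply: (mulfI c0); rewrite eJ.
rewrite (_ : c * (K * V * j) = K * V * (c * j)); last by ring.
rewrite ej (_ : K * V * _ = K * w * (24 * V * n) * (m1 * c1 + m2 * c2 + m3 * c3 + m4 * c4) / 24); last by field.
rewrite en (_ : sx * _ = d * (m1 * (sx * F1) + m2 * (sx * F2) + m3 * (sx * F3) + m4 * (sx * F4)) / 24); last by field.
by rewrite e1 e2 e3 e4; field.
Qed.

Section Relations.
Context (R : realType) (dim : vertex -> R).
Hypothesis dim_gt0 : forall v, 0 < dim v.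
Hypothesis dim_eigen : forall v, \sum_(w | adj v w) dim w = delta R * dim v.
Context (A B : gpa R 4 true).
Local Notation s5 := (@Num.sqrt R 5).
Local Notation K := (spoke_scale dim / 8).
Hypothesis A_val : spoke_values dim A arrayA K.
Hypothesis B_val : spoke_values dim B arrayB K.

Local Notation zv := (zr5_val R).
Local Notation sd x := (sdim dim (decode x)).
Local Notation wu b := (weight_unit dim b).

Lemma relation_sums g i x : x \in codes ->
  let C := circ_sum dim g x in let M := row i x in
  zv (if even_code x then (Zpos 1536, Z0) else (Zpos 6144, Z0))
    * jelly_sum dim g x (if i then arrayB else arrayA)
  = zv (recip_dim x) * zv (recip_dim x) * zv (Zpos 199, Zpos 89)
    * (zv M.1.1 * C arrayA arrayA + zv M.1.2 * C arrayA arrayB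
       + zv M.2.1 * C arrayB arrayA + zv M.2.2 * C arrayB arrayB).
Proof.
move=> xc C M.
have cert : certified i x.
  by have /andP[] := allP all_certified x xc; case: (i).
have := cancels_lsum (spine_sums dim_gt0 dim_eigen g xc) (fun w => @spine_zero R dim dim_gt0 dim_eigen g x w xc) cert.
rewrite /relation_list lsum_cat lsum_jelly_list lsum_circ_list -/M -/C zr5_valN !zr5_valM.
by rewrite mulNr => /eqP; rewrite subr_eq0 => /eqP.
Qed.

Lemma scale_center : K * (unit_dim dim)%:C^-1 ^+ 5 = (2 + sqrt5 R) ^+ 3 * (1 + sqrt5 R) ^+ 2 * (3 + sqrt5 R) / 8.
Proof.
have : unit_dim dim != 0 by rewrite gt_eqF // unit_dim_gt0.
rewrite /spoke_scale -(fmorph_eq0 (real_complex R)); move: (unit_dim dim) => t t0.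
rewrite !(rmorphM, rmorphXn, rmorphD, rmorph_nat, rmorph1) /= -/(sqrt5 R) -/(deltaC R).
rewrite -deltaC_sqr; move: t0; rewrite /=; move: t%:C (sqrt5 R) (deltaC R) => {}t s d t0; by field.
Qed.

Lemma zr5_val_number : zv (Zpos 199, Zpos 89) = 199 + 89 * sqrt5 R.
Proof. by []. Qed.

(** (2 + sqrt 5)^3 (1 + sqrt 5)^2 is what remains of [spoke_scale] when the units cancel. *)
Lemma number_factored : (2 + sqrt5 R) ^+ 3 * (1 + sqrt5 R) ^+ 2 = 2 * zv (Zpos 199, Zpos 89).
Proof.
rewrite zr5_val_number; have := sqrt5_sqr R; move: (sqrt5 R) => s ss.
have -> : (2 + s) ^+ 3 * (1 + s) ^+ 2
  = 8 + 28 * s + 38 * (s * s) + 25 * (s * s * s) + 8 * (s * s * (s * s)) + s * s * (s * s) * s by ring.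
by rewrite ss; ring.
Qed.

Lemma weight_unit_even : wu true = (unit_dim dim)%:C^-1.
Proof. by rewrite /weight_unit; move: (unit_dim dim) => t; rewrite fmorphV. Qed.

Lemma weight_unit_odd : wu false = (4 * deltaC R * (unit_dim dim)%:C)^-1.
Proof.
rewrite /weight_unit; move: (unit_dim dim) => t.
by rewrite fmorphV !rmorphM rmorph_nat.
Qed.

Lemma scale_even : K * (wu false ^+ 2 * wu true ^+ 3) = zv (Zpos 199, Zpos 89) / 64.
Proof.
rewrite weight_unit_even weight_unit_odd; have d0 := deltaC_neq0 R.
transitivity (K * (unit_dim dim)%:C^-1 ^+ 5 / (deltaC R * deltaC R * 16)).
  have t0 : (unit_dim dim)%:C != 0 :> R[i] by rewrite fmorph_eq0 gt_eqF // unit_dim_gt0.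
  move: (spoke_scale dim) d0 t0; move: (unit_dim dim)%:C (deltaC R) => t d k d0 t0.
  by field; rewrite d0.
have e0 : 3 + sqrt5 R != 0 by rewrite -deltaC_sqr mulf_neq0.
rewrite scale_center number_factored deltaC_sqr; move: (zv _) e0 => n e0; by field.
Qed.

Lemma scale_odd : deltaC R * K * (wu true ^+ 2 * wu false ^+ 3) = zv (Zpos 199, Zpos 89) / 256.
Proof.
rewrite -[RHS]mulr1; have d0 := deltaC_neq0 R.
transitivity (zv (Zpos 199, Zpos 89) / 64 * (1 / 4)); last by move: (zv _) => n; field.
rewrite -scale_even weight_unit_even weight_unit_odd.
have t0 : (unit_dim dim)%:C != 0 :> R[i] by rewrite fmorph_eq0 gt_eqF // unit_dim_gt0.
move: (spoke_scale dim) d0 t0; move: (unit_dim dim)%:C (deltaC R) => t d k d0 t0.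
by field; rewrite ?t0 ?d0.
Qed.

Lemma relation_even (g : loop 5 true) i :
  exists2 x, even_code x &
  f_jelly dim (fourier dim (if i then B else A)) g
  = zv (row i x).1.1 / 24 * f_circ dim A A g + zv (row i x).1.2 / 24 * f_circ dim A B g
    + zv (row i x).2.1 / 24 * f_circ dim B A g + zv (row i x).2.2 / 24 * f_circ dim B B g.
Proof.
have [x xc gx] := vertex_decode (head root_vertex g); exists x.
  by rewrite -even_vertex_decode // -gx; case/and3P: (valP g) => _ _ /eqP.
have xe : even_code x.
  by rewrite -even_vertex_decode // -gx; case/and3P: (valP g) => _ _ /eqP.
have rel := relation_sums g i xc; rewrite xe in rel.
have arr_val : spoke_values dim (if i then B else A) (if i then arrayB else arrayA) K by case: (i).
have J := @f_jelly_value R dim dim_gt0 dim_eigen false g _ _ _ x arr_val xc gx.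
have CAA := @f_circ_value R dim dim_gt0 dim_eigen true g A A _ _ _ x A_val A_val xc gx.
have CAB := @f_circ_value R dim dim_gt0 dim_eigen true g A B _ _ _ x A_val B_val xc gx.
have CBA := @f_circ_value R dim dim_gt0 dim_eigen true g B A _ _ _ x B_val A_val xc gx.
have CBB := @f_circ_value R dim dim_gt0 dim_eigen true g B B _ _ _ x B_val B_val xc gx.
have sx : sd x ^+ 3 != 0 by rewrite expf_neq0 // sdim_neq0.
have c0 : zv (Zpos 1536, Z0) != 0 by rewrite /zr5_val mul0r addr0 intr_eq0.
have key : 24 * (wu false ^+ 5 * wu (~~ false) ^+ 4) * zv (Zpos 199, Zpos 89)
     = zv (Zpos 1536, Z0) * 1 * K * (wu true * wu (~~ true)) ^+ 7.
  rewrite (_ : zv (Zpos 1536, Z0) = 1536); last by rewrite /zr5_val mul0r addr0.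
  rewrite [~~ true]/= [~~ false]/=.
  rewrite (_ : zv (Zpos 199, Zpos 89) = 64 * (K * (wu false ^+ 2 * wu true ^+ 3))).
    by move: (wu _) (wu _) (spoke_scale dim) => a b k; field.
  by rewrite scale_even; move: (zv _) => n; field.
have := relation_algebra sx c0 J CAA CAB CBA CBB rel key.
by rewrite !mul1r.
Qed.

Lemma relation_odd (g : loop 5 false) i :
  exists2 x, even_code x = false &
  f_jelly dim (if i then B else A) (g : loop 5 (~~ true))
  = deltaC R * (zv (row i x).1.1 / 24) * f_circ dim (fourier dim A) (fourier dim A) g
    + deltaC R * (zv (row i x).1.2 / 24) * f_circ dim (fourier dim A) (fourier dim B) g
    + deltaC R * (zv (row i x).2.1 / 24) * f_circ dim (fourier dim B) (fourier dim A) g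
    + deltaC R * (zv (row i x).2.2 / 24) * f_circ dim (fourier dim B) (fourier dim B) g.
Proof.
have [x xc gx] := vertex_decode (head root_vertex g); exists x.
  by rewrite -even_vertex_decode // -gx; case/and3P: (valP g) => _ _ /eqP.
have xe : even_code x = false.
  by rewrite -even_vertex_decode // -gx; case/and3P: (valP g) => _ _ /eqP.
have rel := relation_sums g i xc; rewrite xe in rel.
have arr_val : spoke_values dim (if i then B else A) (if i then arrayB else arrayA) K by case: (i).
have J := @f_jelly_value R dim dim_gt0 dim_eigen true g _ _ _ x arr_val xc gx.
have CAA := @f_circ_value R dim dim_gt0 dim_eigen false g A A _ _ _ x A_val A_val xc gx.
have CAB := @f_circ_value R dim dim_gt0 dim_eigen false g A B _ _ _ x A_val B_val xc gx.
have CBA := @f_circ_value R dim dim_gt0 dim_eigen false g B A _ _ _ x B_val A_val xc gx.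
have CBB := @f_circ_value R dim dim_gt0 dim_eigen false g B B _ _ _ x B_val B_val xc gx.
have sx : sd x ^+ 3 != 0 by rewrite expf_neq0 // sdim_neq0.
have c0 : zv (Zpos 6144, Z0) != 0 by rewrite /zr5_val mul0r addr0 intr_eq0.
have key : 24 * (wu true ^+ 5 * wu (~~ true) ^+ 4) * zv (Zpos 199, Zpos 89)
     = zv (Zpos 6144, Z0) * deltaC R * K * (wu false * wu (~~ false)) ^+ 7.
  rewrite (_ : zv (Zpos 6144, Z0) = 6144); last by rewrite /zr5_val mul0r addr0.
  rewrite [~~ true]/= [~~ false]/=.
  rewrite (_ : zv (Zpos 199, Zpos 89) = 256 * (deltaC R * K * (wu true ^+ 2 * wu false ^+ 3))).
    by move: (wu _) (wu _) (spoke_scale dim) (deltaC R) => a b k e; field.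
  by rewrite scale_odd; move: (zv _) => n; field.
exact: (relation_algebra sx c0 J CAA CAB CBA CBB rel key).
Qed.

End Relations.

(** * The trace of the square of a generator *)

(** The terms of the trace of S^2: two walks from x to v4 form a closed walk, and S is
    evaluated on it and on its reverse. *)
Definition trace_list arr : seq (zr5 * seq nat) :=
  bind [seq x <- codes | even_code x] (fun x =>
  bind (nbrs x) (fun v1 => bind (nbrs v1) (fun v2 => bind (nbrs v2) (fun v3 =>
  bind (nbrs v3) (fun v4 =>
    let W := zr5_mul (recip_dim x) (recip_dim4 (v1, v2, v3, v4)) in
    bind (nbrs x) (fun r1 => bind (nbrs r1) (fun r2 =>
      [seq (zr5_mul (zr5_mul W (zr5_mul (recip_dim r1) (zr5_mul (recip_dim r2) (recip_dim r3))))
             (zr5_mul (entry_at arr x v1 v2 v3 v4 r3 r2 r1)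
                (entry_at arr x r1 r2 r3 v4 v3 v2 v1)), [::])
      | r3 <- nbrs r2 & adj_code r3 v4]))))))).

Definition total (l : seq (zr5 * seq nat)) : zr5 :=
  foldr (fun e c => zr5_add e.1 c) (Z0, Z0) l.

(** The square of 199 + 89 sqrt 5, the factor by which [spoke_scale] exceeds the units, makes
    the total a multiple of 105 + 47 sqrt 5 = (10 + 4 sqrt 5) (11 + 5 sqrt 5) / 2, where
    10 + 4 sqrt 5 comes from the sum of the squared dimensions and the rest is Tr(A^2). *)
Lemma total_A :
  zr5_mul (zr5_mul (Zpos 199, Zpos 89) (Zpos 199, Zpos 89)) (total (trace_list arrayA))
  = zr5_mul (zr5_mul (Zpos 64, Z0) (Zpos 64, Z0)) (zr5_mul (Zpos 4, Z0) (Zpos 105, Zpos 47)).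
Proof. by vm_compute. Qed.

Section Trace.
Context (R : realType) (dim : vertex -> R).
Hypothesis dim_gt0 : forall v, 0 < dim v.
Hypothesis dim_eigen : forall v, \sum_(w | adj v w) dim w = delta R * dim v.
Context (S : gpa R 4 true).
Local Notation sv v := (sdim dim v).

Lemma run_four_caps psi y w1 w2 w3 x z1 z2 z3 u :
  sorted adj [:: y; w1; w2; w3; x; z3; z2; z1; u] ->
  run dim [seq Min R k | k <- rev (iota 0 4)] psi [:: y; w1; w2; w3; x; z3; z2; z1; u]
  = if [&& z1 == w1, z2 == w2, z3 == w3 & y == u] then sv x / sv y * psi [:: y] else 0.
Proof.
move=> sp; rewrite /run /=.
rewrite (@apply_min _ _ 3 [:: y; w1; w2] w3 x z3 [:: z2; z1; u]) //.
rewrite (eq_sym z3); case: eqP => [e|_]; last by rewrite ?andbF.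
rewrite -{}e in sp; move/(@sorted_adj_flat [:: y; w1; w2]): sp => sp.
rewrite (@apply_min _ _ 2 [:: y; w1] w2 w3 z2 [:: z1; u]) //.
rewrite (eq_sym z2); case: eqP => [e|_]; last by rewrite ?andbF mulr0.
rewrite -{}e in sp; move/(@sorted_adj_flat [:: y; w1]): sp => sp.
rewrite (@apply_min _ _ 1 [:: y] w1 w2 z1 [:: u]) //.
rewrite (eq_sym z1); case: eqP => [e|_]; last by rewrite ?andbF !mulr0.
rewrite -{}e in sp; move/(@sorted_adj_flat [:: y]): sp => sp.
rewrite (@apply_min _ _ 0 [::] y w1 u [::]) //.
case: eqP => [e|_]; last by rewrite ?andbF ?mulr0.
rewrite -{}e /= in sp *.
by rewrite !mulrA !turnE //; congr (_ * _); field; rewrite !sdim_neq0.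
Qed.

(** The four nested maxima create v1, .., v4 and the minima force the other side of the
    closure to repeat them. *)
Lemma closure_value (x : gpa R 4 true) v :
  state_sum dim (closure_diagram x) [:: v] [:: v]
  = \sum_(v1 | adj v v1) \sum_(v2 | adj v1 v2) \sum_(v3 | adj v2 v3) \sum_(v4 | adj v3 v4)
      (sv v4 / sv v) ^+ 2 * value x [:: v; v1; v2; v3; v4; v3; v2; v1].
Proof.
rewrite state_sum_run (_ : closure_diagram x = bent_down 0 x ++ [seq Min R k | k <- rev (iota 0 4)]) //.
rewrite run_cat (@run_bent_down _ dim dim_gt0 true x 0 [::] v [::]) //.
apply: eq_bigr => v1 a1; apply: eq_bigr => v2 a2; apply: eq_bigr => v3 a3.
apply: eq_bigr => v4 a4.
have sym := adj_sym.
rewrite (@sum_matching3 _ v v1 v2 v3 v4 (fun r1 r2 r3 => sv v4 / sv v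
   * value x [:: v; v1; v2; v3; v4; r3; r2; r1]
   * run dim [seq Min R k | k <- rev (iota 0 4)] (fun r => (r == [:: v])%:R)
       ([::] ++ [:: v; r1; r2; r3; v4; v3; v2; v1; v]))) //.
  rewrite sym a4 run_four_caps; last by rewrite /= a1 a2 a3 a4 (sym v4) a4 (sym v3) a3 (sym v2) a2 (sym v1) a1.
  by rewrite !eqxx /= mulr1; ring.
move=> r1 r2 r3 b1 b2 /andP[b3 b4] /negbTE ne.
rewrite run_four_caps ?eqxx ?andbT ?ne ?mulr0 //.
by rewrite /= b1 b2 b3 b4 (sym v4) a4 (sym v3) a3 (sym v2) a2 (sym v1) a1.
Qed.

Lemma mul_value v v1 v2 v3 v4 : even_vertex v ->
  adj v v1 -> adj v1 v2 -> adj v2 v3 -> adj v3 v4 ->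
  value (gpa_mul dim S S) [:: v; v1; v2; v3; v4; v3; v2; v1]
  = \sum_(r1 | adj v r1) \sum_(r2 | adj r1 r2) \sum_(r3 | adj r2 r3 && adj r3 v4)
      value S [:: v; v1; v2; v3; v4; r3; r2; r1] * value S [:: v; r1; r2; r3; v4; v3; v2; v1].
Proof.
move=> ve a1 a2 a3 a4; have sym := adj_sym.
have lp : is_loop 4 true [:: v; v1; v2; v3; v4; v3; v2; v1].
  by rewrite /is_loop /= ve a1 a2 a3 a4 (sym v4) a4 (sym v3) a3 (sym v2) a2 (sym v1) a1.
have [g gE] := is_loopP lp.
rewrite gE value_loop /gpa_mul /of_diagram ffunE -gE state_sum_run run_cons run1.
rewrite [take _ _]/= [head _ _]/= [drop _ _]/= [rev _]/=.
rewrite (@apply_box _ dim 3 true 0 S [::] v [:: v1; v2; v3] v4 [::]) //; last first.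
  by rewrite /= a1 a2 a3 a4.
rewrite (sum_walk3 v v4 (fun t => value S (v :: [:: v1; v2; v3] ++ v4 :: rev t) *
  apply_event dim (Box 0 S) (fun q => (q == [:: v; v1; v2; v3; v4])%:R) ([::] ++ v :: t ++ [:: v4]))).
apply: eq_bigr => r1 b1; apply: eq_bigr => r2 b2; apply: eq_bigr => r3 /andP[b3 b4].
congr (_ * _).
have := @apply_box_delta R dim true 3 S v [:: r1; r2; r3] v4 [:: v1; v2; v3].
rewrite /= b1 b2 b3 b4 a1 a2 a3 a4; exact.
Qed.

Lemma sum_codes (V : nmodType) (P : pred vertex) (f : vertex -> V) :
  \sum_(v | P v) f v = \sum_(x <- codes | P (decode x)) f (decode x).
Proof.
rewrite -(big_map decode P f) [RHS]big_mkcond [RHS]big_uniq; last first.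
  by rewrite map_inj_in_uniq; [|exact: decode_inj].
rewrite big_mkcond; apply: eq_bigl => v; symmetry.
by have [x xc ->] := vertex_decode v; rewrite map_f.
Qed.

Local Notation sd x := (sdim dim (decode x)).
Local Notation zv := (zr5_val R).
Local Notation id x := (inv_dim dim x).
Local Notation wu b := (weight_unit dim b).

(** Both loops run through the same vertices, so all the signs cancel. *)
Lemma trace_algebra (F : fieldType) (x v1 v2 v3 v4 r1 r2 r3 : F)
    (ex e1 e2 e3 e4 f1 f2 f3 s t K A T : F) :
  [/\ x != 0, v1 != 0, v2 != 0, v3 != 0 & v4 != 0] ->
  [/\ r1 != 0, r2 != 0 & r3 != 0] ->
  [/\ ex * ex = 1, e1 * e1 = 1, e2 * e2 = 1, e3 * e3 = 1 & e4 * e4 = 1] ->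
  [/\ f1 * f1 = 1, f2 * f2 = 1 & f3 * f3 = 1] ->
  x * (v1 * (v2 * (v3 * (v4 * (r3 * (r2 * (r1 * 1))))))) * (x * v4) * s
    = ex * e1 * e2 * e3 * e4 * f3 * f2 * f1 * (K * A) ->
  x * (r1 * (r2 * (r3 * (v4 * (v3 * (v2 * (v1 * 1))))))) * (x * v4) * t
    = ex * f1 * f2 * f3 * e4 * e3 * e2 * e1 * (K * T) ->
  (x * x) ^+ 2 * ((v4 / x) ^+ 2 * (s * t))
  = K * K * (x^-1 * x^-1 * (v1^-1 * v1^-1 * (v2^-1 * v2^-1) * (v3^-1 * v3^-1 * (v4^-1 * v4^-1)))
      * (r1^-1 * r1^-1 * (r2^-1 * r2^-1 * (r3^-1 * r3^-1)))) * (A * T).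
Proof.
move=> [x0 v10 v20 v30 v40] [r10 r20 r30].
move=> [exx e11 e22 e33 e44] [f11 f22 f33] sE tE.
rewrite (canRL (mulKf _) sE) ?mulf_neq0 ?oner_neq0 //.
rewrite (canRL (mulKf _) tE) ?mulf_neq0 ?oner_neq0 //.
apply: (sign_sqr_cancel exx); apply: (sign_sqr_cancel e11); apply: (sign_sqr_cancel e22).
apply: (sign_sqr_cancel e33); apply: (sign_sqr_cancel e44); apply: (sign_sqr_cancel f11).
apply: (sign_sqr_cancel f22); apply: (sign_sqr_cancel f33).
clear sE tE exx e11 e22 e33 e44 f11 f22 f33.
by field; rewrite ?x0 ?v10 ?v20 ?v30 ?v40 ?r10 ?r20 ?r30.
Qed.

Lemma lsum_total l : lsum (fun=> 1) l = zv (total l).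
Proof.
elim: l => [|e l IH]; first by rewrite /lsum big_nil [RHS](zr5_val0 R).
by rewrite [total _]/= zr5_valD -IH /lsum big_cons mulr1.
Qed.

Lemma trace_value arr K : spoke_values dim S arr K ->
  \sum_(v | even_vertex v == true)
     (dim v ^+ 2)%:C * state_sum dim (closure_diagram (gpa_mul dim S S)) [:: v] [:: v]
  = K * K * (wu true * wu false) ^+ 4 * zv (total (trace_list arr)).
Proof.
move=> Sv; rewrite sum_codes -lsum_total /trace_list lsum_bind big_filter mulr_sumr.
rewrite big_seq_cond [RHS]big_seq_cond.
rewrite (eq_bigl (fun x => (x \in codes) && even_code x)); last first.
  by move=> x; case: (boolP (x \in codes)) => //= xc; rewrite even_vertex_decode // eqb_id.
apply: eq_bigr => x /andP[xc xe].
rewrite closure_value lsum_bind sum_nbrs // !mulr_sumr; apply: eq_big_seq => v1 a1.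
have c1 := nbrs_codes xc a1; have e1 := nbrs_even xc a1.
rewrite lsum_bind sum_nbrs // !mulr_sumr; apply: eq_big_seq => v2 a2.
have c2 := nbrs_codes c1 a2; have e2 := nbrs_even c1 a2.
rewrite lsum_bind sum_nbrs // !mulr_sumr; apply: eq_big_seq => v3 a3.
have c3 := nbrs_codes c2 a3; have e3 := nbrs_even c2 a3.
rewrite lsum_bind sum_nbrs // !mulr_sumr; apply: eq_big_seq => v4 a4.
have c4 := nbrs_codes c3 a4; have e4 := nbrs_even c3 a4.
rewrite mul_value ?adj_decode ?even_vertex_decode //.
rewrite lsum_bind sum_nbrs // !mulr_sumr; apply: eq_big_seq => r1 b1.
have d1 := nbrs_codes xc b1; have f1 := nbrs_even xc b1.
rewrite lsum_bind sum_nbrs // !mulr_sumr; apply: eq_big_seq => r2 b2.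
have d2 := nbrs_codes d1 b2; have f2 := nbrs_even d1 b2.
rewrite big_mkcondr sum_nbrs // !mulr_sumr /lsum big_map big_filter [RHS]big_mkcond.
apply: eq_big_seq => r3 b3.
have d3 := nbrs_codes d2 b3; have f3 := nbrs_even d2 b3.
rewrite adj_decode // adj_codeE; case: ifP => b4; last by rewrite !mulr0.
have sy y w : y \in codes -> w \in codes -> w \in nbrs y -> y \in nbrs w.
  by move=> yc wc; rewrite nbrs_sym.
have [a1' a2' a3' a4'] := And4 (sy _ _ xc c1 a1) (sy _ _ c1 c2 a2) (sy _ _ c2 c3 a3) (sy _ _ c3 c4 a4).
have [b1' b2' b3' b4'] := And4 (sy _ _ xc d1 b1) (sy _ _ d1 d2 b2) (sy _ _ d2 d3 b3) (sy _ _ d3 c4 b4).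
have SE := gauge_entry dim_gt0 Sv (x := x) (p1 := v1) (p2 := v2) (p3 := v3) (p4 := v4) (p5 := r3) (p6 := r2) (p7 := r1)
  ltac:(by rewrite /closed_walk /walk /= xc c1 c2 c3 c4 d1 d2 d3 a1 a2 a3 a4 b1' b2' b3' b4').
have TE := gauge_entry dim_gt0 Sv (x := x) (p1 := r1) (p2 := r2) (p3 := r3) (p4 := v4) (p5 := v3) (p6 := v2) (p7 := v1)
  ltac:(by rewrite /closed_walk /walk /= xc c1 c2 c3 c4 d1 d2 d3 b1 b2 b3 b4 a1' a2' a3' a4').
have n y : sd y != 0 by apply: sdim_neq0.
rewrite xe /gauge in SE TE; rewrite !big_cons !big_nil in SE; rewrite !big_cons !big_nil in TE.
have := @trace_algebra _ _ _ _ _ _ _ _ _ _ _ _ _ _ _ _ _ _ _ _ _ _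
  (And5 (n x) (n v1) (n v2) (n v3) (n v4)) (And3 (n r1) (n r2) (n r3))
  (And5 (eps_sqr R x) (eps_sqr R v1) (eps_sqr R v2) (eps_sqr R v3) (eps_sqr R v4))
  (And3 (eps_sqr R r1) (eps_sqr R r2) (eps_sqr R r3)) SE TE.
rewrite sdim_sqr // -rmorphXn => E; apply: (etrans E); rewrite -!/(inv_dim dim _).
have ID := inv_dim_recip dim_gt0 dim_eigen.
rewrite !ID // f3 f2 f1 e4 e3 e2 e1 xe /= !zr5_valM.
move: (zv (recip_dim x)) (zv (recip_dim v1)) (zv (recip_dim v2)) (zv (recip_dim v3)) (zv (recip_dim v4)) => b5 b6 b7 b8 b9.
move: (zv (recip_dim r1)) (zv (recip_dim r2)) (zv (recip_dim r3)) => d5 d6 d7.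
move: (zv _) (zv _) (wu _) (wu _) => *; ring.
Qed.

End Trace.

(** * The entries of the second matrix *)

Section Lambda.
Context (R : realType).
Local Notation s5 := (@Num.sqrt R 5).

Lemma norm_real (x : R) : `|x%:C| = `|x|%:C :> R[i].
Proof. by rewrite normc_def /= expr0n addr0 sqrtr_sqr. Qed.

(** A polynomial a X^4 - b X^2 + c with roots r, -r, t, -t. *)
Lemma even_quartic_root (a b c : nat) (r t : R) (z : R[i]) :
  a%:R * (r ^+ 2 + t ^+ 2) = b%:R -> a%:R * (r * t) ^+ 2 = c%:R ->
  (Poly (rev [:: a%:R; 0; - b%:R; 0; c%:R])).[z]
  = a%:R * ((z - r%:C) * (z + r%:C) * ((z - t%:C) * (z + t%:C))) :> R[i].
Proof.
move=> eb ec; rewrite horner_Poly /= mul0r add0r addr0 !addr0.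
rewrite -(rmorph_nat (real_complex R) b) -(rmorph_nat (real_complex R) c) -eb -ec.
rewrite !(rmorphM, rmorphXn, rmorphD, rmorph_nat) /=; ring.
Qed.

(** All the roots are real, and r is within e of the target while the others are not, so the
    closest root is unique. *)
Lemma lambda_even_quartic (a b c : nat) (r t e q : R) (z : R[i]) : (0 < a)%N ->
  a%:R * (r ^+ 2 + t ^+ 2) = b%:R -> a%:R * (r * t) ^+ 2 = c%:R ->
  z = q%:C -> - e < r - q < e ->
  (forall x, x \in [:: - r; t; - t] -> (x - q <= - e) || (e <= x - q)) ->
  lambda [:: a%:R; 0; - b%:R; 0; c%:R] z = r%:C.
Proof.
move=> a0 eb ec -> rq far.
have rootE y : root (Poly (rev [:: a%:R; 0; - b%:R; 0; c%:R])) y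
    = (y == r%:C) || (y \in [seq x%:C | x <- [:: - r; t; - t]]).
  rewrite /root (even_quartic_root y eb ec) !mulf_eq0 pnatr_eq0 (gtn_eqF a0) /=.
  by rewrite !inE !rmorphN /= !subr_eq0 !addr_eq0 -!orbA.
have closer y : y \in [seq x%:C | x <- [:: - r; t; - t]] -> `|r%:C - q%:C| < `|y - q%:C|.
  case/mapP=> x xs ->; rewrite -!rmorphB !norm_real ltcR.
  have rq' : `|r - q| < e by rewrite ltr_norml.
  apply: lt_le_trans rq' _; case/orP: (far x xs) => h; last first.
    by apply: le_trans h (ler_norm _).
  by rewrite -normrN; apply: le_trans (ler_norm _); rewrite lerNr.
apply: xget_unique => [|y [yr ymin]]; rewrite /closest_root.
  split=> [|y]; first by rewrite rootE eqxx.
  by rewrite rootE => /orP[/eqP -> //|/closer/ltW].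
move: yr; rewrite rootE => /orP[/eqP //|/closer].
move=> /lt_geF h; have := ymin r%:C; rewrite rootE eqxx h => /(_ isT).
by [].
Qed.

Local Notation d := (delta R).

Lemma sqrt5_bounds : 223 / 100 < s5 < 224 / 100.
Proof.
have ss : s5 * s5 = 5 by rewrite -expr2 sqr_sqrtr.
by have s0 := s5_gt0 R; apply/andP; split; nra.
Qed.

Lemma delta_bounds : 228 / 100 < d < 229 / 100.
Proof.
have dd := delta_sqr R; have d0 := delta_gt0 R; have /andP[s1 s2] := sqrt5_bounds.
by apply/andP; split; nra.
Qed.

(** With the previous bounds this makes the comparison of the roots linear: each root is a
    combination of delta and delta sqrt 5. *)
Lemma delta_sqrt5_bounds : 511 / 100 < d * s5 < 512 / 100.
Proof.
have ss : s5 * s5 = 5 by rewrite -expr2 sqr_sqrtr.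
have pp : (d * s5) * (d * s5) = 15 + 5 * s5.
  by rewrite mulrACA (delta_sqr R) ss; ring.
have /andP[s1 s2] := sqrt5_bounds; have p0 : 0 < d * s5 by rewrite mulr_gt0 ?delta_gt0 ?s5_gt0.
by move: p0 pp; move: (d * s5) => p p0 pp; apply/andP; split; nra.
Qed.

Lemma decimal (m : nat) : m%:R / 10000%:R = ((m%:R : R) / 10000)%:C :> R[i].
Proof. by rewrite rmorphM fmorphV !rmorph_nat. Qed.

Lemma sqrt5_powers : [/\ s5 ^+ 2 = 5, s5 ^+ 3 = 5 * s5, s5 ^+ 4 = 25, s5 ^+ 5 = 25 * s5
  & s5 ^+ 6 = 125].
Proof.
have ss : s5 ^+ 2 = 5 by rewrite sqr_sqrtr.
split=> //; first by rewrite exprSr ss.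
- by rewrite (exprM s5 2 2) ss; ring.
- by rewrite exprSr (exprM s5 2 2) ss; ring.
- by rewrite (exprM s5 2 3) ss; ring.
Qed.

(** The target m / 10000 is replaced by the bounds h / 100 and (h + 1) / 100, since two digits
    separate the roots. *)
Lemma lambda_delta (a b c m h : nat) (neg : bool) (k l : R) : (0 < a)%N ->
  (100 * h <= m <= 100 * h.+1)%N ->
  a%:R * ((3 + s5) * (k ^+ 2 + l ^+ 2)) = b%:R ->
  a%:R * ((3 + s5) * (k * l)) ^+ 2 = c%:R ->
  (forall q : R, h%:R / 100 <= q <= h.+1%:R / 100 ->
     let z := if neg then - q else q in
     - (1 / 10) < d * k - z < 1 / 10 /\
     forall x, x \in [:: - (d * k); d * l; - (d * l)] -> (x - z <= - (1 / 10)) || (1 / 10 <= x - z)) ->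
  lambda [:: a%:R; 0; - b%:R; 0; c%:R]
     (if neg then - (m%:R / 10000%:R) else m%:R / 10000%:R) = (d * k)%:C.
Proof.
move=> a0 mh eb ec apart.
have q_int : h%:R / 100 <= (m%:R : R) / 10000 <= h.+1%:R / 100.
  have -> : 10000 = 100 * 100 :> R by rewrite -natrM.
  have [m1 m2] : 100 * h%:R <= m%:R :> R /\ m%:R <= 100 * h.+1%:R :> R.
    by case/andP: mh => m1 m2; rewrite -!natrM !ler_nat.
  by move: m1 m2; move: (m%:R : R) (h%:R : R) (h.+1%:R : R) => x y z m1 m2; apply/andP; split; lra.
have [near far] := apart _ q_int.
apply: lambda_even_quartic near far => //.
- by rewrite -eb -(delta_sqr R); ring.
- by rewrite -ec -(delta_sqr R); ring.
- by rewrite decimal; case: (neg); rewrite ?rmorphN.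
Qed.

Local Ltac closest lem :=
  apply: lem => //;
  [ by have [s2 s3 s4 s5' s6] := sqrt5_powers; lra
  | by have [s2 s3 s4 s5' s6] := sqrt5_powers; lra
  | have /andP[p1 p2] := delta_sqrt5_bounds; have /andP[d1 d2] := delta_bounds;
    move=> q /andP[q1 q2]; split; [by apply/andP; split; lra|];
    by move=> x; rewrite !inE => /or3P[] /eqP ->; apply/orP;
       first [by left; lra | by right; lra] ].

Lemma lambda_a_neg : lambda [:: 64; 0; - 216; 0; 121] (- (8422 / 10000)) = (d * ((3 - 2 * s5) / 4))%:C.
Proof.
closest (@lambda_delta 64 216 121 8422 84 true ((3 - 2 * s5) / 4) ((3 * s5 - 1) / 8)).
Qed.

Lemma lambda_a_pos : lambda [:: 64; 0; - 216; 0; 121] (8422 / 10000) = (d * ((2 * s5 - 3) / 4))%:C.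
Proof.
closest (@lambda_delta 64 216 121 8422 84 false ((2 * s5 - 3) / 4) ((3 * s5 - 1) / 8)).
Qed.

Lemma lambda_b_neg : lambda [:: 64; 0; - 24; 0; 1] (- (2185 / 10000)) = (d * ((s5 - 3) / 8))%:C.
Proof.
closest (@lambda_delta 64 24 1 2185 21 true ((s5 - 3) / 8) (1 / 4)).
Qed.

Lemma lambda_b_pos : lambda [:: 64; 0; - 24; 0; 1] (2185 / 10000) = (d * ((3 - s5) / 8))%:C.
Proof.
closest (@lambda_delta 64 24 1 2185 21 false ((3 - s5) / 8) (1 / 4)).
Qed.

Lemma lambda_c : lambda [:: 5184; 0; - 3024; 0; 121] (7349 / 10000) = (d * ((1 + 3 * s5) / 24))%:C.
Proof.
closest (@lambda_delta 5184 3024 121 7349 73 false ((1 + 3 * s5) / 24) ((9 - 5 * s5) / 24)).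
Qed.

Lemma lambda_d : lambda [:: 64; 0; - 1296; 0; 81] (- (2504 / 10000)) = (d * ((9 * s5 - 21) / 8))%:C.
Proof.
closest (@lambda_delta 64 1296 81 2504 25 true ((9 * s5 - 21) / 8) ((9 + 3 * s5) / 8)).
Qed.

End Lambda.

(** * The normalization of the generators *)

Section Kappa.
Context (R : realType) (dim : vertex -> R).
Hypothesis dim_gt0 : forall v, 0 < dim v.
Hypothesis dim_eigen : forall v, \sum_(w | adj v w) dim w = delta R * dim v.
Local Notation zv := (zr5_val R).
Local Notation wu b := (weight_unit dim b).
Local Notation s5 := (@Num.sqrt R 5).

Lemma generator_spoke_values kappa S t s arr : is_generator dim kappa t S ->
  tabulated t s -> array_ok s arr ->
  spoke_values dim S arr (spoke_scale dim * (kappa%:C / 8)).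
Proof.
move=> S_gen ts arr_ok'; have [unc srho _ _] := S_gen.
by split=> // a b c d a4 b4 c4 d4; apply: (spoke_gauge_entry dim_gt0 dim_eigen S_gen ts).
Qed.

(** The even vertices are the four spokes and the four leaves. *)
Lemma sum_even_dims :
  \sum_(v | even_vertex v == true) dim v ^+ 2 = 4 * (10 + 4 * s5) * unit_dim dim ^+ 2.
Proof.
pose F x := dim (decode x) ^+ 2; pose t := unit_dim dim.
have F0 j : (j < 4)%N -> F (Some (j, 0%N)) = ((2 + s5) * t) ^+ 2.
  by move=> j4; rewrite /F; have [-> _ _] := dims dim_eigen j4.
have F2 j : (j < 4)%N -> F (Some (j, 2%N)) = t ^+ 2.
  by move=> j4; rewrite /F; have [_ _ ->] := dims dim_eigen j4.
rewrite sum_codes big_mkcond.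
rewrite (eq_big_seq (fun x => if even_code x then F x else 0)); last first.
  by move=> x xc; rewrite even_vertex_decode // eqb_id.
clearbody F; rewrite unlock /= !F0 // !F2 // -/t.
have ss : s5 ^+ 2 = 5 by rewrite sqr_sqrtr.
transitivity (4 * (5 + 4 * s5 + s5 ^+ 2) * t ^+ 2); first by ring.
by rewrite ss; ring.
Qed.

(** The trace is kappa^2 times the value for kappa = 1, which is the prescribed one; kappa is
    positive. *)
Lemma kappa_eq1 kappa S : 0 < kappa -> is_generator dim kappa (tableA R) S ->
  gpa_trace dim (gpa_mul dim S S) = ((11 + 5 * s5) / 2)%:C -> kappa = 1.
Proof.
move=> k0 S_gen; have Sv := generator_spoke_values S_gen (tableA_tabulated R) arrayA_ok.
rewrite /gpa_trace (trace_value dim_gt0 dim_eigen Sv) sum_even_dims => E.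
move: E; have := scale_even dim_gt0.
have d0 : (unit_dim dim)%:C != 0 :> R[i] by rewrite fmorph_eq0 gt_eqF // unit_dim_gt0.
have s0 := s5_gt0 R.
have nz : (10 + 4 * s5)%:C != 0 :> R[i].
  by rewrite fmorph_eq0 gt_eqF //; lra.
have N : zv (Zpos 199, Zpos 89) ^+ 2 * zv (total (trace_list arrayA))
    = 64 * 64 * (4 * (105 + 47 * sqrt5 R)).
  rewrite expr2 -!zr5_valM total_A !zr5_valM.
  have val0 m : zv (m, Z0) = Z_val R m by rewrite /zr5_val mul0r addr0.
  by rewrite !val0.
have c1 : (4 * (10 + 4 * s5) * unit_dim dim ^+ 2)%:C
    = 4 * (10 + 4 * sqrt5 R) * (unit_dim dim)%:C ^+ 2.
  by move: (unit_dim dim) => u; rewrite !(rmorphM, rmorphXn, rmorphD, rmorph_nat).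
have c2 : ((11 + 5 * s5) / 2)%:C = (11 + 5 * sqrt5 R) / 2.
  by rewrite rmorphM fmorphV !(rmorphM, rmorphD, rmorph_nat).
have c3 : (10 + 4 * s5)%:C = 10 + 4 * sqrt5 R.
  by rewrite !(rmorphM, rmorphD, rmorph_nat).
have c4 : (105 + 47 * s5)%:C = 105 + 47 * sqrt5 R.
  by rewrite rmorphD rmorphM /= !rmorph_nat.
have nz2 : 105 + 47 * sqrt5 R != 0.
  have pos : 0 < 105 + 47 * s5 by move: s0; move: (s5) => s s0; lra.
  by rewrite -c4 fmorph_eq0 (gt_eqF pos).
rewrite c1 c2; rewrite c3 in nz; rewrite weight_unit_even => S3 E.
have {c1 c2 c3 c4}E' : kappa%:C ^+ 2 = 1.
  move: N d0 nz nz2 S3 E; have := sqrt5_sqr R.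
  move: (zv (total _)) (zv _) (spoke_scale dim) (wu false) (unit_dim dim)%:C (kappa%:C) (sqrt5 R).
  move=> T n sp wf t k s ss N t_nz nz nz2 S3 E.
  have n2 : n ^+ 2 = 64 * 64 * (sp / 8 * (wf ^+ 2 * t^-1 ^+ 3)) ^+ 2 by rewrite S3; field.
  apply: (mulIf nz2); rewrite mul1r.
  have E1 : k ^+ 2 * (n ^+ 2 * T) = 64 * 64 * 4 * (10 + 4 * s)
       * (sp * (k / 8) * (sp * (k / 8)) * (t^-1 * wf) ^+ 4 * T / (4 * (10 + 4 * s) * t ^+ 2)).
    by rewrite n2; field; rewrite t_nz nz.
  apply: (mulfI (_ : 64 * 64 * 4 != 0)); first by rewrite !mulf_neq0 ?pnatr_eq0.
  rewrite (_ : 64 * 64 * 4 * (k ^+ 2 * (105 + 47 * s)) = k ^+ 2 * (64 * 64 * (4 * (105 + 47 * s)))); last by ring.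
  rewrite -N E1 E.
  have -> : 64 * 64 * 4 * (10 + 4 * s) * ((11 + 5 * s) / 2) = 64 * 64 * 4 * (55 + 47 * s + 10 * (s * s)) by field.
  by rewrite ss; ring.
move/eqP: E'; rewrite -rmorphXn -[1](rmorph1 (real_complex R)) (inj_eq (@fmorph_inj _ _ _)).
by rewrite sqrf_eq1 => /orP[/eqP //|/eqP kN]; move: k0; rewrite kN oppr_gt0 ltr10.
Qed.
End Kappa.

(** * The two matrices *)

Section Matrices.
Context (R : realType).
Local Notation zv := (zr5_val R).

Lemma sum4 (M : 'I_4 -> R[i]) (f : nat -> R[i]) :
  \sum_(j < 4) M j * f j = M 0 * f 0%N + M 1 * f 1%N + M 2 * f 2%N + M 3 * f 3%N.
Proof.
rewrite !big_ord_recl big_ord0 addr0 !addrA.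
by congr (_ * _ + _ * _ + _ * _ + _ * _); congr M; apply: val_inj.
Qed.

Definition row_entries (i : bool) (x : code) : seq zr5 :=
  [:: (row i x).1.1; (row i x).1.2; (row i x).2.1; (row i x).2.2].

Lemma inv24 : 24^-1 = (24^-1)%:C :> R[i].
Proof. by rewrite fmorphV rmorph_nat. Qed.

Lemma Rmat_row (i : 'I_2) (j : 'I_4) x : even_code x ->
  Rmat R i j = zv (nth (Z0, Z0) (row_entries (i == 1) x) j) / 24.
Proof.
move=> xe; rewrite /row_entries /row xe /Rmat mxE /mx24 mxE inv24 zr5_valE -rmorphM /zr5_real.
congr (_ %:C); case: i => [[|[|//]] ?]; case: j => [[|[|[|[|//]]]] ?]; rewrite /= /Pos.to_nat /=; lra.
Qed.

Lemma delta_multiple c : deltaC R * (zv c / 24) = (delta R * (zr5_real R c / 24))%:C.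
Proof. by rewrite zr5_valE inv24 -!rmorphM. Qed.

Lemma Rmat_check_row (i : 'I_2) (j : 'I_4) x : even_code x = false ->
  Rmat_check R i j = deltaC R * (zv (nth (Z0, Z0) (row_entries (i == 1) x) j) / 24).
Proof.
move=> xe; rewrite delta_multiple /row_entries /row xe mxE.
case: i => [[|[|//]] ?]; case: j => [[|[|[|[|//]]]] ?]; rewrite [LHS]/=.
all: rewrite ?(lambda_a_neg, lambda_a_pos, lambda_b_neg, lambda_b_pos, lambda_c, lambda_d).
all: by congr ((_ * _)%:C); rewrite /zr5_real /= /Pos.to_nat /=; lra.
Qed.
End Matrices.

Theorem lemma4p7 (R : realType) (dim : vertex -> R)
    (dim_PF : perron_frobenius dim)
    (kappa : R) (kappa_gt0 : 0 < kappa)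
    (A B : gpa R 4 true)
    (A_gen : is_generator dim kappa (tableA R) A)
    (B_gen : is_generator dim kappa (tableB R) B)
    (TrAA : gpa_trace dim (gpa_mul dim A A) = ((11 + 5 * Num.sqrt 5) / 2)%:C) :
  let Ac := dual_gen dim 1 A in
  let Bc := dual_gen dim 1 B in
  column_relation (b := true) (Rmat R)
    [:: f_jelly dim Ac; f_jelly dim Bc]
    [:: f_circ dim A A; f_circ dim A B; f_circ dim B A; f_circ dim B B]
  /\
  column_relation (b := false) (Rmat_check R)
    [:: f_jelly dim A; f_jelly dim B]
    [:: f_circ dim Ac Ac; f_circ dim Ac Bc; f_circ dim Bc Ac; f_circ dim Bc Bc].
Proof.
have [dim_gt0 dim_eigen] := dim_PF.
have k1 := kappa_eq1 dim_gt0 dim_eigen kappa_gt0 A_gen TrAA.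
have scaleE : spoke_scale dim * (kappa%:C / 8) = spoke_scale dim / 8.
  by rewrite k1 mul1r.
have Av := generator_spoke_values dim_gt0 dim_eigen A_gen (tableA_tabulated R) arrayA_ok.
have Bv := generator_spoke_values dim_gt0 dim_eigen B_gen (tableB_tabulated R) arrayB_ok.
rewrite scaleE in Av Bv.
rewrite !dual_gen_fourier; split=> i g.
- have [x xe rel] := relation_even dim_gt0 dim_eigen Av Bv g (i == 1).
  rewrite (sum4 (Rmat R i) (fun j => nth [ffun=> 0] [:: f_circ dim A A; f_circ dim A B;
    f_circ dim B A; f_circ dim B B] j g)) !(Rmat_row R i _ xe).
  apply: etrans rel; case: i => [[|[|//]] lt]; exact: erefl.
- have [x xe rel] := relation_odd dim_gt0 dim_eigen Av Bv g (i == 1).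
  rewrite (sum4 (Rmat_check R i) (fun j => nth [ffun=> 0] [:: f_circ dim (fourier dim A) (fourier dim A);
    f_circ dim (fourier dim A) (fourier dim B); f_circ dim (fourier dim B) (fourier dim A);
    f_circ dim (fourier dim B) (fourier dim B)] j g)) !(Rmat_check_row R i _ xe).
  apply: etrans rel; case: i => [[|[|//]] lt]; exact: erefl.
Qed.
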